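(* Let $p$ be an odd prime, let $F$ be a field with $\operatorname{char}(F)\ne p$ and $\mu_p\not\subseteq F$, and let $L=F(\mu_p)$, $J=F(p)(\mu_p)$. Let $V$ be a valuation ring of $F$ with $\operatorname{char}(\overline V)\ne p$, and let $\ell$ be the number of extensions of $V$ to $L$. Let $Y$ be any extension of $V$ to $F(p)$. Then $\overline Y\cong\overline V(p)$. If $\mu_p\not\subseteq\overline V$, then $\Delta_Y=\Delta_V$. If $\mu_p\subseteq\overline V$, let $P$ be the prime ideal of $V$ maximal such that $\mu_p\not\subseteq V/P$, let $Q$ be the prime ideal of $Y$ with $Q\cap V=P$, and let $\widetilde V=V/P$ and $\widetilde Y=Y/Q$. Then $\Delta_{Y_Q}=\Delta_{V_P}$, while $\Delta_{\widetilde Y}=\mathbb Z[1/p]\otimes_{\mathbb Z}\Delta_{\widetilde V}$. Furthermore, $Y$ has exactly $\ell$ different extensions $Z_1,\dots,Z_\ell$ to $J$, and each $\overline{Z_i}\cong\overline Y(\mu_p)$ and $\Delta_{Z_i}=\Delta_Y$.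
   Context: For a field $K$, $K(p)$ denotes the maximal $p$-extension of $K$ (the compositum of all finite Galois extensions of $K$ of $p$-power degree). $\mu_p$ is the group of $p$-th roots of unity; for a domain $R$ of characteristic $\ne p$, $\mu_p\subseteq R$ means that $R$ contains a primitive $p$-th root of unity. A valuation ring of a field $K$ has quotient field $K$ (the trivial one is allowed). For a valuation ring $W$ of $K$: $\overline W$ is its residue field, $\Delta_W$ its value group (written additively). For a field $K'\supseteq K$, an extension of $W$ to $K'$ is a valuation ring $W'$ of $K'$ with $W'\cap K=W$; then $\Delta_W$ is regarded as a subgroup of $\Delta_{W'}$, and value groups of algebraic extensions are viewed inside the divisible hull $\mathbb Q\otimes_{\mathbb Z}\Delta_W$. The ideal $P$ is the union of all prime ideals $\mathfrak P$ of $V$ such that $V/\mathfrak P$ contains no primitive $p$-th root of unity; it is itself such a prime ideal (possibly $(0)$). $V_P$ and $Y_Q$ are localizations (valuation rings of $F$ and $F(p)$ respectively), and $\widetilde V=V/P$, $\widetilde Y=Y/Q$ are valuation rings of the residue fields $\overline{V_P}$, $\overline{Y_Q}$. *)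

(* Defs.v *)
From HB Require Import structures.
From mathcomp Require Import all_boot all_order all_algebra all_field.
From mathcomp Require Import boolp classical_sets functions cardinality.

Set Implicit Arguments.
Unset Strict Implicit.
Unset Printing Implicit Defensive.

Import GRing.Theory Num.Theory.

Local Open Scope classical_set_scope.
Local Open Scope quotient_scope.
Local Open Scope ring_scope.

Definition subfield_set (K : fieldType) (S : set K) : Prop :=
  divring_closed [in S].

Definition generated_subfield (K : fieldType) (A : set K) : set K :=
  smallest (@subfield_set K) A.

Definition has_mup (p : nat) (K : fieldType) (R : set K) : Prop :=
  exists2 z : K, R z & p.-primitive_root z.

(* The compositum, inside Omega, of the images of all the finite Galois
   extensions N of K of p-power degree; the field K itself is among them
   (N = K, n = 0). *)
Definition p_compositum (p : nat) (K Omega : fieldType)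
    (f : {rmorphism K -> Omega}) : set Omega :=
  generated_subfield [set x : Omega |
    exists (n : nat) (N : splittingFieldType K) (j : {rmorphism N -> Omega}),
      [/\ galois 1%AS {:N}, \dim {:N} = (p ^ n)%N,
          (forall a : K, j a%:A = f a) & range j x]].

(* The extension f : K -> M is (up to K-isomorphism) K(p): it is carried onto
   the compositum above by some embedding of M in an algebraically closed
   field. *)
Definition is_max_p_extension (p : nat) (K M : fieldType)
    (f : {rmorphism K -> M}) : Prop :=
  exists (Omega : fieldType) (g : {rmorphism M -> Omega}),
    GRing.closed_field_axiom Omega /\ range g = p_compositum p (g \o f).

(* The extension f : K -> M is K(mu_p). *)
Definition is_mup_extension (p : nat) (K M : fieldType)
    (f : {rmorphism K -> M}) : Prop :=
  has_mup p [set: M] /\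
  generated_subfield (range f `|` [set z : M | z ^+ p = 1]) = [set: M].

Record valuation_ring (K : fieldType) := ValuationRing {
  vr_set :> set K;
  vr_subring : subring_closed [in vr_set];
  vr_total : forall x : K, vr_set x \/ vr_set x^-1
}.

Section ValuationRing.
Variables (K : fieldType) (W : valuation_ring K).

Lemma vr1 : vr_set W 1.
Proof. by have [/set_mem] := vr_subring W. Qed.

Lemma vrB x y : vr_set W x -> vr_set W y -> vr_set W (x - y).
Proof.
by move=> Wx Wy; have [_ + _] := vr_subring W; move=> /(_ x y) h;
  apply/set_mem/h; apply/mem_set.
Qed.

Lemma vrM x y : vr_set W x -> vr_set W y -> vr_set W (x * y).
Proof.
by move=> Wx Wy; have [_ _] := vr_subring W; move=> /(_ x y) h;
  apply/set_mem/h; apply/mem_set.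
Qed.

Lemma vr0 : vr_set W 0.
Proof. by rewrite -(subrr 1); apply: vrB vr1 vr1. Qed.

Lemma vrN x : vr_set W x -> vr_set W (- x).
Proof. by move=> Wx; rewrite -sub0r; apply: vrB vr0 Wx. Qed.

Lemma vrD x y : vr_set W x -> vr_set W y -> vr_set W (x + y).
Proof. by move=> Wx Wy; rewrite -[y]opprK; apply/vrB/vrN. Qed.

Definition vr_pred : {pred K} := [in (W : set K)].

HB.instance Definition _ := GRing.isSubringClosed.Build K vr_pred (vr_subring W).

Record vr_type := VRElem { vr_val : K; _ : vr_val \in vr_pred }.

HB.instance Definition _ := [isSub for vr_val].
HB.instance Definition _ := [Choice of vr_type by <:].
HB.instance Definition _ := [SubChoice_isSubComNzRing of vr_type by <:].

Definition vr_elem (x : K) (Wx : vr_set W x) : vr_type := VRElem (mem_set Wx).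

Lemma vr_typeP (x : vr_type) : vr_set W (val x).
Proof. by apply/set_mem; case: x. Qed.

(* The maximal ideal of W *)
Definition nonunits : {pred vr_type} :=
  [pred x : vr_type | (val x == 0) || ~~ `[< vr_set W (val x)^-1 >]].

Lemma nonunitsP (x : vr_type) :
  reflect (val x = 0 \/ ~ vr_set W (val x)^-1) (x \in nonunits).
Proof.
rewrite inE; apply: (iffP orP) => -[h|h]; [left|right|left|right].
- exact/eqP.
- exact/asboolPn.
- exact/eqP.
- exact/asboolPn.
Qed.

Lemma nonunits_idealr : idealr_closed nonunits.
Proof.
have aux (a x : vr_type) : x \in nonunits -> a * x \in nonunits.
  move=> /nonunitsP nx; apply/nonunitsP; rewrite rmorphM /=.
  have [->|a0] := eqVneq (val a) 0; first by rewrite mul0r; left.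
  case: nx => [->|nx]; [by rewrite mulr0; left | right => h; apply: nx].
  have [x0|x0] := eqVneq (val x) 0; first by rewrite x0 invr0; apply: vr0.
  have -> : (val x)^-1 = (val a * val x)^-1 * val a.
    by rewrite invfM mulrC mulrA divff ?mul1r.
  exact: vrM h (vr_typeP a).
have aux2 (x y : vr_type) : x \in nonunits -> y \in nonunits -> vr_set W (val x / val y) ->
    x + y \in nonunits.
  move=> nx ny h; have [y0|y0] := eqVneq (val y) 0.
    have -> : x + y = x by apply: val_inj; rewrite rmorphD /= y0 addr0.
    by [].
  have -> : x + y = (vr_elem h + 1) * y.
    apply: val_inj; rewrite !rmorphM !rmorphD rmorph1 /= mulrDl mul1r.
    by rewrite divfK.
  exact: aux.
split.
- by apply/nonunitsP; left; rewrite rmorph0.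
- apply/negP => /nonunitsP; rewrite rmorph1 invr1 => -[/eqP|].
    by rewrite oner_eq0.
  by case; exact: vr1.
move=> a x y /(aux a); move: (a * x) => {a}{}x nx ny.
have [h|] := vr_total W (val x / val y); first exact: aux2.
by rewrite invf_div addrC => h; exact: aux2.
Qed.

HB.instance Definition _ := isIdealr.Build vr_type nonunits nonunits_idealr.

Definition residue : Type := {ideal_quot nonunits}.

HB.instance Definition _ := GRing.ComNzRing.on residue.

Definition res (x : vr_type) : residue := \pi_({ideal_quot nonunits}) x.

HB.instance Definition _ := GRing.RMorphism.copy res
  (\pi_({ideal_quot nonunits}) : vr_type -> {ideal_quot nonunits}).

Definition residue_repr (r : residue) : vr_type :=
  repr (r : {ideal_quot nonunits}).

Lemma residue_reprK (r : residue) : res (residue_repr r) = r.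
Proof. exact: reprK. Qed.

Lemma res_eq0 (x : vr_type) : (res x == 0) = (x \in nonunits).
Proof.
have -> : (0 : residue) = res 0 by rewrite rmorph0.
by rewrite /res -Quotient.idealrBE subr0.
Qed.

Lemma res_surj (r : residue) : exists x, res x = r.
Proof. by exists (residue_repr r); apply: residue_reprK. Qed.

Definition residue_inv (r : residue) : residue :=
  if r == 0 then 0 else res (insubd 0 (val (residue_repr r))^-1).

Lemma residue_mulVf (r : residue) : r != 0 -> residue_inv r * r = 1.
Proof.
rewrite /residue_inv => r0; rewrite (negbTE r0).
move: r0; rewrite -{1 3}[r]residue_reprK res_eq0; move: (residue_repr r) => x.
move=> /nonunitsP /not_orP[/eqP x0 /contrapT Wx].
rewrite -rmorphM -(rmorph1 res); congr (res _); apply: val_inj.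
rewrite rmorphM rmorph1 /= insubdK ?mulVf //.
exact: mem_set.
Qed.

Lemma residue_inv0 : residue_inv 0 = 0.
Proof. by rewrite /residue_inv eqxx. Qed.

HB.instance Definition _ :=
  GRing.ComNzRing_isField.Build residue residue_mulVf residue_inv0.

Record nonzero := Nonzero { nz_val : K; _ : nz_val != 0 }.

HB.instance Definition _ := [isSub for nz_val].
HB.instance Definition _ := [Choice of nonzero by <:].

Lemma nonzero_neq0 (x : nonzero) : val x != 0.
Proof. by case: x. Qed.
#[local] Hint Resolve nonzero_neq0 : core.

Definition nz_one : nonzero := Nonzero (oner_neq0 K).
Definition nz_mul (x y : nonzero) : nonzero :=
  Nonzero (mulf_neq0 (nonzero_neq0 x) (nonzero_neq0 y)).
Definition nz_inv (x : nonzero) : nonzero :=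
  Nonzero (invr_neq0 (nonzero_neq0 x)).

(* x and y differ by a unit of W *)
Definition same_value : rel nonzero :=
  fun x y => `[< vr_set W (val x / val y) /\ vr_set W (val y / val x) >].

Lemma same_value_equiv : equiv_class_of same_value.
Proof.
split=> [x|x y|y x z].
- by apply/asboolP; rewrite divff ?nonzero_neq0 //; split; exact: vr1.
- by apply/asboolP/asboolP => -[].
move=> /asboolP[h1 h2] /asboolP[h3 h4]; apply/asboolP; split.
  by rewrite -[val x](divfK (nonzero_neq0 y)) -[_ * _ / _]mulrA; apply: vrM.
by rewrite -[val z](divfK (nonzero_neq0 y)) -[_ * _ / _]mulrA; apply: vrM.
Qed.

Canonical same_value_eq := EquivRelPack same_value_equiv.
Canonical same_value_enc := defaultEncModRel same_value.

(* K^*/W^*, written additively. Its order, value x <= value y iff y / x is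
   in W, is not recorded: the canonical maps value_map below preserve and
   reflect it. *)
Definition value_group : Type := {eq_quot same_value}.
HB.instance Definition _ := EqQuotient.on value_group.
HB.instance Definition _ := Choice.on value_group.

Definition value (x : nonzero) : value_group := \pi x.

Lemma value_eqP x y :
  value x = value y <-> vr_set W (val x / val y) /\ vr_set W (val y / val x).
Proof.
split=> [/eqP|h]; first by rewrite /value eqmodE => /asboolP.
by apply/eqP; rewrite /value eqmodE; apply/asboolP.
Qed.

Lemma value_repr d : value (repr d) = d.
Proof. exact: reprK. Qed.

Lemma value_ind (T : value_group -> Prop) :
  (forall x, T (value x)) -> forall d, T d.
Proof. by move=> h d; rewrite -(value_repr d). Qed.

Definition value_zero : value_group := value nz_one.
Definition value_add (d e : value_group) : value_group :=
  value (nz_mul (repr d) (repr e)).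
Definition value_opp (d : value_group) : value_group :=
  value (nz_inv (repr d)).

Lemma value_addE x y : value_add (value x) (value y) = value (nz_mul x y).
Proof.
have /value_eqP[h1 h2] := value_repr (value x).
have /value_eqP[h3 h4] := value_repr (value y).
by apply/value_eqP; rewrite /= !invfM; split;
  rewrite mulrACA; apply: vrM.
Qed.

Lemma value_oppE x : value_opp (value x) = value (nz_inv x).
Proof.
have /value_eqP[h1 h2] := value_repr (value x).
by apply/value_eqP; rewrite /= !invrK mulrC [X in _ /\ vr_set W X]mulrC.
Qed.

Lemma value_addA : associative value_add.
Proof.
elim/value_ind=> x; elim/value_ind=> y; elim/value_ind=> z.
by rewrite !value_addE; congr value; apply: val_inj; rewrite /= mulrA.
Qed.

Lemma value_addC : commutative value_add.
Proof.
elim/value_ind=> x; elim/value_ind=> y.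
by rewrite !value_addE; congr value; apply: val_inj; rewrite /= mulrC.
Qed.

Lemma value_add0 : left_id value_zero value_add.
Proof.
elim/value_ind=> x.
by rewrite value_addE; congr value; apply: val_inj; rewrite /= mul1r.
Qed.

Lemma value_addN : left_inverse value_zero value_opp value_add.
Proof.
elim/value_ind=> x; rewrite value_oppE value_addE; congr value.
by apply: val_inj; rewrite /= mulVf.
Qed.

HB.instance Definition _ := GRing.isZmodule.Build value_group
  value_addA value_addC value_add0 value_addN.

Lemma valueM x y : value (nz_mul x y) = value x + value y.
Proof. by rewrite -value_addE. Qed.

End ValuationRing.

(* W \cap K = V, where K is identified with its image under f *)
Definition extends (K M : fieldType) (f : {rmorphism K -> M})
    (V : valuation_ring K) (W : valuation_ring M) : Prop :=
  f @^-1` W = V :> set K.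

Section Extension.
Variables (K M : fieldType) (f : {rmorphism K -> M}).
Variables (V : valuation_ring K) (W : valuation_ring M).
Hypothesis VW : extends f V W.

Lemma extendsE x : vr_set W (f x) <-> vr_set V x.
Proof. by have /seteqP[h1 h2] := VW; split; [exact: h1|exact: h2]. Qed.

Definition vr_map (x : vr_type V) : vr_type W :=
  vr_elem ((extendsE (val x)).2 (vr_typeP x)).

Definition residue_map (r : residue V) : residue W :=
  res (vr_map (residue_repr r)).

Lemma residue_mapE x : residue_map (res x) = res (vr_map x).
Proof.
apply/eqP; rewrite -subr_eq0 -rmorphB res_eq0.
have /eqP := residue_reprK (res x); rewrite -subr_eq0 -rmorphB res_eq0.
move=> /nonunitsP h; apply/nonunitsP; move: h.
rewrite !rmorphB /= -(rmorphB f) -fmorphV.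
by case=> [->|h]; [left; rewrite rmorph0 | right => /extendsE].
Qed.

Lemma residue_map_zmod : zmod_morphism residue_map.
Proof.
move=> r s; have [x <-] := res_surj r; have [y <-] := res_surj s.
rewrite -rmorphB !residue_mapE -rmorphB; congr res; apply: val_inj.
by rewrite !rmorphB /= rmorphB.
Qed.

Lemma residue_map_monoid : monoid_morphism residue_map.
Proof.
split.
  rewrite -(rmorph1 (@res _ V)) residue_mapE -(rmorph1 (@res _ W)).
  by congr res; apply: val_inj; rewrite rmorph1 /= rmorph1.
move=> r s; have [x <-] := res_surj r; have [y <-] := res_surj s.
rewrite -rmorphM !residue_mapE -rmorphM; congr res; apply: val_inj.
by rewrite !rmorphM /= rmorphM.
Qed.

HB.instance Definition _ :=
  GRing.isZmodMorphism.Build _ _ residue_map residue_map_zmod.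
HB.instance Definition _ :=
  GRing.isMonoidMorphism.Build _ _ residue_map residue_map_monoid.

Definition nz_map (x : nonzero K) : nonzero M :=
  Nonzero (etrans (congr1 negb (fmorph_eq0 f (val x))) (nonzero_neq0 x)).

Definition value_map of extends f V W := fun d : value_group V =>
  value W (nz_map (repr d)).

Lemma value_mapE x : value_map VW (value V x) = value W (nz_map x).
Proof.
have /value_eqP[h1 h2] := value_repr (value V x).
by apply/value_eqP; rewrite /= -!fmorph_div; split; apply/extendsE.
Qed.

Lemma value_map_zmod : zmod_morphism (value_map VW).
Proof.
elim/value_ind=> x; elim/value_ind=> y.
have -> : value V x - value V y = value V (nz_mul x (nz_inv y)).
  by rewrite valueM -value_oppE.
rewrite !value_mapE; apply: (canRL (addrK _)); rewrite -valueM; congr value.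
apply: val_inj; rewrite /= fmorph_div divfK //.
by rewrite fmorph_eq0 nonzero_neq0.
Qed.

HB.instance Definition _ :=
  GRing.isZmodMorphism.Build _ _ (value_map VW) value_map_zmod.

Lemma value_map_inj : injective (value_map VW).
Proof.
elim/value_ind=> x; elim/value_ind=> y; rewrite !value_mapE.
move=> /value_eqP[]; rewrite /= -!fmorph_div => /extendsE h1 /extendsE h2.
exact/value_eqP.
Qed.

End Extension.

Arguments residue_map {K M f V W} VW r.
Arguments value_map {K M f V W} VW d.

Record prime_ideal (K : fieldType) (V : valuation_ring K) := PrimeIdeal {
  pi_set :> set K;
  pi_sub : pi_set `<=` V;
  pi_0 : pi_set 0;
  pi_D : forall x y, pi_set x -> pi_set y -> pi_set (x + y);
  pi_M : forall x y, vr_set V x -> pi_set y -> pi_set (x * y);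
  pi_1 : ~ pi_set 1;
  pi_prime : forall x y, vr_set V x -> vr_set V y ->
    pi_set (x * y) -> pi_set x \/ pi_set y
}.

Section Localization.
Variables (K : fieldType) (V : valuation_ring K) (P : prime_ideal V).

Definition localize_set : set K :=
  [set z | exists x y, [/\ vr_set V x, vr_set V y, ~ pi_set P y & z = x / y]].

Lemma pi_neq0 y : ~ pi_set P y -> y != 0.
Proof. by move=> Py; apply/eqP => y0; apply: Py; rewrite y0; exact: pi_0. Qed.

Lemma localize_sub x : vr_set V x -> localize_set x.
Proof.
by move=> Vx; exists x, 1; split=> //; [exact: vr1|exact: pi_1|rewrite divr1].
Qed.

Lemma pi_notM y z : vr_set V y -> vr_set V z ->
  ~ pi_set P y -> ~ pi_set P z -> ~ pi_set P (y * z).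
Proof. by move=> Vy Vz Py Pz /(pi_prime Vy Vz)[]. Qed.

Lemma localize_subring : subring_closed [in localize_set].
Proof.
split.
- by apply/mem_set/localize_sub/vr1.
- move=> _ _ /set_mem[x [y [Vx Vy Py ->]]] /set_mem[z [t [Vz Vt Pt ->]]].
  apply/mem_set; exists (x * t - z * y), (y * t); split.
  + by apply: vrB; apply: vrM.
  + exact: vrM.
  + exact: pi_notM.
  + by rewrite -mulNr addf_div ?pi_neq0 // mulNr.
- move=> _ _ /set_mem[x [y [Vx Vy Py ->]]] /set_mem[z [t [Vz Vt Pt ->]]].
  apply/mem_set; exists (x * z), (y * t); split.
  + exact: vrM.
  + exact: vrM.
  + exact: pi_notM.
  + by rewrite mulf_div.
Qed.

Lemma localize_total x : localize_set x \/ localize_set x^-1.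
Proof. by case: (vr_total V x) => h; [left|right]; apply: localize_sub. Qed.

Definition localize : valuation_ring K :=
  ValuationRing localize_subring localize_total.

(* The image of V in the residue field of V_P *)
Definition quotient_set : set (residue localize) :=
  [set r | exists2 x : vr_type localize, vr_set V (val x) & res x = r].

(* The kernel of V -> V_P / P V_P is P, so that quotient_set is V/P *)
Lemma quotient_kernel (x : vr_type localize) :
  vr_set V (val x) -> res x = 0 <-> pi_set P (val x).
Proof.
move=> Vx; have -> : (res x = 0) <-> x \in @nonunits _ localize.
  by rewrite -res_eq0; split=> /eqP.
split=> [/nonunitsP[->|h]|Px]; first exact: pi_0.
  apply: contrapT => Px; apply: h; exists 1, (val x); split=> //.
    exact: vr1.
  by rewrite mul1r.
apply/nonunitsP; have [->|x0] := eqVneq (val x) 0; [by left|right].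
move=> [a [b [Va Vb Pb /(congr1 (fun z => z * val x * b))]]].
rewrite mulVf // mul1r mulrAC divfK ?pi_neq0 // => bE.
by apply: Pb; rewrite bE; apply: pi_M.
Qed.

Lemma quotient_subring : subring_closed [in quotient_set].
Proof.
split.
- by apply/mem_set; exists 1; [rewrite rmorph1; exact: vr1|rewrite rmorph1].
- move=> _ _ /set_mem[x Vx <-] /set_mem[y Vy <-]; apply/mem_set.
  by exists (x - y); [rewrite rmorphB; exact: vrB|rewrite rmorphB].
- move=> _ _ /set_mem[x Vx <-] /set_mem[y Vy <-]; apply/mem_set.
  by exists (x * y); [rewrite rmorphM; exact: vrM|rewrite rmorphM].
Qed.

Lemma quotient_total r : quotient_set r \/ quotient_set r^-1.
Proof.
have [x <-] := res_surj r; case: (vr_total V (val x)) => h.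
  by left; exists x.
have [->|r0] := eqVneq (res x) 0.
  by left; exists 0; rewrite rmorph0 //; exact: vr0.
right; exists (@vr_elem _ localize _ (localize_sub h)) => //.
apply: (mulIf r0); rewrite mulVf // -rmorphM -(rmorph1 (@res _ localize)).
congr res; apply: val_inj; rewrite rmorphM rmorph1 /= mulVf //.
by apply: contra_neq r0 => x0; rewrite -[x](_ : 0 = x) ?rmorph0 //; apply: val_inj.
Qed.

(* V/P, a valuation ring of the residue field of V_P *)
Definition quotient_vr : valuation_ring (residue localize) :=
  ValuationRing quotient_subring quotient_total.

End Localization.

Definition lies_over (K M : fieldType) (f : {rmorphism K -> M})
    (V : valuation_ring K) (W : valuation_ring M)
    (P : prime_ideal V) (Q : prime_ideal W) : Prop :=
  f @^-1` Q = P :> set K.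

Lemma lies_over_exists (K M : fieldType) (f : {rmorphism K -> M})
    (V : valuation_ring K) (W : valuation_ring M) (VW : extends f V W)
    (P : prime_ideal V) : exists Q : prime_ideal W, lies_over f P Q.
Proof.
pose Q : set M := [set y | vr_set W y /\
  exists n a t, [/\ pi_set P a, vr_set W t & y ^+ n = f a * t]].
have VX (y : M) n : vr_set W y -> vr_set W (y ^+ n).
  by move=> Wy; elim: n => [|n IHn]; [exact: vr1|rewrite exprS; exact: vrM].
have QW : Q `<=` W by move=> y [].
have Q0 : Q 0.
  split; first exact: vr0.
  exists 1%N, 0, 0; split; [exact: pi_0|exact: vr0|by rewrite expr1 mulr0].
have QM x y : vr_set W x -> Q y -> Q (x * y).
  move=> Wx [Wy [n [a [t [Pa Wt yn]]]]]; split; first exact: vrM.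
  exists n, a, (x ^+ n * t); split=> //; first by apply: vrM => //; exact: VX.
  by rewrite exprMn yn mulrCA.
have aux x y : y <> 0 -> vr_set W (x / y) -> Q y -> Q (x + y).
  move=> /eqP y0 Wxy Qy; have -> : x + y = (x / y + 1) * y.
    by rewrite mulrDl mul1r divfK.
  by apply: QM => //; apply: vrD => //; exact: vr1.
have QD x y : Q x -> Q y -> Q (x + y).
  move=> Qx Qy; have [->|/eqP x0] := eqVneq x 0; first by rewrite add0r.
  have [->|/eqP y0] := eqVneq y 0; first by rewrite addr0.
  have [h|h] := vr_total W (x / y); first exact: aux.
  by rewrite addrC; apply: aux => //; rewrite -invf_div.
have fE x : vr_set V x -> Q (f x) -> pi_set P x.
  move=> Vx [_ [n [a [t [Pa Wt]]]]]; rewrite -rmorphXn => E.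
  have Pxn : pi_set P (x ^+ n).
    have [a0|a0] := eqVneq a 0.
      move/eqP: E; rewrite a0 rmorph0 mul0r fmorph_eq0 => /eqP ->.
      exact: pi_0.
    rewrite -[x ^+ n](divfK a0); apply: pi_M => //; apply/(extendsE VW).
    by rewrite fmorph_div E mulrC mulKf // fmorph_eq0.
  elim: n Pxn {E} => [|n IHn]; first by rewrite expr0 => /pi_1.
  rewrite exprS => /pi_prime[] //.
  by elim: n {IHn} => [|n IHn]; [exact: vr1|rewrite exprS; exact: vrM].
have Q1 : ~ Q 1.
  by rewrite -(rmorph1 f) => /(fE _ (vr1 V)) /pi_1.
have sq x y : vr_set W x -> y <> 0 -> vr_set W (x / y) -> Q (x * y) -> Q x.
  move=> Wx /eqP y0 Wxy [_ [n [a [t [Pa Wt E]]]]]; split=> //.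
  exists (n + n)%N, a, ((x / y) ^+ n * t); split=> //.
    by apply: vrM => //; exact: VX.
  rewrite exprD -exprMn; have -> : x * x = (x / y) * (x * y).
    by rewrite mulrCA divfK.
  by rewrite exprMn E mulrCA.
have QP x y : vr_set W x -> vr_set W y -> Q (x * y) -> Q x \/ Q y.
  move=> Wx Wy Qxy; have [->|/eqP x0] := eqVneq x 0; first by left.
  have [->|/eqP y0] := eqVneq y 0; first by right.
  have [h|h] := vr_total W (x / y); first by left; exact: sq h Qxy.
  by right; apply: (@sq y x) => //; [rewrite -invf_div|rewrite mulrC].
exists (@PrimeIdeal M W Q QW Q0 QD QM Q1 QP); apply/seteqP; split=> x /=.
  by move=> Qx; apply: fE => //; apply/(extendsE VW); case: Qx.
move=> Px; split; first by apply/(extendsE VW); exact: pi_sub Px.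
exists 1%N, x, 1; split=> //; first exact: vr1.
by rewrite expr1 mulr1.
Qed.

Section ExtensionLocalization.
Variables (K M : fieldType) (f : {rmorphism K -> M}).
Variables (V : valuation_ring K) (W : valuation_ring M).
Variables (P : prime_ideal V) (Q : prime_ideal W).
Hypotheses (VW : extends f V W) (PQ : lies_over f P Q).

Lemma lies_overE x : pi_set Q (f x) <-> pi_set P x.
Proof. by have /seteqP[h1 h2] := PQ; split; [exact: h1|exact: h2]. Qed.

Lemma localize_extends : extends f (localize P) (localize Q).
Proof.
apply/seteqP; split=> z /=; last first.
  move=> [x [y [Vx Vy Py ->]]]; exists (f x), (f y); split.
  - exact/(extendsE VW).
  - exact/(extendsE VW).
  - by move/lies_overE.
  - exact: fmorph_div.
move=> [a [b [Wa Wb Qb zE]]].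
have [Vz|Vz] := vr_total V z; first exact: localize_sub.
have [->|z0] := eqVneq z 0; first exact/localize_sub/vr0.
exists 1, z^-1; split=> //; [exact: vr1| |by rewrite mul1r invrK].
move/lies_overE => Qz; apply: Qb; have -> : b = a * f z^-1.
  rewrite fmorphV zE invf_div mulrC divfK //.
  by apply: contra_neq z0 => a0; move: zE; rewrite a0 mul0r => /eqP;
    rewrite fmorph_eq0 => /eqP.
exact: pi_M.
Qed.

Lemma quotient_extends :
  extends (residue_map localize_extends) (quotient_vr P) (quotient_vr Q).
Proof.
apply/seteqP; split=> r /=; have [x <-] := res_surj r; rewrite residue_mapE.
  move=> [y Wy /eqP]; rewrite -subr_eq0 -rmorphB res_eq0 => /nonunitsP h.
  exists x => //; apply/(extendsE VW).
  have Wxy : vr_set W (f (val x) - val y).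
    rewrite -opprB; apply: vrN; move: h; rewrite rmorphB /=.
    case=> [->|h]; first exact: vr0.
    have [//|/(localize_sub Q)] := vr_total W (vr_val y - f (vr_val x)).
    by move/h.
  by rewrite -[f _](subrK (val y)); apply: vrD.
move=> [y Vy /eqP]; rewrite -subr_eq0 -rmorphB res_eq0 => /nonunitsP h.
exists (vr_map localize_extends x) => //=; apply/(extendsE VW).
have Vxy : vr_set V (val x - val y).
  rewrite -opprB; apply: vrN; move: h; rewrite rmorphB /=.
  case=> [->|h]; first exact: vr0.
  have [//|/(localize_sub P)] := vr_total V (vr_val y - vr_val x).
  by move/h.
by rewrite -[vr_val x](subrK (val y)); apply: vrD.
Qed.

End ExtensionLocalization.

Arguments localize_extends {K M f V W P Q} VW PQ.
Arguments quotient_extends {K M f V W P Q} VW PQ.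

Definition is_mup_prime (p : nat) (K : fieldType) (V : valuation_ring K)
    (P : prime_ideal V) : Prop :=
  ~ has_mup p (quotient_vr P) /\
  forall P' : prime_ideal V, ~ has_mup p (quotient_vr P') -> P' `<=` P.

Section MupPrime.
Variables (p : nat) (K : fieldType) (V : valuation_ring K).
Hypothesis p_pr : prime p.

Lemma prime_primitive_root (L : fieldType) (z : L) :
  p.-primitive_root z <-> z ^+ p = 1 /\ z <> 1.
Proof.
split=> [h|[zp z1]].
  split; first exact: prim_expr_order.
  move=> z1; have := prim_order_dvd h 1.
  by rewrite z1 expr1n eqxx dvdn1 => /eqP pE; move: p_pr; rewrite pE.
have [m mp hm] := prim_order_exists (prime_gt0 p_pr) zp.
case/primeP: p_pr => _ /(_ m hm) /orP[] /eqP mE; last by rewrite -mE.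
by case: z1; move: (prim_expr_order mp); rewrite mE expr1.
Qed.

Lemma has_mup_quotient (P : prime_ideal V) : has_mup p (quotient_vr P) <->
  exists z, [/\ vr_set V z, pi_set P (z ^+ p - 1) & ~ pi_set P (z - 1)].
Proof.
pose L := localize P.
have VX z n : vr_set V z -> vr_set V (z ^+ n).
  move=> Vz; elim: n => [|n IHn]; first exact: vr1.
  by rewrite exprS; exact: vrM.
have E (x : vr_type L) n : vr_set V (val x) ->
    (res x ^+ n = 1) <-> pi_set P (val x ^+ n - 1).
  move=> Vx; have -> : (res x ^+ n = 1) <-> res (x ^+ n - 1) = 0.
    rewrite rmorphB rmorphXn rmorph1; split=> [->|/eqP]; first by rewrite subrr.
    by rewrite subr_eq0 => /eqP.
  by rewrite quotient_kernel rmorphB rmorphXn rmorph1 //=; apply/vrB/vr1/VX.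
split=> [[_ [x Vx <-] /prime_primitive_root[h1 h2]]|[z [Vz h1 h2]]].
  exists (val x); split=> //; first exact/E.
  by rewrite -[X in X - 1]expr1 => /E h; apply: h2; rewrite -[LHS]expr1 h.
pose x : vr_type L := @vr_elem _ L z (localize_sub P Vz).
exists (res x); first by exists x.
apply/prime_primitive_root; split; first exact/E.
by rewrite -[LHS]expr1 => /E; rewrite expr1 => /(_ Vz).
Qed.

Lemma prime_ideal_chain (P P' : prime_ideal V) : P `<=` P' \/ P' `<=` P.
Proof.
apply: contrapT => /not_orP[/existsNP[x /not_implyP[Px P'x]]].
move=> /existsNP[y /not_implyP[P'y Py]].
have [h|h] := vr_total V (x / y).
  by apply: P'x; rewrite -[x](divfK (pi_neq0 Py)); exact: pi_M.
by apply: Py; rewrite -[y](divfK (pi_neq0 P'x)) -invf_div; exact: pi_M.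
Qed.

(* The union of the primes P with no primitive p-th root of 1 in V/P is itself
   such a prime. *)
Lemma mup_prime_exists : ~ has_mup p [set: K] ->
  exists P : prime_ideal V, is_mup_prime p P /\
    pi_set P = [set x | exists2 P' : prime_ideal V,
                  ~ has_mup p (quotient_vr P') & pi_set P' x].
Proof.
move=> noK.
pose U : set K := [set x | exists2 P' : prime_ideal V,
                  ~ has_mup p (quotient_vr P') & pi_set P' x].
have zD (x y : K) : x = 0 -> y = 0 -> x + y = 0 by move=> -> ->; rewrite addr0.
have zM (x y : K) : vr_set V x -> y = 0 -> x * y = 0.
  by move=> _ ->; rewrite mulr0.
have z1 : (1 : K) <> 0 by apply/eqP; rewrite oner_eq0.
have zP (x y : K) : vr_set V x -> vr_set V y -> x * y = 0 -> x = 0 \/ y = 0.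
  by move=> _ _ /eqP; rewrite mulf_eq0 => /orP[]/eqP; [left|right].
have zV : [set 0 : K] `<=` V by move=> _ ->; exact: vr0.
pose Z := @PrimeIdeal K V [set 0] zV erefl zD zM z1 zP.
have nZ : ~ has_mup p (quotient_vr Z).
  move=> /has_mup_quotient[z [_ /= /eqP zp nz1]]; apply: noK; exists z => //.
  apply/prime_primitive_root; split; first by apply/eqP; rewrite -subr_eq0.
  by move=> z1'; apply: nz1; rewrite z1' subrr.
have U0 : U 0 by exists Z.
have UV : U `<=` V by move=> x [P' _ /(pi_sub)].
have UD x y : U x -> U y -> U (x + y).
  move=> [P1 n1 P1x] [P2 n2 P2y]; have [h|h] := prime_ideal_chain P1 P2.
    by exists P2 => //; apply: pi_D => //; exact: h.
  by exists P1 => //; apply: pi_D => //; exact: h.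
have UM x y : vr_set V x -> U y -> U (x * y).
  by move=> Vx [P' n' P'y]; exists P' => //; exact: pi_M.
have U1 : ~ U 1 by move=> [P' _ /pi_1].
have UP x y : vr_set V x -> vr_set V y -> U (x * y) -> U x \/ U y.
  by move=> Vx Vy [P' n' /(pi_prime Vx Vy)[h|h]]; [left|right]; exists P'.
exists (@PrimeIdeal K V U UV U0 UD UM U1 UP); split=> //; split.
  move=> /has_mup_quotient[z [Vz /= [P' n' P'z] nz]]; apply: (n').
  apply/has_mup_quotient; exists z; split=> // P'z1; apply: nz.
  by exists P'.
by move=> P' n' x P'x; exists P'.
Qed.

End MupPrime.

Definition is_biadditive (A B U : zmodType) (b : A -> B -> U) : Prop :=
  (forall x, zmod_morphism (b x)) /\ (forall y, zmod_morphism (b ^~ y)).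

Definition is_tensor_product (A B T : zmodType) (t : A -> B -> T) : Prop :=
  is_biadditive t /\
  forall (U : zmodType) (b : A -> B -> U), is_biadditive b ->
    exists! h : T -> U, zmod_morphism h /\ forall x y, h (t x y) = b x y.

(* Z[1/p], as a subring of rat *)
Definition Zinv_set (p : nat) : set rat :=
  [set x | exists (a : int) (n : nat), x = a%:~R / p%:R ^+ n].

Lemma Zinv_subring p : subring_closed [in Zinv_set p].
Proof.
have [->|p0] := posnP p.
  have E x : x \in Zinv_set 0 -> exists a : int, x = a%:~R.
    move=> /set_mem[a [[|n] ->]]; first by exists a; rewrite divr1.
    by exists 0; rewrite expr0n invr0 mulr0.
  have I (a : int) : a%:~R \in Zinv_set 0.
    by apply/mem_set; exists a, 0%N; rewrite divr1.
  split; first exact: (I 1).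
    by move=> x y /E[a ->] /E[b ->]; rewrite -rmorphB; exact: I.
  by move=> x y /E[a ->] /E[b ->]; rewrite -rmorphM; exact: I.
have pn0 n : p%:R ^+ n != 0 :> rat.
  by rewrite expf_neq0 // pnatr_eq0 -lt0n.
split.
- by apply/mem_set; exists 1, 0%N; rewrite divr1.
- move=> _ _ /set_mem[a [n ->]] /set_mem[b [m ->]]; apply/mem_set.
  exists (a * p%:R ^+ m - b * p%:R ^+ n), (n + m)%N.
  rewrite -mulNr addf_div // exprD mulNr.
  by rewrite rmorphB !rmorphM !rmorphXn /= !rmorph_nat.
- move=> _ _ /set_mem[a [n ->]] /set_mem[b [m ->]]; apply/mem_set.
  by exists (a * b), (n + m)%N; rewrite mulf_div exprD rmorphM.
Qed.

Section Zinv.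
Variable p : nat.

Definition Zinv_pred : {pred rat} := [in Zinv_set p].
HB.instance Definition _ :=
  GRing.isSubringClosed.Build rat Zinv_pred (Zinv_subring p).

Record Zinv := ZinvElem { Zinv_val : rat; _ : Zinv_val \in Zinv_pred }.
HB.instance Definition _ := [isSub for Zinv_val].
HB.instance Definition _ := [Choice of Zinv by <:].
HB.instance Definition _ := [SubChoice_isSubComNzRing of Zinv by <:].

End Zinv.

(* i : A -> B exhibits B as Z[1/p] (x) A, i being a |-> 1 (x) a *)
Definition is_Zinv_tensor (p : nat) (A B : zmodType) (i : A -> B) : Prop :=
  exists t : Zinv p -> A -> B, is_tensor_product t /\ t 1 =1 i.

(* Main.v *)
(** Everything takes place inside an algebraically closed Omega containing F(p), with a
    valuation ring B of Omega over Y. The elements of a p-extension of F are those fixed by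
    the automorphisms over F of order prime to p. Hence a Kummer argument: for b in
    E = F(p)(mu_p), with G = Gal(E / F(p)) acting on the roots of unity by z -> z^(s t), the
    product over t in G of t(b)^(n t), where n t is inverse to s t mod p, is a p-th power in E.

    As |G| is prime to p and inertia is trivial in E / F(p), residues and values descend from
    E to F(p), and the decomposition group is determined by which z -> z^s are realized over
    the residue field. These exponents are the same over F as over F(p), whence the count of
    the extensions to J.

    The residue field and the value group of Y are obtained from those of V by p-extensions. If
    there are no p-th roots of unity in the residue field of V, the ramification character of
    the inertia group is trivial and the value group does not grow. Conversely, a p-extension
    of the residue field is climbed in steps of degree p: the p-th power of a Lagrange
    resolvent lifts to some b in E which is 1 at the other conjugates of the valuation (weak
    approximation), and the Kummer argument extracts the p-th root. For V/P, no proper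
    overring of the valuation of E is stable under a nontrivial t in G; so approximation gives b
    with the value of any given x in F(p) at one conjugate and value 0 at the others, and the
    Kummer argument makes the value of x divisible by p. *)

From HB Require Import structures.
Require Import Defs.
From mathcomp Require Import all_boot all_order all_algebra all_field.
From mathcomp Require Import all_fingroup all_solvable.
From mathcomp Require Import boolp classical_sets functions cardinality.

Set Implicit Arguments.
Unset Strict Implicit.
Unset Printing Implicit Defensive.

Import GRing.Theory.

Local Open Scope classical_set_scope.
Local Open Scope card_scope.
Local Open Scope ring_scope.

(** * Valuation rings *)

(** The exponents [n t] project b onto an eigenspace: modulo p-th powers, u in G raises the product
    to the power s u, exactly as it does the roots of unity. By the Kummer pairing G then acts
    trivially on the Galois group of the extension generated by a p-th root of the product, so that
    this extension comes from one of F(p) of degree dividing p; but F(p) is p-closed. The obstacle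
    is that all conjugates of b enter the product, while a single valuation of E is to be
    controlled. Distinct conjugates of a valuation are incomparable but may share proper overrings,
    so arbitrary data cannot be approximated: u can be small relative to d at one of them and 1 at
    the other only if d lies in their common overrings. For residues d is integral and this is
    automatic; for values it is what the choice of P provides. The conjugates of b under the
    decomposition group cannot be removed. For residues their p-th roots, raised to the powers
    [n t], agree with one and the same element up to factors in the residue field, and the order of
    the decomposition group, being prime to p, can be inverted. *)

Section ValuationBasics.
Variables (K : fieldType) (W : valuation_ring K).

Definition vmax : set K := [set x | x = 0 \/ ~ vr_set W x^-1].

Lemma vmax0 : vmax 0.
Proof. by left. Qed.

Lemma vmax_sub x : vmax x -> vr_set W x.
Proof.
by case=> [->|h]; [exact: vr0|case: (vr_total W x)].
Qed.

Lemma vmax1 : ~ vmax 1.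
Proof. by case=> [/eqP|]; rewrite ?oner_eq0 // invr1 => -[]; exact: vr1. Qed.

Lemma vmax_nonunits (x : vr_type W) : (x \in @nonunits _ W) <-> vmax (val x).
Proof. by split=> [/nonunitsP|h]; last apply/nonunitsP. Qed.

Lemma vmaxMl a x : vr_set W a -> vmax x -> vmax (a * x).
Proof.
move=> Wa [->|h]; first by rewrite mulr0; exact: vmax0.
have [->|a0] := eqVneq a 0; first by rewrite mul0r; exact: vmax0.
by right=> h'; apply: h; rewrite -[x^-1](mulVKf a0) -invfM; exact: vrM.
Qed.

Lemma vmaxMr a x : vr_set W a -> vmax x -> vmax (x * a).
Proof. by rewrite mulrC; exact: vmaxMl. Qed.

Lemma vmaxD x y : vmax x -> vmax y -> vmax (x + y).
Proof.
move=> mx my; have [_ _ /(_ 1 (vr_elem (vmax_sub mx)) (vr_elem (vmax_sub my)))] :=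
  nonunits_idealr W.
rewrite mul1r => h; rewrite -[x + y]/(val (vr_elem (vmax_sub mx) + vr_elem (vmax_sub my))).
by apply/vmax_nonunits/h; apply/vmax_nonunits.
Qed.

Lemma vmaxN x : vmax x -> vmax (- x).
Proof.
by rewrite -mulN1r; apply: vmaxMl; apply: vrN; exact: vr1.
Qed.

Lemma vmaxB x y : vmax x -> vmax y -> vmax (x - y).
Proof. by move=> mx /vmaxN; exact: vmaxD. Qed.

Lemma vmaxBC x y : vmax (x - y) -> vmax (y - x).
Proof. by move=> /vmaxN; rewrite opprB. Qed.

Lemma vmax_trans y x z : vmax (x - y) -> vmax (y - z) -> vmax (x - z).
Proof. by move=> h1 h2; rewrite -(subrKA y); exact: vmaxD. Qed.

Lemma vmax_inv x : ~ vr_set W x -> vmax x^-1.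
Proof. by move=> h; right; rewrite invrK. Qed.

Lemma vunit_inv x : ~ vmax x -> vr_set W x^-1.
Proof. by move=> /not_orP[_ /contrapT]. Qed.

Lemma vunit_neq0 x : ~ vmax x -> x != 0.
Proof. by move=> h; apply/eqP => x0; apply: h; left. Qed.

Lemma vmax_invN x : vmax x -> x != 0 -> ~ vr_set W x^-1.
Proof. by case=> [->|//]; rewrite eqxx. Qed.

Lemma vmax_prime x y : vmax (x * y) -> vr_set W x -> vr_set W y -> vmax x \/ vmax y.
Proof.
move=> h Wx Wy; apply: contrapT => /not_orP[nx ny].
by apply: ny; rewrite -[y](mulKf (vunit_neq0 nx)); apply: vmaxMl => //; exact: vunit_inv.
Qed.

Lemma vunitM x y : vr_set W x -> ~ vmax x -> vr_set W y -> ~ vmax y -> ~ vmax (x * y).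
Proof. by move=> Wx nx Wy ny /vmax_prime[]. Qed.

Lemma vrX x n : vr_set W x -> vr_set W (x ^+ n).
Proof. by move=> Wx; elim: n => [|n IH]; [exact: vr1|rewrite exprS; exact: vrM]. Qed.

Lemma vmaxX x n : vr_set W x -> vmax (x ^+ n) -> vmax x.
Proof.
move=> Wx; elim: n => [|n IH]; first by rewrite expr0 => /vmax1.
by rewrite exprS => /vmax_prime[] //; exact: vrX.
Qed.

Lemma vr_sum (I : Type) (r : seq I) (P : pred I) (F : I -> K) :
  (forall i, P i -> vr_set W (F i)) -> vr_set W (\sum_(i <- r | P i) F i).
Proof. by move=> h; elim/big_ind: _ => //; [exact: vr0|exact: vrD]. Qed.

Lemma vr_prod (I : Type) (r : seq I) (P : pred I) (F : I -> K) :
  (forall i, P i -> vr_set W (F i)) -> vr_set W (\prod_(i <- r | P i) F i).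
Proof. by move=> h; elim/big_ind: _ => //; [exact: vr1|exact: vrM]. Qed.

Lemma vmax_sum (I : Type) (r : seq I) (P : pred I) (F : I -> K) :
  (forall i, P i -> vmax (F i)) -> vmax (\sum_(i <- r | P i) F i).
Proof. by move=> h; elim/big_ind: _ => //; [exact: vmax0|exact: vmaxD]. Qed.

Lemma vr_cong x y : vmax (x - y) -> vr_set W y -> vr_set W x.
Proof. by move=> h Wy; rewrite -(subrK y x); apply: vrD => //; exact: vmax_sub. Qed.

Lemma vmax_cong x y : vmax (x - y) -> vmax x -> vmax y.
Proof.
move=> h mx; suff -> : y = x - (x - y) by exact: vmaxB.
by rewrite opprB addrC subrK.
Qed.

Lemma vmax_congM x x' y y' : vr_set W x -> vr_set W y' ->
  vmax (x - x') -> vmax (y - y') -> vmax (x * y - x' * y').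
Proof.
move=> Wx Wy' hx hy; have -> : x * y - x' * y' = x * (y - y') + (x - x') * y'.
  by rewrite mulrBr mulrBl addrA subrK.
by apply: vmaxD; [exact: vmaxMl|exact: vmaxMr].
Qed.

Lemma vmax_congX x x' n : vr_set W x -> vr_set W x' ->
  vmax (x - x') -> vmax (x ^+ n - x' ^+ n).
Proof.
move=> Wx Wx' h; elim: n => [|n IH]; first by rewrite !expr0 subrr; exact: vmax0.
by rewrite !exprS; apply: vmax_congM => //; exact: vrX.
Qed.

Lemma vmax_cong_prod (I : Type) (r : seq I) (P : pred I) (F H : I -> K) :
  (forall i, P i -> vr_set W (F i)) -> (forall i, P i -> vr_set W (H i)) ->
  (forall i, P i -> vmax (F i - H i)) ->
  vmax (\prod_(i <- r | P i) F i - \prod_(i <- r | P i) H i).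
Proof.
move=> WF WH h.
suff [] : [/\ vr_set W (\prod_(i <- r | P i) F i), vr_set W (\prod_(i <- r | P i) H i) &
  vmax (\prod_(i <- r | P i) F i - \prod_(i <- r | P i) H i)] by [].
elim/big_rec2: _ => [|i x y Pi [Wx Wy hxy]].
  by rewrite subrr; split; [exact: vr1|exact: vr1|exact: vmax0].
split; [by apply: vrM => //; exact: WF|by apply: vrM => //; exact: WH|].
by apply: vmax_congM => //; [exact: WF|exact: h].
Qed.

Lemma res_eqP (x y : vr_type W) : res x = res y <-> vmax (val x - val y).
Proof.
rewrite -[val x - val y]/(val (x - y)) -vmax_nonunits -res_eq0 rmorphB subr_eq0.
by split=> [h|/eqP //]; apply/eqP; exact: h.
Qed.

(** Were x outside W, its inverse would be in the maximal ideal, and dividing the equation by the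
    leading power of x would write 1 as a sum of elements of that ideal. *)
Lemma vr_root_monic (h : {poly K}) x : h \is monic ->
  (forall i, vr_set W h`_i) -> root h x -> vr_set W x.
Proof.
move=> hm hW /rootP hx; have [//|nWx] := pselect (vr_set W x).
have x0 : x != 0 by apply/eqP => x0; apply: nWx; rewrite x0; exact: vr0.
have h0 : h != 0 by exact: monic_neq0.
have := hx; rewrite horner_coef (polySpred h0) big_ord_recr /=.
rewrite -lead_coefE (monicP hm) mul1r => /eqP.
rewrite addrC addr_eq0 => /eqP E.
set n := (size h).-1 in E.
suff : vmax 1 by move/vmax1.
have -> : 1 = - (\sum_(i < n) (h`_i * x ^+ i)) / x ^+ n.
  by rewrite -E divff // expf_neq0.
rewrite mulNr; apply: vmaxN; rewrite big_distrl /=; apply: vmax_sum => i _.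
rewrite -mulrA; apply: vmaxMl => //.
have -> : x ^+ i / x ^+ n = x^-1 * x^-1 ^+ (n - i).-1.
  rewrite -exprS prednK ?subn_gt0 // exprVn.
  have -> : x ^+ n = x ^+ (n - i) * x ^+ i by rewrite -exprD subnK // ltnW.
  by rewrite invfM mulrCA divff ?mulr1 // expf_neq0.
by apply: vmaxMr; [apply: vrX; exact: vmax_sub (vmax_inv nWx)|exact: vmax_inv].
Qed.

Lemma vr_of_exp x n : (0 < n)%N -> vr_set W (x ^+ n) -> vr_set W x.
Proof.
move=> n0 h; apply: (@vr_root_monic ('X^n - (x ^+ n)%:P)).
- exact: monicXnsubC.
- move=> i; rewrite coefB coefXn coefC; apply: vrB.
    by case: eqP => _; [exact: vr1|exact: vr0].
  by case: eqP => _ //; exact: vr0.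
- by rewrite /root !hornerE subrr.
Qed.

End ValuationBasics.

Section Extensions.
Variables (K M : fieldType) (f : {rmorphism K -> M}).

Lemma vr_pull_subring (W : valuation_ring M) : subring_closed [in f @^-1` W].
Proof.
split=> [|x y /set_mem /= Wx /set_mem /= Wy|x y /set_mem /= Wx /set_mem /= Wy]; apply/mem_set => /=.
- by rewrite rmorph1; exact: vr1.
- by rewrite rmorphB; exact: vrB.
- by rewrite rmorphM; exact: vrM.
Qed.

Lemma vr_pull_total (W : valuation_ring M) x : (f @^-1` W) x \/ (f @^-1` W) x^-1.
Proof. by rewrite /= fmorphV; exact: vr_total. Qed.

(** When f is an automorphism this is a conjugate of W, so that conjugates need no separate
    notion. *)
Definition vr_pull (W : valuation_ring M) : valuation_ring K :=
  ValuationRing (vr_pull_subring W) (vr_pull_total W).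

Lemma vr_pull_extends W : extends f (vr_pull W) W.
Proof. by []. Qed.

Lemma vr_eq (V V' : valuation_ring K) :
  (forall x, vr_set V x <-> vr_set V' x) -> V = V'.
Proof.
case: V => [S sS tS]; case: V' => [S' sS' tS'] /= h.
have E : S = S' by apply/seteqP; split=> x /h.
by subst S'; congr ValuationRing; exact: Prop_irrelevance.
Qed.

Lemma extends_pull V W : extends f V W -> V = vr_pull W.
Proof. by move=> VW; apply: vr_eq => x; rewrite -(extendsE VW). Qed.

Lemma vmax_pull W x : vmax (vr_pull W) x <-> vmax W (f x).
Proof.
rewrite /vmax /= fmorphV; split=> -[h|h]; try by right.
  by left; rewrite h rmorph0.
by left; move/eqP: h; rewrite fmorph_eq0 => /eqP.
Qed.

Lemma extends_vmax V W x : extends f V W -> vmax W (f x) <-> vmax V x.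
Proof. by move=> /extends_pull ->; rewrite vmax_pull. Qed.

Lemma residue_map_res V W (VW : extends f V W) (x : vr_type V) (y : vr_type W) :
  val y = f (val x) -> residue_map VW (res x) = res y.
Proof. by move=> h; rewrite residue_mapE; congr res; apply: val_inj. Qed.

End Extensions.

Lemma res_lift (K : fieldType) (W : valuation_ring K) (r : residue W) :
  exists x (Wx : vr_set W x), r = res (vr_elem Wx).
Proof.
have [x <-] := res_surj r; exists (val x), (vr_typeP x).
by congr res; apply: val_inj.
Qed.

Lemma res_elemP (K : fieldType) (W : valuation_ring K) x y (Wx : vr_set W x) (Wy : vr_set W y) :
  res (vr_elem Wx) = res (vr_elem Wy) <-> vmax W (x - y).
Proof. exact: res_eqP. Qed.

(** For a in U only and b in U' only, one of a / b and b / a is in W, which puts a in U' or b in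
    U. *)
Lemma vr_chain (K : fieldType) (W U U' : valuation_ring K) :
  vr_set W `<=` vr_set U -> vr_set W `<=` vr_set U' ->
  vr_set U `<=` vr_set U' \/ vr_set U' `<=` vr_set U.
Proof.
move=> WU WU'; apply: contrapT => /not_orP[].
move=> /existsNP[a /not_implyP[Ua U'a]] /existsNP[b /not_implyP[U'b Ub]].
have b0 : b != 0 by apply/eqP => b0; apply: Ub; rewrite b0; exact: vr0.
have a0 : a != 0 by apply/eqP => a0; apply: U'a; rewrite a0; exact: vr0.
have [h|h] := vr_total W (a / b).
  by apply: U'a; rewrite -(divfK b0 a); apply: vrM => //; exact: WU'.
by apply: Ub; rewrite -(divfK a0 b); apply: vrM => //; apply: WU; rewrite -invf_div.
Qed.

(* Coarsening reverses the inclusion of maximal ideals. *)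
Lemma vmax_subr (K : fieldType) (W U : valuation_ring K) :
  vr_set W `<=` vr_set U -> vmax U `<=` vmax W.
Proof. by move=> WU x [->|h]; [left|right=> /WU]. Qed.

(** Divides by an entry of least value; this makes a nonzero polynomial primitive over V. The
    scaling c is kept as long as the next entry a satisfies c a in V; otherwise a has smaller value
    and its inverse becomes the scaling. *)
Lemma vr_scale (K : fieldType) (V : valuation_ring K) (s : seq K) :
  has (fun a => a != 0) s ->
  exists2 c, {in s, forall a, vr_set V (c * a)} & exists2 a, a \in s & c * a = 1.
Proof.
elim: s => // a s IH /=; have [/IH[c cs [b bs cb]] _|ns] := boolP (has _ s).
  have c0 : c != 0 by apply/eqP => c0; move/eqP: cb; rewrite c0 mul0r eq_sym oner_eq0.
  have [h|h] := pselect (vr_set V (c * a)).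
    exists c; last by exists b; rewrite // inE bs orbT.
    by move=> d; rewrite inE => /predU1P[->|/cs].
  have ca0 : c * a != 0 by apply/eqP => e; apply: h; rewrite e; exact: vr0.
  have a0 : a != 0 by move: ca0; rewrite mulf_eq0 negb_or => /andP[].
  exists a^-1; last by exists a; rewrite ?inE ?eqxx ?mulVf.
  move=> d; rewrite inE => /predU1P[->|ds]; first by rewrite mulVf //; exact: vr1.
  have -> : a^-1 * d = (c * a)^-1 * (c * d) by rewrite invfM mulrACA mulVf // mul1r.
  by apply: vrM; [exact/vmax_sub/vmax_inv|exact: cs].
rewrite orbF => a0; exists a^-1; last by exists a; rewrite ?inE ?eqxx ?mulVf.
move=> d; rewrite inE => /predU1P[->|ds]; first by rewrite mulVf //; exact: vr1.
have -> : d = 0 by apply: contraNeq ns => d0; apply/hasP; exists d.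
by rewrite mulr0; exact: vr0.
Qed.

(* If y is a unit of W' in the maximal ideal of W, a polynomial over V taking at y
   a value in the maximal ideal of W' is zero modulo the maximal ideal of V. *)
Lemma extends_incomparable (K M : fieldType) (f : {rmorphism K -> M})
    (V : valuation_ring K) (W W' : valuation_ring M) :
  (forall x : M, exists2 h : {poly K}, h != 0 & root (map_poly f h) x) ->
  extends f V W -> extends f V W' -> vr_set W `<=` vr_set W' -> W = W'.
Proof.
move=> alg VW VW' WW'; apply: vr_eq => x; split; first exact: WW'.
move=> W'x; apply: contrapT => Wx; have my := vmax_inv Wx.
have W'y : vr_set W' x^-1 by apply: WW'; exact: vmax_sub my.
have x0 : x != 0 by apply/eqP => x0; apply: Wx; rewrite x0; exact: vr0.
have ny : ~ vmax W' x^-1 by case=> [/eqP|]; rewrite ?invr_eq0 ?(negbTE x0) // invrK.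
have claim (h : {poly K}) : (forall i, vr_set V h`_i) ->
    vmax W' (map_poly f h).[x^-1] -> forall i, vmax V h`_i.
  elim/poly_ind: h => [|h a IH] hV; first by move=> _ i; rewrite coef0; exact: vmax0.
  rewrite rmorphD rmorphM /= map_polyX map_polyC /= hornerMXaddC => hm.
  have hV' i : vr_set V h`_i.
    by have := hV i.+1; rewrite coefD coefMX coefC /= addr0.
  have Va : vr_set V a by have := hV 0%N; rewrite coefD coefMX coefC /= add0r.
  have Wh : vr_set W (map_poly f h).[x^-1].
    rewrite horner_coef; apply: vr_sum => i _; apply: vrM.
      by rewrite coef_map; apply/(extendsE VW).
    by apply: vrX; exact: vmax_sub my.
  have ma : vmax V a.
    apply/(extends_vmax _ VW).
    rewrite -[f a](addKr ((map_poly f h).[x^-1] * x^-1)) addrC.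
    by apply: vmaxB; [exact: (vmax_subr WW')|exact: vmaxMl].
  have mh : vmax W' (map_poly f h).[x^-1].
    have : vmax W' ((map_poly f h).[x^-1] * x^-1).
      rewrite -[_ * _](addrK (f a)); apply: vmaxB => //; exact/(extends_vmax _ VW').
    by move=> /vmax_prime[] //; exact: WW'.
  move=> [|i]; rewrite coefD coefMX coefC /= ?add0r ?addr0 //; exact: IH.
have [h h0 hx] := alg x^-1.
have hn : has (fun a => a != 0) h.
  by apply/hasP; exists (lead_coef h); rewrite ?lead_coef_eq0 // mem_nth // prednK ?size_poly_gt0.
have [c hc [a /(nthP 0)[i isz <-] ca]] := vr_scale V hn.
suff : vmax V ((c *: h)`_i) by rewrite coefZ ca => /vmax1.
apply: claim => [j|]; last first.
  rewrite linearZ /= hornerZ; move/rootP: hx => ->; rewrite mulr0; exact: vmax0.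
rewrite coefZ; have [jh|jh] := ltnP j (size h); first by apply: hc; exact: mem_nth.
by rewrite nth_default // mulr0; exact: vr0.
Qed.

(* Two relations 1 = c_0 + ... + c_n x^n and 1 = g_0 + ... + g_n x^-n with
   coefficients in an ideal can both be shortened. *)
Lemma shorten_relation (M : fieldType) (A I : set M) (x : M) (n : nat) (c g : nat -> M) :
  x != 0 ->
  (forall a b, I a -> I b -> I (a + b)) -> (forall a b, A a -> I b -> I (a * b)) ->
  (forall a, I a -> A a) -> (forall a, I a -> A (1 - a)) -> I 0 ->
  (forall i, I (c i)) -> (forall i, I (g i)) ->
  \sum_(i < n.+2) c i * x ^+ i = 1 -> \sum_(i < n.+2) g i * x^-1 ^+ i = 1 ->
  exists2 c' : nat -> M, forall i, I (c' i) & \sum_(i < n.+1) c' i * x ^+ i = 1.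
Proof.
move=> x0 ID IM IA I1 I0 Ic Ig Ec Eg.
(* Multiplied by x^(n+1), the second relation expresses (1 - g_0) x^(n+1) through lower powers of x.
   Substituting this in 1 - g_0 times the first relation gives a sum equal to 1 - g_0, and the extra
   g_0 in degree 0 restores the 1. *)
exists (fun i => (if i == 0%N then g 0%N else 0) + ((1 - g 0%N) * c i + c n.+1 * g (n.+1 - i)%N)).
- move=> i; apply: (ID); first by case: eqP.
  by apply: ID; apply: IM => //; [exact: I1|exact: IA].
- under eq_bigr do rewrite mulrDl mulrDl -!mulrA.
rewrite big_split big_split /= -!mulr_sumr.
rewrite big_ord_recl /= big1 ?addr0 => [|i _]; last by rewrite mul0r.
have /(congr1 (fun z => z * x ^+ n.+1)) := Eg; rewrite mul1r big_distrl /= big_ord_recl /=.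
rewrite mulr1 => Eg'.
have -> : \sum_(i < n.+1) g (n.+1 - i)%N * x ^+ i = (1 - g 0%N) * x ^+ n.+1.
  rewrite mulrBl mul1r -{1}Eg' addrC addKr.
  rewrite [RHS](reindex_inj rev_ord_inj) /=; apply: eq_bigr => i _.
  have e : bump 0 (n.+1 - i.+1)%N = (n.+1 - i)%N.
    by rewrite /bump /= add1n subSS subSn // -ltnS.
  rewrite e -mulrA; congr (g _ * _).
  have -> : x ^+ n.+1 = x ^+ (n.+1 - i) * x ^+ i by rewrite -exprD subnK // ltnW.
  by rewrite mulrA -exprMn mulVf // expr1n mul1r.
rewrite mulrCA -mulrDr.
have -> : \sum_(i < n.+1) c i * x ^+ i + c n.+1 * x ^+ n.+1 = 1 by rewrite -Ec [RHS]big_ord_recr.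
by rewrite mulr1 addrC subrK.
Qed.

(** * Chevalley's theorem: valuations extend to larger fields *)

Section Chevalley.
Variables (K M : fieldType) (f : {rmorphism K -> M}) (V : valuation_ring K).

(** Replaces Chevalley's pairs of a ring and a prime ideal: for a subring A containing the image of
    V, contracting to V amounts to the maximal ideal of V generating a proper ideal of A, because z
    outside V has its inverse in that maximal ideal. *)
Let good (A : set M) := subring_closed [in A] /\ f @^-1` A = vr_set V.

Let good_1 A : good A -> A 1.
Proof. by move=> [[/set_mem]]. Qed.
Let good_B A x y : good A -> A x -> A y -> A (x - y).
Proof. by move=> [[_ h _] _] Ax Ay; apply/set_mem/h; exact: mem_set. Qed.
Let good_M A x y : good A -> A x -> A y -> A (x * y).
Proof. by move=> [[_ _ h] _] Ax Ay; apply/set_mem/h; exact: mem_set. Qed.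
Let good_f A x : good A -> A (f x) <-> vr_set V x.
Proof. by move=> [_ /seteqP[h1 h2]]; split; [exact: h1|exact: h2]. Qed.
Let good_0 A : good A -> A 0.
Proof. by move=> gA; rewrite -(subrr 1); have := good_1 gA => A1; exact: good_B. Qed.
Let good_D A x y : good A -> A x -> A y -> A (x + y).
Proof.
move=> gA Ax Ay; rewrite -[y]opprK -[- y]add0r; apply: good_B => //.
by apply: good_B => //; exact: good_0.
Qed.

Let maximal_good : exists2 A, good A & forall B, A `<=` B -> good B -> B `<=` A.
Proof.
have good_base : good (f @` vr_set V).
  split.
    split=> [|_ _ /set_mem[x Vx <-] /set_mem[y Vy <-]|_ _ /set_mem[x Vx <-] /set_mem[y Vy <-]]; apply/mem_set.
    - by exists 1; [exact: vr1|rewrite rmorph1].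
    - by exists (x - y); [exact: vrB|rewrite rmorphB].
    - by exists (x * y); [exact: vrM|rewrite rmorphM].
  by apply/seteqP; split=> x /= => [[y Vy /fmorph_inj <-]//|Vx]; exists x.
have [F FP Ftot|A [[A0|gA] Amax]] := @Zorn_bigcup M (fun A => A = set0 \/ good A).
- have [[A FA gA]|nF] := pselect (exists2 A, F A & good A); last first.
    left; apply/seteqP; split=> // x [B FB Bx]; case: (FP B FB) => [B0|gB].
      by move: Bx; rewrite B0.
    by case: nF; exists B.
  right; have two x y : (\bigcup_(X in F) X) x -> (\bigcup_(X in F) X) y ->
      exists B, [/\ F B, good B, B x & B y].
    move=> [B FB Bx] [C FC Cy].
    have gB : good B by case: (FP B FB) => // B0; move: Bx; rewrite B0.
    have gC : good C by case: (FP C FC) => // C0; move: Cy; rewrite C0.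
    case: (Ftot B C FB FC) => h; [by exists C; split=> //; exact: h|].
    by exists B; split=> //; exact: h.
  split.
    split=> [|x y /set_mem hx /set_mem hy|x y /set_mem hx /set_mem hy]; apply/mem_set.
    - by exists A => //; exact: good_1.
    - by have [B [FB gB Bx By]] := two x y hx hy; exists B => //; exact: good_B.
    - by have [B [FB gB Bx By]] := two x y hx hy; exists B => //; exact: good_M.
  apply/seteqP; split=> x /=.
    by move=> /[dup] h /two /(_ h) [B [FB gB Bx _]]; apply/(good_f x gB).
  by move=> Vx; exists A => //; apply/good_f.
- case: (Amax (f @` vr_set V)); last by right.
  rewrite A0; split; first by move=> ? [].
  by move=> /(_ 1); case; exists 1; [exact: vr1|rewrite rmorph1].
- exists A => // B AB gB; apply: contrapT => BA; apply: (Amax B) => //; last by right.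
Qed.

(** If neither x nor its inverse were in the maximal good subring A, both would satisfy relations
    with value 1 and coefficients in the ideal generated by the maximal ideal of V. Shortening the
    two in turn ends with 1 in that ideal. *)
Lemma vr_extension_exists : exists W : valuation_ring M, extends f V W.
Proof.
have [A gA Amax] := maximal_good.
suff tot x : A x \/ A x^-1.
  have [sA eA] := gA; by exists (ValuationRing sA tot).
have [->|x0] := eqVneq x 0; first by left; exact: good_0.
(* Single products already form an ideal: of two elements of V one divides the other, so a sum of
   two products is again one. *)
pose I : set M := [set y | exists m r, [/\ vmax V m, A r & y = f m * r]].
have Af m : vr_set V m -> A (f m) by move=> Vm; apply/good_f.
have IM a b : A a -> I b -> I (a * b).
  move=> Aa [m [r [mm Ar ->]]]; exists m, (a * r); split=> //; first exact: good_M.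
  by rewrite mulrCA.
have IA a : I a -> A a.
  by move=> [m [r [mm Ar ->]]]; apply: good_M => //; apply: Af; exact: vmax_sub.
have I0 : I 0 by exists 0, 0; split; [exact: vmax0|exact: good_0|rewrite mulr0].
have ID a b : I a -> I b -> I (a + b).
  move=> [m [r [mm Ar ->]]] [m' [r' [mm' Ar' ->]]].
  have aux (n n' : K) s s' : vmax V n -> vmax V n' -> A s -> A s' -> n != 0 ->
      vr_set V (n' / n) -> I (f n * s + f n' * s').
    move=> hn hn' As As' n0 h; exists n, (s + f (n' / n) * s'); split=> //.
      by apply: good_D => //; apply: good_M => //; exact: Af.
    by rewrite mulrDr mulrA -rmorphM mulrC [n * _]mulrC divfK // mulrC.
  have [->|m0] := eqVneq m 0.
    by rewrite rmorph0 mul0r add0r; exists m', r'.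
  have [->|m'0] := eqVneq m' 0.
    by rewrite rmorph0 mul0r addr0; exists m, r.
  have [h|h] := vr_total V (m' / m); first exact: aux.
  by rewrite addrC; apply: aux => //; rewrite -invf_div.
have I1 : ~ I 1.
  move=> [m [r [mm Ar E]]].
  have m0 : m != 0 by apply/eqP => m0; move/eqP: E; rewrite m0 rmorph0 mul0r oner_eq0.
  apply: (vmax_invN mm m0); apply/(good_f _ gA).
  suff -> : f m^-1 = r by [].
  by rewrite fmorphV -[RHS](mulKf (_ : f m != 0)) ?fmorph_eq0 // -E mulr1.
pose J (y : M) n := exists2 c : nat -> M, forall i, I (c i) & \sum_(i < n) c i * y ^+ i = 1.
have JS y n m : (n <= m)%N -> J y n -> J y m.
  move=> nm [c Ic E]; exists (fun i => if (i < n)%N then c i else 0) => [i|]; first by case: ifP.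
  rewrite -E (big_ord_widen m (fun i => c i * y ^+ i)) // [in RHS]big_mkcond /=.
  by apply: eq_bigr => i _; case: ifP => //; rewrite mul0r.
(* By maximality A[y] contains some f z with z outside V; the expression of f z in powers of y,
   multiplied by the inverse of f z, is the relation. *)
have JP y : ~ A y -> exists n, J y n.
  move=> nAy.
  pose B : set M := [set z | exists2 h : {poly M}, forall i, A h`_i & z = h.[y]].
  have AB : A `<=` B.
    by move=> a Aa; exists a%:P; rewrite ?hornerC // => i; rewrite coefC; case: eqP => // _; exact: good_0.
  have By : B y.
    exists 'X; rewrite ?hornerX // => i; rewrite coefX.
    by case: eqP => _; [exact: good_1|exact: good_0].
  have sB : subring_closed [in B].
    split=> [|_ _ /set_mem[h hA ->] /set_mem[g gA' ->]|_ _ /set_mem[h hA ->] /set_mem[g gA' ->]]; apply/mem_set.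
    - by apply: AB; exact: good_1.
    - by exists (h - g); rewrite ?hornerD ?hornerN // => i; rewrite coefB; exact: good_B.
    - exists (h * g); rewrite ?hornerM // => i; rewrite coefM.
      by elim/big_ind: _ => [|? ? ? ?|j _]; [exact: good_0|exact: good_D|exact: good_M].
  have : ~ (f @^-1` B `<=` vr_set V).
    move=> h; apply: nAy; apply: (Amax B) => //; split=> //; apply/seteqP; split=> // z Vz.
    by apply: AB; exact: Af.
  move=> /existsNP[z /not_implyP[[h hA zE] nVz]].
  exists (size h), (fun i => f z^-1 * h`_i) => [i|].
    by exists z^-1, h`_i; split=> //; exact: vmax_inv.
  under eq_bigr do rewrite -mulrA; rewrite -mulr_sumr -horner_coef -zE -rmorphM mulVf ?rmorph1 //.
  by apply/eqP => z0; apply: nVz; rewrite z0; exact: vr0.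
have noJ n y : y != 0 -> J y n -> J y^-1 n -> False.
  elim: n => [|[|n] IH] y0.
  - by move=> [c _]; rewrite big_ord0 => /esym/eqP; rewrite oner_eq0.
  - by move=> [c Ic]; rewrite big_ord1 mulr1 => E; case: I1; rewrite -E.
  move=> [c Ic Ec] [g Ig Eg]; apply: IH => //.
    by apply: (@shorten_relation _ A I y n c g) => // a Ia; apply: good_B; [|exact: good_1|exact: IA].
  apply: (@shorten_relation _ A I y^-1 n g c); rewrite ?invr_eq0 ?invrK // => a Ia.
  by apply: good_B; [|exact: good_1|exact: IA].
apply: contrapT => /not_orP[/JP[n hn] /JP[m hm]].
by apply: (noJ (maxn n m) x) => //; [apply: JS hn; exact: leq_maxl|apply: JS hm; exact: leq_maxr].
Qed.

End Chevalley.

(** A monic equation is lifted coefficientwise; its root in Omega is integral over B, hence has a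
    residue. *)
Lemma residue_closed (Omega : fieldType) (B : valuation_ring Omega) :
  GRing.closed_field_axiom Omega -> GRing.closed_field_axiom (residue B).
Proof.
move=> cl n P n0; pose c i : Omega := val (residue_repr (P i)).
have [x E] := cl n c n0.
have Bc i : vr_set B (c i) by exact: vr_typeP.
have Bx : vr_set B x.
  apply: (@vr_root_monic _ _ ('X^n - \poly_(i < n) c i)).
  - apply/monicP; rewrite lead_coefDl ?lead_coefXn // size_polyN size_polyXn ltnS.
    exact: size_poly.
  - move=> i; rewrite coefB coefXn coef_poly; apply: vrB.
      by case: eqP => _; [exact: vr1|exact: vr0].
    by case: ifP => _ //; exact: vr0.
  - rewrite /root !hornerE horner_poly subr_eq0; exact/eqP.
exists (res (vr_elem Bx)).
have -> : \sum_(i < n) P i * res (vr_elem Bx) ^+ i =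
   res (\sum_(i < n) residue_repr (P i) * vr_elem Bx ^+ i).
  by rewrite (rmorph_sum (@res _ B)); apply: eq_bigr => i _; rewrite (rmorphM (@res _ B)) (rmorphXn (@res _ B)); congr (_ * _); exact/esym/residue_reprK.
rewrite -(rmorphXn (@res _ B)); congr res; apply: val_inj.
rewrite rmorphXn rmorph_sum [LHS]E.
by apply: eq_bigr => i _; rewrite rmorphM rmorphXn.
Qed.

(* Induction on the support A: multiplicativity lets one cancel a term whose map
   differs from phi i0. *)
Lemma dedekind_independence (L L' : fieldType) (I : finType)
    (phi : I -> {rmorphism L -> L'}) (A : {set I}) (c : I -> L') (i0 : I) :
  (forall t, \sum_(i in A) c i * phi i t = 0) ->
  \sum_(i in A | `[< phi i =1 phi i0 >]) c i = 0.
Proof.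
have [n] := ubnP #|A|; elim: n A c => // n IH A c; rewrite ltnS => An h.
have [eqA|] := pselect (forall i, i \in A -> phi i =1 phi i0).
  rewrite -[RHS](h 1); rewrite big_mkcondr; apply: eq_bigr => i iA.
  by rewrite rmorph1 mulr1; case: asboolP => // -[]; exact: eqA.
move=> /existsNP[j /not_implyP[jA /existsNP[x /eqP nx]]].
have {}IH := IH (A :\ j) (fun i => c i * (phi i x - phi j x)).
have /IH/(_ _) : (#|A :\ j| < n)%N by rewrite (leq_trans _ An) // (cardsD1 j A) jA.
have nj : `[< phi j =1 phi i0 >] = false.
  by apply/asboolPn => /(_ x) /eqP; rewrite (negbTE nx).
have -> : \sum_(i in A :\ j | `[< phi i =1 phi i0 >]) c i * (phi i x - phi j x) =
    (\sum_(i in A | `[< phi i =1 phi i0 >]) c i) * (phi i0 x - phi j x).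
  rewrite mulr_suml; apply: eq_big => [i|i /andP[_ /asboolP ->] //].
  by rewrite !inE; case: eqP => //= ->; rewrite nj andbF.
move=> e; have /eqP : (\sum_(i in A | `[< phi i =1 phi i0 >]) c i) * (phi i0 x - phi j x) = 0.
  apply: e => t; have := h (x * t); have := h t.
  move=> /(congr1 (fun z => phi j x * z)); rewrite mulr0 => h1 h2.
  transitivity (\sum_(i in A) c i * phi i (x * t) - phi j x * \sum_(i in A) c i * phi i t);
    last by rewrite h1 h2 subrr.
  rewrite mulr_sumr -sumrB [RHS](bigD1 j jA) /=.
  rewrite rmorphM mulrCA subrr add0r; apply: eq_big => [i|i _]; first by rewrite !inE andbC.
  rewrite rmorphM mulrBr mulrBl; congr (_ - _); first by rewrite mulrA.
  by rewrite mulrA [phi j x * c i]mulrC.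
rewrite mulf_eq0 => /orP[/eqP //|]; rewrite subr_eq0 eq_sym => /eqP E.
by rewrite E eqxx in nx.
Qed.

(** * Approximation and Galois actions *)

(* Otherwise U := {z | z q \subset q}, with q := {z | z m_W \subset W'}, is a
   valuation ring containing W, W' and hence d, so that 1 \in q. *)
Lemma separating_element (K : fieldType) (W W' : valuation_ring K) (d : K) :
  ~ vr_set W `<=` vr_set W' -> ~ vr_set W' `<=` vr_set W -> d != 0 ->
  (forall U : valuation_ring K,
     vr_set W `<=` vr_set U -> vr_set W' `<=` vr_set U -> vr_set U d) ->
  exists2 g, vmax W g & ~ vr_set W' (g / d).
Proof.
move=> /existsNP[a /not_implyP[Wa W'a]] /existsNP[b /not_implyP[W'b Wb]] d0 Ud.
apply: contrapT => /forall2NP h.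
pose q : set K := [set z | forall g, vmax W g -> vr_set W' (z * g)].
have qd : q d^-1.
  by move=> g mg; case: (h g) => // /contrapT; rewrite mulrC.
pose S : set K := [set z | forall y, q y -> q (z * y)].
have sS : subring_closed [in S].
  split=> [|x y /set_mem Sx /set_mem Sy|x y /set_mem Sx /set_mem Sy]; apply/mem_set => z qz.
  - by rewrite mul1r.
  - by move=> g mg; rewrite !mulrBl; apply: vrB; [exact: Sx|exact: Sy].
  - by rewrite -mulrA; apply: Sx; exact: Sy.
have WS : vr_set W `<=` S.
  by move=> z Wz y qy g mg; rewrite -mulrA mulrCA; apply: qy; exact: vmaxMl.
have W'S : vr_set W' `<=` S.
  by move=> z Wz y qy g mg; rewrite -mulrA; apply: vrM => //; exact: qy.
have tS x : S x \/ S x^-1.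
  by case: (vr_total W x) => /WS; [left|right].
have := Ud (ValuationRing sS tS) WS W'S => /(_ _ qd); rewrite divff // => q1.
have b0 : b != 0 by apply/eqP => b0; apply: Wb; rewrite b0; exact: vr0.
apply: W'a; rewrite -[a](divfK b0); apply: vrM => //.
by rewrite -[a / b]mul1r; apply: q1; apply: vmaxMl => //; exact: vmax_inv.
Qed.

(* The polynomials 1 + X * comax k are monic with constant term 1 and pairwise
   comaximal, as in Euclid's proof: at most one of them vanishes at a given
   residue. *)
Fixpoint comax (K : fieldType) (x : K) (k : nat) : K :=
  if k is k'.+1 then comax x k' * (1 + x * comax x k') else 1.

Lemma comax_vr (K : fieldType) (W : valuation_ring K) x k :
  vr_set W x -> vr_set W (comax x k).
Proof.
move=> Wx; elim: k => [|k IH] /=; first exact: vr1.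
by apply: vrM => //; apply: vrD; [exact: vr1|exact: vrM].
Qed.

(** For x in W, a factor [1 + x * comax x k] in the maximal ideal divides all later [comax x l], so
    every later factor is a unit. For x outside W, [comax x k] has nonpositive value, and the factor
    has the value of [x * comax x k], at most that of x. The threshold [k0] lets one k serve
    finitely many rings. *)
Lemma comax_unit (K : fieldType) (W : valuation_ring K) x :
  exists k0, forall k, (k0 <= k)%N ->
    1 + x * comax x k != 0 /\
    if `[< vr_set W x >] then ~ vmax W (1 + x * comax x k)
    else vr_set W (x / (1 + x * comax x k)).
Proof.
case: asboolP => Wx.
  suff [k0 h] : exists k0, forall k, (k0 <= k)%N -> ~ vmax W (1 + x * comax x k).
    by exists k0 => k /h hk; split=> //; exact: vunit_neq0 hk.
  have [[k mk]|h] := pselect (exists k, vmax W (1 + x * comax x k)); last first.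
    by exists 0%N => k _ mk; apply: h; exists k.
  exists k.+1 => l kl ml.
  have : vmax W (comax x l).
    elim: l kl {ml} => // l IH; rewrite ltnS leq_eqVlt => /predU1P[<-|kl] /=.
      by apply: vmaxMl => //; exact: comax_vr.
    apply: vmaxMr; last exact: IH.
    by apply: vrD; [exact: vr1|apply: vrM => //; exact: comax_vr].
  move=> /(vmaxMl Wx) h; apply: (@vmax1 _ W).
  by rewrite -[1](addrK (x * comax x l)); apply: vmaxB.
have mx := vmax_inv Wx.
have x0 : x != 0 by apply/eqP => x0; apply: Wx; rewrite x0; exact: vr0.
have key c : c != 0 -> vr_set W c^-1 ->
    1 + x * c != 0 /\ vr_set W (x / (1 + x * c)).
  move=> c0 Wc.
  have m1 : vmax W (x * c)^-1 by rewrite invfM; apply: vmaxMr.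
  have n1 : ~ vmax W (1 + (x * c)^-1).
    move=> h; apply: (@vmax1 _ W); rewrite -[1](addrK (x * c)^-1); exact: vmaxB.
  have E : 1 + x * c = (1 + (x * c)^-1) * (x * c).
    by rewrite mulrDl mul1r mulVf ?mulf_neq0 // addrC.
  rewrite E; split; first by rewrite !mulf_neq0 //; exact: vunit_neq0 n1.
  set u := 1 + _ in n1 *; rewrite invfM mulrCA invfM mulVKf //.
  by apply: vrM => //; exact: vunit_inv n1.
have hc k : comax x k != 0 /\ vr_set W (comax x k)^-1.
  elim: k => [|k [c0 Wc]] /=; first by rewrite oner_eq0 invr1; split=> //; exact: vr1.
  have [e h] := key _ c0 Wc.
  rewrite mulf_neq0 //; split=> //; rewrite invfM; apply: vrM => //.
  rewrite -[_^-1](mulKf x0); apply: vrM => //; exact: vmax_sub mx.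
by exists 0%N => k _; have [c0 Wc] := hc k; apply: key.
Qed.

(** The condition on [d i] is forced: u is a unit in every overring of W0. The element u is a
    product of inverses of [1 + x i * comax (x i) k], where [x i] is small at W0 and large at [W i],
    also relative to [d i]: each inverse is 1 modulo W0, small at [W i] and, for large k, integral
    at all the other rings. *)
Lemma approximation (K : fieldType) (W0 : valuation_ring K) (I : finType)
    (P : pred I) (W : I -> valuation_ring K) (d : I -> K) :
  (forall i, P i -> ~ vr_set W0 `<=` vr_set (W i)) ->
  (forall i, P i -> ~ vr_set (W i) `<=` vr_set W0) ->
  (forall i (U : valuation_ring K), P i ->
     vr_set W0 `<=` vr_set U -> vr_set (W i) `<=` vr_set U -> vr_set U (d i)) ->
  exists u, vmax W0 (u - 1) /\
    forall i, P i -> vmax (W i) u /\ vmax (W i) (u * d i).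
Proof.
move=> h1 h2 hd.
have /choice[x hx] : forall i, exists x, P i -> [/\ vmax W0 x, ~ vr_set (W i) x &
    ~ vr_set (W i) (d i) -> vmax (W i) (d i / x)].
  move=> i; have [Pi|nP] := boolP (P i); last by exists 0.
  have [Wd|Wd] := pselect (vr_set (W i) (d i)).
    have [||g mg] := @separating_element _ W0 (W i) 1 (h1 i Pi) (h2 i Pi); first exact: oner_neq0.
      by move=> U _ _; exact: vr1.
    by rewrite divr1 => Wg; exists g; split.
  have d0 : d i != 0 by apply/eqP => e; apply: Wd; rewrite e; exact: vr0.
  have [|g mg Wg] := separating_element (h1 i Pi) (h2 i Pi) d0; first by move=> U; exact: hd.
  exists g => _; split=> //; last by move=> _; rewrite -invf_div; exact: vmax_inv.
  move=> Wg'; apply: Wg; apply: vrM => //; exact: vmax_sub (vmax_inv Wd).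
have /choice[k0 hk0] : forall i, exists k0, forall j k, (k0 <= k)%N ->
    1 + x i * comax (x i) k != 0 /\
    if `[< vr_set (W j) (x i) >] then ~ vmax (W j) (1 + x i * comax (x i) k)
    else vr_set (W j) (x i / (1 + x i * comax (x i) k)).
  move=> i; have /choice[k0 hk0] := fun j => comax_unit (W j) (x i).
  exists (\max_j k0 j)%N => j k hk; apply: hk0; apply: leq_trans hk; exact: leq_bigmax.
pose q i := 1 + x i * comax (x i) (k0 i).
have q0 i : q i != 0 by have [] := hk0 i i _ (leqnn _).
have Wq i j : vr_set (W j) (q i)^-1.
  have [_] := hk0 i j _ (leqnn _); case: asboolP => [Wx|Wx h]; first exact: vunit_inv.
  have x0 : x i != 0 by apply/eqP => e; apply: Wx; rewrite e; exact: vr0.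
  rewrite -[_^-1](mulKf x0); apply: vrM => //; exact/vmax_sub/vmax_inv.
exists (\prod_(i | P i) (q i)^-1); split.
  rewrite [X in vmax _ (_ - X)](_ : 1 = \prod_(i | P i) (1 : K)); last by rewrite big1.
  have mq i : P i -> vmax W0 (q i - 1).
    move=> /hx[mx _ _]; rewrite addrC addKr; apply: vmaxMr => //; apply: comax_vr; exact: vmax_sub.
  have nq i : P i -> ~ vmax W0 (q i).
    by move=> /mq h1' h2'; apply: (@vmax1 _ W0); exact: vmax_cong h1' h2'.
  apply: vmax_cong_prod => i Pi; [exact/vunit_inv/nq|exact: vr1|].
  have -> : (q i)^-1 - 1 = - ((q i)^-1 * (q i - 1)).
    by rewrite mulrBr mulVf // mulr1 opprB.
  by apply/vmaxN/vmaxMl; [exact/vunit_inv/nq|exact: mq].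
move=> i Pi; rewrite (bigD1 i Pi) /=; set r := \prod_(j | _) _.
have Wr : vr_set (W i) r by apply: vr_prod => j _; exact: Wq.
have [mx Wx hdx] := hx i Pi.
have x0 : x i != 0 by apply/eqP => e; apply: Wx; rewrite e; exact: vr0.
have hq : vr_set (W i) (x i / q i).
  by have [_] := hk0 i i _ (leqnn _); case: asboolP.
have mq : vmax (W i) (q i)^-1.
  by rewrite -[_^-1](mulKf x0); apply: vmaxMr => //; exact: vmax_inv.
split; first exact: vmaxMr.
rewrite mulrAC; apply: vmaxMr => //.
have [Wd|Wd] := pselect (vr_set (W i) (d i)); first exact: vmaxMr.
have -> : (q i)^-1 * d i = (x i / q i) * (d i / x i).
  by rewrite [RHS]mulrC mulrA divfK // mulrC.
by apply: vmaxMl => //; exact: hdx.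
Qed.

(* M is Galois over f(k) with finite group gact_grp. *)
Record galois_act (k M : fieldType) (f : {rmorphism k -> M}) := GaloisAct {
  gact_grp : finGroupType;
  gact : gact_grp -> {rmorphism M -> M};
  gact1 : forall z, gact 1%g z = z;
  gactM : forall s t z, gact (s * t)%g z = gact t (gact s z);
  gact_base : forall s a, gact s (f a) = f a;
  gact_fix : forall z, (forall s, gact s z = z) -> exists a, z = f a
}.

Section GaloisAct.
Variables (k M : fieldType) (f : {rmorphism k -> M}) (G : galois_act f).
Local Notation gT := (gact_grp G).
Local Notation act := (gact (g := G)).
Implicit Types (s t : gT) (W : valuation_ring M).

Lemma gactK s z : act s^-1%g (act s z) = z.
Proof. by rewrite -gactM mulgV gact1. Qed.

Lemma gactKV s z : act s (act s^-1%g z) = z.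
Proof. by rewrite -gactM mulVg gact1. Qed.

Lemma gactX s n z : act (s ^+ n)%g z = iter n (act s) z.
Proof. by elim: n => [|n IH]; rewrite ?gact1 //= -IH expgSr gactM. Qed.

Lemma gact_trace z : exists a, \sum_s act s z = f a.
Proof.
apply: (gact_fix (g := G)) => t; rewrite rmorph_sum [RHS](reindex_inj (mulIg t)) /=.
by apply: eq_bigr => s _; rewrite gactM.
Qed.

Lemma gact_norm z : exists a, \prod_s act s z = f a.
Proof.
apply: (gact_fix (g := G)) => t; rewrite rmorph_prod [RHS](reindex_inj (mulIg t)) /=.
by apply: eq_bigr => s _; rewrite gactM.
Qed.

Lemma gact_charpoly z : exists h : {poly k},
  map_poly f h = \prod_s ('X - (act s z)%:P).
Proof.
set h := \prod_s _.
have /choice[c hc] : forall i, exists a, h`_i = f a.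
  move=> i; apply: (gact_fix (g := G)) => t; rewrite -coef_map.
  suff -> : map_poly (act t) h = h by [].
  rewrite /h rmorph_prod [RHS](reindex_inj (mulIg t)) /=.
  by apply: eq_bigr => s _; rewrite rmorphB /= map_polyX map_polyC /= gactM.
exists (\poly_(i < size h) c i); apply/polyP => i; rewrite coef_map coef_poly.
case: ltnP => [_|hi]; first by rewrite hc.
by rewrite raddf0 nth_default.
Qed.

Lemma gact_algebraic z : exists2 h : {poly k}, h != 0 & root (map_poly f h) z.
Proof.
have [h hE] := gact_charpoly z; exists h.
  rewrite -(map_poly_eq0 f) hE; apply: monic_neq0; apply: monic_prod => s _.
  exact: monicXsubC.
rewrite hE /root horner_prod (bigD1 1%g) //= gact1 !hornerE subrr.
by rewrite mul0r.
Qed.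

Definition gstab W : {set gT} :=
  [set s | `[< forall x, vr_set W (act s x) <-> vr_set W x >]].

Lemma gstabP W s :
  reflect (forall x, vr_set W (act s x) <-> vr_set W x) (s \in gstab W).
Proof. by rewrite inE; exact: asboolP. Qed.

Lemma gstab_group_set W : group_set (gstab W).
Proof.
apply/group_setP; split; first by apply/gstabP => x; rewrite gact1.
by move=> s t /gstabP hs /gstabP ht; apply/gstabP => x; rewrite gactM ht.
Qed.
Canonical gstab_group W := Group (gstab_group_set W).

Lemma gstab_vmax W s x : s \in gstab W -> vmax W (act s x) <-> vmax W x.
Proof.
move=> /gstabP h; rewrite /vmax /= -fmorphV; split=> -[e|e].
- by left; apply/eqP; rewrite -(fmorph_eq0 (act s)) e.
- by right=> /h.
- by left; rewrite e rmorph0.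
- by right=> /h.
Qed.

Lemma gstab_extends W s : s \in gstab W -> extends (act s) W W.
Proof. by move=> /gstabP h; apply/seteqP; split=> x /h. Qed.

(** As s has finite order, its inverse is one of its powers, and one inclusion gives the other. Thus
    comparable conjugates are equal. *)
Lemma gact_iter_stable W s : (forall x, vr_set W x -> vr_set W (act s x)) -> s \in gstab W.
Proof.
move=> h; apply/gstabP => x; split; last exact: h.
have hn n y : vr_set W y -> vr_set W (act (s ^+ n)%g y).
  by move=> Wy; rewrite gactX; elim: n => //= n; exact: h.
move=> /(hn #[s]%g.-1); rewrite -gactM -expgS prednK ?order_gt0 //.
by rewrite expg_order gact1.
Qed.

Lemma gact_pull_sub W s : vr_set W `<=` vr_set (vr_pull (act s) W) -> s \in gstab W.
Proof. by move=> h; apply: gact_iter_stable => x /h. Qed.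

Lemma gact_pull_sup W s : vr_set (vr_pull (act s) W) `<=` vr_set W -> s \in gstab W.
Proof.
move=> h; rewrite -groupV; apply: gact_iter_stable => x Wx; apply: h => /=.
by rewrite gactKV.
Qed.

(** Both U and its conjugate contain the conjugate of W, hence are comparable. *)
Lemma gstab_common_overring W U s : vr_set W `<=` vr_set U ->
  vr_set (vr_pull (act s) W) `<=` vr_set U -> s \in gstab U.
Proof.
move=> WU WsU; have WsUs : vr_set (vr_pull (act s) W) `<=` vr_set (vr_pull (act s) U).
  by move=> x /= /WU.
by have [/gact_pull_sub|/gact_pull_sup] := vr_chain WsU WsUs.
Qed.

(* If y / s y lies in the maximal ideal, so does every y / s^n y, including 1. *)
Lemma gstab_ratio U s y : s \in gstab U -> y != 0 -> vr_set U (act s y / y).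
Proof.
move=> sU y0; apply: contrapT => /vmax_inv; rewrite invf_div => m.
have h n : vmax U (y / act (s ^+ n.+1)%g y).
  elim: n => [|n IH]; first by rewrite expg1.
  have sy0 : act s y != 0 by rewrite fmorph_eq0.
  rewrite -[y / _](_ : (y / act s y) * (act s y / act (s ^+ n.+2)%g y) = _); last first.
    by rewrite mulrA divfK.
  apply: vmaxMr => //; apply: vmax_sub.
  by rewrite [(s ^+ _)%g]expgSr gactM -fmorph_div; apply/gstab_vmax.
have := h #[s]%g.-1; rewrite prednK ?order_gt0 // expg_order gact1 divff //.
exact: vmax1.
Qed.

Lemma gstab_ratio_unit W s x : s \in gstab W -> x != 0 ->
  vr_set W (act s x / x) /\ ~ vmax W (act s x / x).
Proof.
move=> sW x0; split; first exact: gstab_ratio.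
move=> m; have sx0 : act s x != 0 by rewrite fmorph_eq0.
apply: (vmax_invN m); first by rewrite mulf_neq0 // invr_eq0.
rewrite invf_div -{1}[x](gactK s); apply: gstab_ratio => //.
by rewrite groupV.
Qed.

(* Multiplying x * s by a u close to 1 at W and small at the other conjugates of W,
   only the stabilizer of W contributes to the trace. *)
Lemma gact_trace_approx W x e : x != 0 -> vr_set W e ->
  exists y : k, vmax W (f y / x - \sum_(t in gstab W) act t x / x * act t e).
Proof.
move=> x0 We.
(* With this [d t], the image under t of [u * d t] is the t-th term of the trace of [x * e * u],
   divided by x. It lies in each common overring because t stabilizes that overring, which makes the
   ratio of x to its conjugate a unit there. *)
have [|||u [u1 hu]] := @approximation _ W gT (fun t => t \notin gstab W)
    (fun t => vr_pull (act t) W) (fun t => x * e / act t^-1%g x).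
- by move=> t nt /gact_pull_sub; exact/negP.
- by move=> t nt /gact_pull_sup; exact/negP.
- move=> t U _ WU WtU; rewrite mulrAC; apply: vrM; last exact: WU.
  have tU := gstab_common_overring WU WtU.
  rewrite -{1}[x](gactKV t); apply: gstab_ratio => //.
  by rewrite fmorph_eq0.
have [y Ey] := gact_trace (x * e * u); exists y.
have Wu : vr_set W u by apply: vr_cong u1 _; exact: vr1.
rewrite -Ey (bigID (mem (gstab W))) /= mulrDl addrAC.
apply: vmaxD; last first.
  rewrite mulr_suml; apply: vmax_sum => t nt; have [_] := hu t nt.
  rewrite vmax_pull !rmorphM fmorphV gactKV.
  by rewrite [X in _ -> vmax W X]mulrAC [X in _ -> vmax W X]mulrC.
rewrite mulr_suml -sumrB; apply: vmax_sum => t tW.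
have -> : act t (x * e * u) / x - act t x / x * act t e =
    (act t x / x) * (act t e * act t (u - 1)).
  rewrite rmorphB rmorph1 mulrBr mulr1 mulrBr !rmorphM; congr (_ - _).
  by rewrite -[_ * act t e * _]mulrA mulrAC.
apply: vmaxMl; first by have [] := gstab_ratio_unit tW x0.
by apply: vmaxMl; [exact/(gstabP _ _ tW)|exact/gstab_vmax].
Qed.

Definition ginert W : {set gT} :=
  [set s in gstab W | `[< forall x, vr_set W x -> vmax W (act s x - x) >]].

Lemma ginertP W s : reflect (s \in gstab W /\
  forall x, vr_set W x -> vmax W (act s x - x)) (s \in ginert W).
Proof.
by apply: (iffP setIdP) => -[h1 h2]; split=> //; exact/asboolP.
Qed.

(** Modulo W the sum is a linear combination of automorphisms of the residue field. If it vanished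
    for all e, then by Dedekind the coefficients of the t inducing the identity would add up to 0;
    these t form the inertia group, their coefficients are 1, and the total is its order. *)
Lemma gstab_sum_unit W x : x != 0 ->
  ~ vmax W (#|ginert W|%:R) ->
  (forall t, t \in ginert W -> vmax W (act t x / x - 1)) ->
  exists2 e, vr_set W e & ~ vmax W (\sum_(t in gstab W) act t x / x * act t e).
Proof.
move=> x0 nT hT; apply: contrapT => /forall2NP h; apply: nT.
pose phi (t : gT) : {rmorphism residue W -> residue W} :=
  match pselect (t \in gstab W) with
  | left tW => residue_map (gstab_extends tW)
  | right _ => idfun
  end.
have phiE t y z (Wy : vr_set W y) (Wz : vr_set W z) : t \in gstab W -> z = act t y ->
    phi t (res (vr_elem Wy)) = res (vr_elem Wz).
  rewrite /phi; case: (pselect _) => // tW _ E; exact: residue_map_res.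
pose c (t : gT) : residue W :=
  match pselect (vr_set W (act t x / x)) with
  | left h => res (vr_elem h) | _ => 0 end.
have cE t (Wc : vr_set W (act t x / x)) : c t = res (vr_elem Wc).
  rewrite /c; case: pselect => // h'; congr res; exact: val_inj.
have Wr t : t \in gstab W -> vr_set W (act t x / x) by move=> tW; case: (gstab_ratio_unit tW x0).
have : \sum_(t in gstab W | `[< phi t =1 phi 1%g >]) c t = 0.
  apply: dedekind_independence => r; have [e [We ->]] := res_lift r.
  have ms : vmax W (\sum_(t in gstab W) act t x / x * act t e).
    by case: (h e) => // /contrapT.
  have -> : \sum_(t in gstab W) c t * phi t (res (vr_elem We)) = res (vr_elem (vmax_sub ms)).
    pose F t : vr_type W := match pselect (t \in gstab W) with
      | left tW => vr_elem (vrM (Wr t tW) (proj2 (gstabP _ _ tW e) We))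
      | right _ => 0 end.
    transitivity (\sum_(t in gstab W) res (F t)).
      apply: eq_bigr => t tW; rewrite (cE t (Wr t tW)).
      rewrite (phiE t _ _ _ (proj2 (gstabP _ _ tW e) We)) // -(rmorphM (@res _ W)).
      congr res; apply: val_inj; rewrite /F; case: (pselect _) => [tW'|/(_ tW) //].
      by rewrite rmorphM.
    rewrite -(rmorph_sum (@res _ W)); congr res; apply: val_inj; rewrite rmorph_sum /=.
    apply: eq_bigr => t tW; rewrite /F; case: (pselect _) => // /(_ tW).
  apply/eqP; rewrite res_eq0; exact/vmax_nonunits.
have inertE t : (t \in gstab W) && `[< phi t =1 phi 1%g >] = (t \in ginert W).
  have w1 : 1%g \in gstab W by exact: group1.
  apply/andP/ginertP => -[tW]; last first.
    move=> e; split=> //; apply/asboolP => r; have [y [Wy ->]] := res_lift r.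
    rewrite (phiE t _ _ _ (proj2 (gstabP _ _ tW y) Wy)) //.
    by rewrite (phiE 1%g y y Wy Wy) ?gact1 //; apply/res_elemP; exact: e.
  move=> /asboolP e; split=> // y Wy; have := e (res (vr_elem Wy)).
  rewrite (phiE t _ _ _ (proj2 (gstabP _ _ tW y) Wy)) //.
  by rewrite (phiE 1%g y y Wy Wy) ?gact1 // => /res_elemP.
rewrite (eq_bigl _ _ inertE) (eq_bigr (fun=> 1)) => [|t tT]; last first.
  have [tW _] := ginertP _ _ tT.
  rewrite (cE t (Wr t tW)) -(rmorph1 (@res _ W)); apply/res_eqP.
  by rewrite rmorph1 /=; exact: hT.
rewrite sumr_const -(rmorph_nat (@res _ W)) => /eqP; rewrite res_eq0.
by move=> /vmax_nonunits; rewrite rmorph_nat.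
Qed.

(* The value group of M is that of k as soon as inertia acts trivially on x modulo 1-units. *)
Lemma gact_unramified W x : x != 0 ->
  ~ vmax W (#|ginert W|%:R) ->
  (forall t, t \in ginert W -> vmax W (act t x / x - 1)) ->
  exists2 y : k, vr_set W (f y / x) & ~ vmax W (f y / x).
Proof.
move=> x0 nT hT; have [e We ne] := gstab_sum_unit x0 nT hT.
have [y my] := gact_trace_approx x0 We; exists y.
  apply: vr_cong my _; apply: vr_sum => t tW; apply: vrM.
    by have [] := gstab_ratio_unit tW x0.
  exact/(gstabP _ _ tW).
by move=> h; apply: ne; exact: vmax_cong my h.
Qed.

(** Two approximate traces with the same e, one weighted by x and one by 1, give elements of the
    base field congruent to x s and s for one unit s, since t x / x is 1 modulo W throughout the
    decomposition group. Their quotient has the residue of x. *)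
Lemma gact_residue_fixed W x : vr_set W x -> ~ vmax W (#|ginert W|%:R) ->
  (forall t, t \in gstab W -> vmax W (act t x - x)) ->
  exists y : k, vmax W (x - f y).
Proof.
move=> Wx nT hx; have [mx|nx] := pselect (vmax W x).
  by exists 0; rewrite rmorph0 subr0.
have x0 := vunit_neq0 nx; have Wx' := vunit_inv nx.
have h t : t \in gstab W -> vmax W (act t x / x - 1).
  move=> tW; rewrite -[1](divff x0) -mulrBl.
  by apply: vmaxMr => //; exact: hx.
have [t tT|e We ne] := gstab_sum_unit x0 nT.
  by have [tW _] := ginertP _ _ tT; exact: h.
have [y my] := gact_trace_approx x0 We.
have [z mz] := gact_trace_approx (oner_neq0 M) We.
set s := \sum_(_ in _) _ in ne my.
have ms : vmax W (\sum_(t in gstab W) act t 1 / 1 * act t e - s).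
  rewrite -sumrB; apply: vmax_sum => t tW; rewrite -mulrBl.
  apply: vmaxMr; first exact/(gstabP _ _ tW).
  by rewrite rmorph1 divr1; apply: vmaxBC; exact: h.
have {}mz : vmax W (f z - s).
  by move: mz; rewrite divr1 => /vmax_trans; exact.
have Ws : vr_set W s.
  apply: vr_sum => t tW; apply: vrM.
    by have [] := gstab_ratio_unit tW x0.
  exact/(gstabP _ _ tW).
have nz : ~ vmax W (f z) by move=> hz; apply: ne; exact: vmax_cong mz hz.
have z0 := vunit_neq0 nz.
exists (y / z).
have -> : x - f (y / z) = (x / f z) * (f z - f y / x).
  rewrite mulrBr divfK // fmorph_div; congr (_ - _).
  by rewrite [RHS]mulrC mulrA divfK.
apply: vmaxMl; first by apply: vrM => //; exact: vunit_inv.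
exact: vmax_trans mz (vmaxBC my).
Qed.

(** Otherwise some u is 1 modulo W and small at all other conjugates of W and at all conjugates of
    W'. The norm of 1 - u lies in the base field, in the maximal ideal at W, yet is 1 modulo W'. *)
Lemma gact_transitive (V : valuation_ring k) W W' :
  extends f V W -> extends f V W' -> exists s, W' = vr_pull (act s) W.
Proof.
move=> VW VW'; apply: contrapT => /forallNP nW.
have ext s (U : valuation_ring M) : extends f V U -> extends f V (vr_pull (act s) U).
  move=> /extends_pull ->; apply/seteqP; split=> x /=; by rewrite gact_base.
have inc (U U' : valuation_ring M) : extends f V U -> extends f V U' ->
    vr_set U `<=` vr_set U' -> U = U'.
  by apply: extends_incomparable; exact: gact_algebraic.
pose Wf (i : gT + gT) := match i with
  | inl s => vr_pull (act s) W | inr s => vr_pull (act s) W' end.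
pose P (i : gT + gT) := if i is inl s then s \notin gstab W else true.
have VWf i : extends f V (Wf i) by case: i => s; exact: ext.
have nWf i : P i -> Wf i <> W.
  case: i => s /=; first by move=> ns E; move: ns; rewrite gact_pull_sub // E.
  move=> _ E; apply: (nW s^-1%g); apply: vr_eq => x.
  by rewrite -E /= gactKV.
have [|||u [u1 hu]] := @approximation _ W _ P Wf (fun=> 1).
- by move=> i Pi h; apply: (nWf i Pi); exact/esym/inc.
- by move=> i Pi h; apply: (nWf i Pi); exact: inc.
- by move=> *; exact: vr1.
have {}hu i : P i -> vmax (Wf i) u by move=> /hu[].
have [y Ey] := gact_norm (1 - u).
have my : vmax V y.
  apply/(extends_vmax _ VW); rewrite -Ey (bigD1 1%g) //= gact1.
  apply: vmaxMr; last exact: vmaxBC.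
  apply: vr_prod => s _; suff: vr_set (vr_pull (act s) W) (1 - u) by [].
  have [sW|sW] := boolP (s \in gstab W).
    by apply/(gstabP _ _ sW); apply: vmax_sub; exact: vmaxBC.
  by apply: vrB; [exact: vr1|exact: vmax_sub (hu (inl s) sW)].
move: my => /(extends_vmax _ VW'); rewrite -Ey => my.
apply: (@vmax1 _ W'); apply: vmax_cong my.
rewrite [X in vmax _ (_ - X)](_ : 1 = \prod_(s : gT) (1 : M)); last by rewrite big1.
have hs s : vmax W' (act s u) by have := hu (inr s) isT; rewrite vmax_pull.
have hB s : vmax W' (act s (1 - u) - 1).
  by rewrite rmorphB rmorph1 addrC addKr; exact: vmaxN.
apply: vmax_cong_prod => s _ //; last exact: vr1.
by apply: vr_cong (hB s) _; exact: vr1.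
Qed.

End GaloisAct.

(** * p-extensions inside an algebraically closed field *)

Lemma closed_field_splits (Omega : fieldType) : GRing.closed_field_axiom Omega ->
  forall q : {poly Omega}, exists rs, q = lead_coef q *: \prod_(r <- rs) ('X - r%:P).
Proof.
move=> cl q; have [n] := ubnP (size q); elim: n q => // n IH q sq.
have [sq1|sq1] := leqP (size q) 1.
  by exists [::]; rewrite big_nil (size1_polyC sq1) lead_coefC alg_polyC.
have q0 : q != 0 by rewrite -size_poly_gt0 (ltn_trans _ sq1).
have l0 : lead_coef q != 0 by rewrite lead_coef_eq0.
have n0 : (0 < (size q).-1)%N by rewrite -ltnS prednK // (ltn_trans _ sq1).
have [x Ex] := cl (size q).-1 (fun i => - (q`_i / lead_coef q)) n0.
have rx : root q x.
  rewrite /root horner_coef (polySpred q0) big_ord_recr /= -lead_coefE Ex mulr_sumr.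
  rewrite -big_split big1 //= => i _; rewrite mulNr mulrN mulrA mulrCA divff // mulr1.
  by rewrite subrr.
have /factor_theorem[h hE] := rx.
have h0 : h != 0 by apply: contraNneq q0 => h0; rewrite hE h0 mul0r.
have sh : (size h < n)%N.
  by move: sq; rewrite hE size_Mmonic ?monicXsubC // size_XsubC addn2.
have [rs Ers] := IH h sh; exists (x :: rs).
have lE : lead_coef q = lead_coef h by rewrite hE lead_coef_Mmonic ?monicXsubC.
by rewrite lE hE {1}Ers big_cons -scalerAl mulrC.
Qed.

Lemma adjoin_root_exists (F Omega : fieldType) (f : {rmorphism F -> Omega})
    (E : fieldExtType F) (j : {rmorphism E -> Omega}) (z : Omega) (q : {poly F}) :
  (forall a, j a%:A = f a) -> q != 0 -> root (map_poly f q) z ->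
  exists (E' : fieldExtType F) (j' : {rmorphism E' -> Omega}),
    [/\ forall a, j' a%:A = f a, forall x, exists y, j' y = j x & exists y, j' y = z].
Proof.
move=> jf q0 qz.
pose good n := `[< exists2 h : {poly E}, h != 0 /\ size h = n & root (map_poly j h) z >].
have ex : exists n, good n.
  exists (size (map_poly (in_alg E) q)); apply/asboolP; exists (map_poly (in_alg E) q).
    by rewrite map_poly_eq0.
  by rewrite -map_poly_comp (eq_map_poly jf).
case: (ex_minnP ex) => n /asboolP[h [h0 sh] hz] hmin.
have irr : irreducible_poly h.
  apply/(subfx_irreducibleP hz h0) => g gz g0; rewrite sh; apply: hmin; apply/asboolP.
  by exists g.
pose E1 := SubFieldExtType hz irr.
exists (baseFieldType E1), (subfx_inj : {rmorphism subFExtend j z h -> Omega}); split.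
- move=> a; rewrite -jf.
  rewrite -[a%:A](_ : (a%:A : E)%:A = _ :> E1); first exact: subfx_inj_base.
  by rewrite [RHS]baseField_scaleE.
- by move=> x; exists (x%:A : E1); exact: subfx_inj_base.
- by exists (subfx_root j z h); exact: subfx_inj_root.
Qed.

Lemma adjoin_roots_exist (F Omega : fieldType) (f : {rmorphism F -> Omega}) (q : {poly F})
    (rs : seq Omega) : q != 0 -> all (root (map_poly f q)) rs ->
  exists (E : fieldExtType F) (j : {rmorphism E -> Omega}) (zs : seq E),
    (forall a, j a%:A = f a) /\ map j zs = rs.
Proof.
move=> q0; elim: rs => [_|z rs IH /= /andP[qz /IH[E [j [zs [jf Ezs]]]]]].
  exists F^o, f, [::]; split=> // a; congr (f _); exact: mulr1.
have [E' [j' [jf' /choice[c hc] [y yz]]]] := adjoin_root_exists jf q0 qz.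
exists E', j', (y :: map c zs); split=> //=; rewrite yz -Ezs; congr (_ :: _).
by rewrite -map_comp; apply: eq_map => x /=.
Qed.

(* A subfield split by p is itself the carrier of a splitting field. *)
Lemma subfield_splitting (F : fieldType) (L : fieldExtType F) (E : {subfield L})
    (p : {poly F}) (rs : seq L) :
  map_poly (in_alg L) p %= \prod_(r <- rs) ('X - r%:P) -> <<1 & rs>>%VS = E ->
  exists (N : splittingFieldType F) (j : {rmorphism N -> L}) (zs : seq N),
    [/\ forall a, j a%:A = a%:A, map j zs = rs, <<1 & zs>>%VS = {:N}%VS,
        range j = [set x | x \in E] & \dim {:N} = \dim E].
Proof.
move=> Dp genE.
pose N0 : fieldExtType F := subvs_of E.
have rsE : {subset rs <= E} by move=> r rrs; rewrite -genE seqv_sub_adjoin.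
pose zs : seq N0 := map (vsproj E) rs.
have zsE : map vsval zs = rs.
  by rewrite -map_comp map_id_in // => r /rsE rE /=; exact: vsprojK.
pose phi : 'AHom(N0, L) := linfun_ahom (vsval : {lrmorphism N0 -> L}).
have phiE x : phi x = vsval x by rewrite lfunE.
have gen : <<1 & zs>>%VS = {:N0}%VS.
  apply/vspaceP => x; rewrite memvf; have : phi x \in <<1 & rs>>%VS.
    by rewrite phiE genE subvsP.
  rewrite -zsE -(eq_map phiE) -{1}(aimg1 phi) -aimg_adjoin_seq => /memv_imgP[y yz].
  by rewrite !phiE => /val_inj ->.
have ax : SplittingField.axiom N0.
  exists (map_poly (in_alg N0) p); first exact: alg_polyOver.
  exists zs => //; rewrite -(eqp_map (vsval : {rmorphism N0 -> L})).
  rewrite -map_poly_comp (eq_map_poly (_ : _ =1 in_alg L)); last first.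
    by move=> a /=; rewrite algid1.
  rewrite (eqp_ltrans Dp) -zsE big_map rmorph_prod /=.
  rewrite [X in _ %= X](eq_bigr (fun r => 'X - (vsval r)%:P)) ?eqpxx // => r _.
  by rewrite rmorphB /= map_polyX map_polyC.
pose N : splittingFieldType F := HB.pack (subvs_of E) (FieldExt_isSplittingField.Build F N0 ax).
exists N, (vsval : {rmorphism N0 -> L}), zs; split=> //.
- by move=> a /=; rewrite algid1.
- apply/seteqP; split=> x /=; first by move=> [y _ <-]; exact: subvsP.
  by move=> xE; exists (vsproj E x) => //; rewrite vsprojK.
- rewrite -(genE) -zsE -(eq_map phiE) -(aimg1 phi) -aimg_adjoin_seq gen.
  by rewrite limg_dim_eq // (eqP (AHom_lker0 phi)) capv0.
Qed.

Lemma splitting_field_in (F Omega : fieldType) (f : {rmorphism F -> Omega}) (q : {poly F})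
    (rs : seq Omega) : q != 0 -> map_poly f q %= \prod_(r <- rs) ('X - r%:P) ->
  exists (N : splittingFieldType F) (j : {rmorphism N -> Omega}) (zs : seq N),
    [/\ forall a, j a%:A = f a, map j zs = rs & <<1 & zs>>%VS = {:N}%VS].
Proof.
move=> q0 Dq; have [|E [j [zs [jf Ezs]]]] := @adjoin_roots_exist _ _ f q rs q0.
  by apply/allP => r rrs; rewrite (eqp_root Dq) root_prod_XsubC.
have [|N [j' [zs' [j'f Ezs' gen _ _]]]] := @subfield_splitting F E <<1 & zs>>%AS q zs _ erefl.
  rewrite -(eqp_map j) -map_poly_comp (eq_map_poly jf) (eqp_ltrans Dq) -Ezs.
  rewrite big_map rmorph_prod /= [X in _ %= X](eq_bigr (fun r => 'X - (j r)%:P)) ?eqpxx // => r _.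
  by rewrite rmorphB /= map_polyX map_polyC.
exists N, (j \o j'), zs'; split=> //; first by move=> a /=; rewrite j'f.
by rewrite map_comp Ezs'.
Qed.

Definition sepalg (F Omega : fieldType) (f : {rmorphism F -> Omega}) (x : Omega) :=
  exists2 q : {poly F}, separable_poly q & root (map_poly f q) x.

Lemma sepalg_in (F Omega : fieldType) (f : {rmorphism F -> Omega})
    (N : splittingFieldType F) (j : {rmorphism N -> Omega}) (y : N) :
  (forall a, j a%:A = f a) -> sepalg f (j y) -> separable_element 1 y.
Proof.
move=> jf [q sq qy]; apply/separable_elementP; exists (map_poly (in_alg N) q).
rewrite alg_polyOver separable_map; split=> //.
rewrite -(fmorph_root j) -map_poly_comp (eq_map_poly (_ : _ =1 f)) //.
Qed.

Lemma galois_in (F Omega : fieldType) (f : {rmorphism F -> Omega})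
    (N : splittingFieldType F) (j : {rmorphism N -> Omega}) (zs : seq N) :
  (forall a, j a%:A = f a) -> <<1 & zs>>%VS = {:N}%VS ->
  {in map j zs, forall x, sepalg f x} -> galois 1 {:N}.
Proof.
move=> jf gen sep; rewrite /galois sub1v normalFieldf andbT /= -gen.
apply/separable_Fadjoin_seq/allP => z zzs; apply: (sepalg_in jf).
by apply: sep; exact: map_f.
Qed.

Lemma galois_sepalg (F Omega : fieldType) (f : {rmorphism F -> Omega})
    (N : splittingFieldType F) (j : {rmorphism N -> Omega}) (y : N) :
  (forall a, j a%:A = f a) -> galois 1 {:N} -> sepalg f (j y).
Proof.
move=> jf /and3P[_ /separableP/(_ y (memvf y)) sy _].
have /polyOver1P[q Eq] := minPolyOver 1%AS y.
exists q; first by rewrite -(separable_map (in_alg N)) -Eq.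
rewrite -(eq_map_poly jf) map_poly_comp fmorph_root -Eq; exact: root_minPoly.
Qed.

(** The product q of the polynomials of the given elements may have multiple roots, so the induction
    records that each root of q is separable, not that q is. *)
Lemma galois_hull (F Omega : fieldType) (f : {rmorphism F -> Omega}) (xs : seq Omega) :
  GRing.closed_field_axiom Omega -> {in xs, forall x, sepalg f x} ->
  exists (N : splittingFieldType F) (j : {rmorphism N -> Omega}),
    [/\ forall a, j a%:A = f a, galois 1 {:N} & {in xs, forall x, exists y, j y = x}].
Proof.
move=> cl sep.
have [q [q0 qsep qxs]] : exists q : {poly F}, [/\ q != 0,
    forall x, root (map_poly f q) x -> sepalg f x &
    {in xs, forall x, root (map_poly f q) x}].
  elim: xs sep => [_|x xs IH sep].
    exists 1; split=> //; [exact: oner_neq0|move=> x; rewrite rmorph1 /root hornerE oner_eq0 //].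
  have [|q [q0 qsep qxs]] := IH; first by move=> y ys; apply: sep; rewrite inE ys orbT.
  have [r sr rx] := sep x (mem_head _ _).
  exists (r * q); split.
  - by rewrite mulf_neq0 // separable_poly_neq0.
  - by move=> y; rewrite rmorphM rootM => /orP[ry|/qsep //]; exists r.
  - by move=> y; rewrite inE rmorphM rootM => /predU1P[->|/qxs ->]; rewrite ?rx ?orbT.
have [rs Ers] := closed_field_splits cl (map_poly f q).
have Dq : map_poly f q %= \prod_(r <- rs) ('X - r%:P).
  by rewrite Ers eqp_scale // lead_coef_eq0 map_poly_eq0.
have [N [j [zs [jf Ezs gen]]]] := splitting_field_in q0 Dq.
exists N, j; split=> //.
  apply: (galois_in jf gen) => x; rewrite Ezs => xrs; apply: qsep.
  by rewrite (eqp_root Dq) root_prod_XsubC.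
move=> x /qxs; rewrite (eqp_root Dq) root_prod_XsubC -Ezs => /mapP[y _ ->].
by exists y.
Qed.

(* The generators of the compositum already form a field, see p_compositumE. *)
Definition p_element (p : nat) (F Omega : fieldType) (f : {rmorphism F -> Omega}) : set Omega :=
  [set x : Omega | exists (n : nat) (N : splittingFieldType F) (j : {rmorphism N -> Omega}),
      [/\ galois 1%AS {:N}, \dim {:N} = (p ^ n)%N, (forall a : F, j a%:A = f a) & range j x]].

Lemma gal_X (F : fieldType) (N : splittingFieldType F) (g : gal_of {:N}) i (y : N) :
  (g ^+ i)%g y = iter i g y.
Proof.
by elim: i => [|i IH]; rewrite ?gal_id //= expgSr galM ?memvf // IH.
Qed.

Lemma mem_gal1 (F : fieldType) (N : splittingFieldType F) (g : gal_of {:N}) :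
  g \in 'Gal({:N} / 1)%g.
Proof. by rewrite gal_kHom ?sub1v // k1AHom. Qed.

Lemma card_gal1 (F : fieldType) (N : splittingFieldType F) :
  galois 1 {:N} -> #|'Gal({:N} / 1)%g| = \dim {:N}.
Proof. by move/galois_dim; rewrite dimv1 divn1. Qed.

(* The conjugates of a generator of N being its images under the Galois group, any
   automorphism of M acts on N as an element of that group. *)
Lemma p_element_automorphism (p : nat) (F Omega : fieldType) (f : {rmorphism F -> Omega}) x :
  p_element p f x -> exists (theta : Omega) (n : nat), sepalg f theta /\
    forall (M : fieldType) (phi : {rmorphism F -> M}) (jM : {rmorphism M -> Omega}),
      (forall a, jM (phi a) = f a) -> (exists t, jM t = theta) ->
      exists2 y, jM y = x & forall sigma : {rmorphism M -> M},
        (forall a, sigma (phi a) = phi a) -> iter (p ^ n) sigma y = y.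
Proof.
move=> [n [N [j [galN dimN jf [x' _ <-]]]]].
pose theta := separable_generator 1 {:N}.
have [_ sepN _] := and3P galN.
have gen : {:N}%VS = <<1; theta>>%VS by apply: eq_adjoin_separable_generator; rewrite ?sub1v.
have polyE y : exists h : {poly F}, y = (map_poly (in_alg N) h).[theta].
  by apply/Fadjoin1_polyP; rewrite -gen memvf.
exists (j theta), n; split; first exact: galois_sepalg.
move=> M phi jM jphi [t jt].
have evalE (h : {poly F}) : jM (map_poly phi h).[t] = j (map_poly (in_alg N) h).[theta].
  by rewrite -!horner_map jt -!map_poly_comp (eq_map_poly jphi) (eq_map_poly jf).
have [hx Ex] := polyE x'; exists (map_poly phi hx).[t]; first by rewrite evalE -Ex.
move=> sigma sphi; apply: (fmorph_inj jM); rewrite evalE -Ex.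
have /polyOver1P[q Eq] := minPolyOver 1%AS theta.
have [g jg] : exists g : gal_of {:N}, jM (sigma t) = j (g theta).
  have rq : root (map_poly phi q) t.
    by rewrite /root -(fmorph_eq0 jM) evalE -Eq minPolyxx rmorph0.
  have : root (map_poly f q) (jM (sigma t)).
    rewrite -(eq_map_poly jphi) map_poly_comp fmorph_root.
    rewrite -(eq_map_poly sphi) map_poly_comp fmorph_root //.
  have [r [_ _]] := galois_factors (sub1v _) galN theta (memvf _).
  rewrite Eq => Er; rewrite -(eq_map_poly jf) map_poly_comp Er.
  rewrite rmorph_prod (eq_bigr (fun b => 'X - (j b)%:P)) => [|b _]; last first.
    by rewrite rmorphB /= map_polyX map_polyC.
  rewrite -(big_map j predT (fun b => 'X - b%:P)) root_prod_XsubC => /mapP[_ /mapP[g _ ->] ->].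
  by exists g.
have step m y : jM m = j y -> jM (sigma m) = j (g y).
  have [h ->] := polyE y; rewrite -evalE => /fmorph_inj ->.
  have -> : g (map_poly (in_alg N) h).[theta] = (map_poly (in_alg N) h).[g theta].
    by rewrite -horner_map (fixedPoly_gal (sub1v _) (mem_gal1 g)) // alg_polyOver.
  have -> : sigma (map_poly phi h).[t] = (map_poly phi h).[sigma t].
    by rewrite -horner_map -map_poly_comp (eq_map_poly sphi).
  by rewrite -!horner_map jg -!map_poly_comp (eq_map_poly jphi) (eq_map_poly jf).
have iterE i m y : jM m = j y -> jM (iter i sigma m) = j (iter i g y).
  by elim: i => // i IH /IH /step.
rewrite (iterE _ _ x'); last by rewrite evalE -Ex.
rewrite -gal_X -dimN -card_gal1 //.
by rewrite expg_cardG ?mem_gal1 // gal_id.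
Qed.

(** H is the group usually called O^p(G). An element of prime order q in the quotient lifts to some
    x whose p'-part lies in H; so it is also the image of the p-part of x, and q = p. *)
Lemma p_index_generated (gT : finGroupType) (G : {group gT}) (p : nat) :
  prime p ->
  let H := <<[set g in G | coprime p #[g]%g]>>%g in (H <| G)%g /\ p.-nat #|G : H|%g.
Proof.
move=> p_pr H.
have nHG : (H <| G)%g.
  rewrite /normal gen_subG; apply/andP; split; first by apply/fintype.subsetP => g; rewrite inE => /andP[].
  apply: (fintype.subset_trans _ (norm_gen _)); apply/fintype.subsetP => x xG.
  apply/normP; apply/finset.setP => y; rewrite mem_conjg !inE orderJ.
  by rewrite groupJr ?groupV.
split=> //; rewrite -card_quotient ?normal_norm //.
apply/pgroupP => q q_pr /(Cauchy q_pr)[y yGH oy].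
have [x xN xG Ey] := morphimP yGH.
have xp' : (x.`_p^' \in H)%g.
  apply: mem_gen; rewrite inE groupX //= order_constt.
  rewrite prime_coprime //; apply/negP => pd.
  have : (p \in \pi((#[x]%g)`_p^'))%N by rewrite mem_primes p_pr part_gt0 pd.
  rewrite pi_of_part ?order_gt0 // => /andP[_].
  by rewrite !inE eqxx.
have pey : (p.-elt y)%g.
  rewrite Ey -(consttC p x) morphM ?(fintype.subsetP (normal_norm nHG)) ?groupX //.
  rewrite [X in (_ * X)%g]coset_id // mulg1.
  by apply: morph_p_elt; rewrite ?p_elt_constt ?(fintype.subsetP (normal_norm nHG)) ?groupX.
move: pey; rewrite /p_elt oy => /pnatP -> //; exact: prime_gt0.
Qed.

(** The fixed field of the subgroup generated by the automorphisms of order prime to p is Galois of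
    p-power degree, and y lies in it. *)
Lemma p_element_fixed (p : nat) (F Omega : fieldType) (f : {rmorphism F -> Omega})
    (M : splittingFieldType F) (j : {rmorphism M -> Omega}) (y : M) :
  prime p -> (forall a, j a%:A = f a) -> galois 1 {:M} ->
  (forall g : gal_of {:M}, coprime p #[g]%g -> g y = y) -> p_element p f (j y).
Proof.
move=> p_pr jf gM fix_y; pose G := 'Gal({:M} / 1)%g.
have [nHG pH] := p_index_generated G p_pr; set H := <<_>>%g in nHG pH.
pose E := fixedField H.
have galE : galois 1 E by exact: normal_fixedField_galois.
have /splitting_galoisField[q [/polyOver1P[q0 Eq] sq [rs Dq genE]]] := galE.
have [N [jN [zs [jNf Ezs gen rangeE dimE]]]] : exists (N : splittingFieldType F)
  (j : {rmorphism N -> M}) (zs : seq N),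
    [/\ forall a, j a%:A = a%:A, map j zs = rs, <<1 & zs>>%VS = {:N}%VS,
        range j = [set x | x \in E] & \dim {:N} = \dim E].
  by apply: (@subfield_splitting _ _ _ q0); rewrite -?Eq.
have [n dimN] : exists n, \dim {:N} = (p ^ n)%N.
  have : p.-nat (\dim {:N}).
    have := dim_fixed_galois gM (normal_sub nHG).
    by rewrite dimv1 divn1 dimE => ->.
  by move=> /p_natP[n ->]; exists n.
have jf' a : (j \o jN) a%:A = f a by rewrite /= jNf.
exists n, N, (j \o jN); split=> //.
  apply: (galois_in jf' gen) => x; rewrite map_comp Ezs => /mapP[r rrs ->].
  exists q0; first by rewrite -(separable_map (in_alg M)) -Eq.
  rewrite -(eq_map_poly jf) map_poly_comp fmorph_root -Eq.
  by rewrite (eqp_root Dq) root_prod_XsubC.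
have yE : y \in E.
  have st_group : group_set [set g : gal_of {:M} | g y == y].
    apply/group_setP; split=> [|g h]; first by rewrite inE gal_id.
    by rewrite !inE galM ?memvf // => /eqP -> /eqP ->.
  have HS : H \subset Group st_group.
    rewrite gen_subG; apply/fintype.subsetP => g; rewrite !inE => /andP[_ cg].
    by apply/eqP; exact: fix_y.
  apply/fixedFieldP; rewrite ?memvf // => g gH.
  by have := fintype.subsetP HS g gH; rewrite inE => /eqP.
have : range jN y by rewrite rangeE.
by move=> [y' _ <-]; exists y'.
Qed.

Section Compositum.
Variables (p : nat) (F Omega : fieldType) (f : {rmorphism F -> Omega}).
Hypotheses (p_pr : prime p) (cl : GRing.closed_field_axiom Omega).

Lemma p_element_base a : p_element p f (f a).
Proof.
exists 0%N, F^o, f; split=> //.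
- rewrite /galois sub1v normalFieldf andbT /= (regular_fullv F); exact: separable_refl.
- by rewrite dimvf expn0.
- by move=> b; congr (f _); exact: mulr1.
Qed.

(** In a common Galois extension an automorphism of order prime to p is a power of its p^k-th power,
    so it fixes both elements and whatever is computed from them. The abstract [op] covers
    subtraction and division at once. *)
Lemma p_element_op (op : forall M : fieldType, M -> M -> M) x y :
  (forall (M M' : fieldType) (s : {rmorphism M -> M'}), {morph s : a b / op M a b >-> op M' a b}) ->
  p_element p f x -> p_element p f y -> p_element p f (op Omega x y).
Proof.
move=> opM /p_element_automorphism[t [n [st ht]]] /p_element_automorphism[u [m [su hu]]].
have [|M [j [jf gM jx]]] := @galois_hull _ _ f [:: t; u] cl.
  by move=> z; rewrite !inE => /orP[]/eqP ->.
have [a ja ha] := ht M (in_alg M) j jf (jx t (mem_head _ _)).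
have [|b jb hb] := hu M (in_alg M) j jf (jx u _); first by rewrite !inE eqxx orbT.
rewrite -ja -jb -opM; apply: p_element_fixed => // g cg.
have ord k c : iter (p ^ k) g c = c -> g c = c.
  rewrite -gal_X => gc; have iterX i : ((g ^+ (p ^ k)) ^+ i)%g c = c.
    by elim: i => [|i IH]; rewrite ?gal_id // expgSr galM ?memvf // IH.
  have cgk : coprime #|<[g]>%g| (p ^ k) by rewrite coprime_sym coprimeXl.
  by rewrite -{1}(expgK cgk (cycle_id g)) iterX.
pose sg : {rmorphism M -> M} := gal_repr g.
have sgF z : sg z%:A = z%:A by exact: rmorph_alg.
transitivity (op M (g a) (g b)); first exact: (opM M M sg).
by rewrite (ord n) ?(ord m) //; [exact: (hb sg)|exact: (ha sg)].
Qed.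

Lemma p_compositumE : p_compositum p f = p_element p f.
Proof.
have e1 : p_element p f 1 by rewrite -(rmorph1 f); exact: p_element_base.
apply/seteqP; split; last exact: sub_gen_smallest.
apply: smallest_sub => //; split.
- exact/mem_set.
- move=> x y /set_mem hx /set_mem hy; apply/mem_set.
  by apply: (@p_element_op (fun M a b => a - b)) => // M M' s a b; rewrite rmorphB.
- move=> x y /set_mem hx /set_mem hy; apply/mem_set.
  by apply: (@p_element_op (fun M a b => a / b)) => // M M' s a b; rewrite fmorph_div.
Qed.

End Compositum.

(** * Adjoining the p-th roots of unity *)

Lemma rmorphism_of (K M : fieldType) (h : K -> M) :
  zmod_morphism h -> monoid_morphism h -> exists r : {rmorphism K -> M}, r =1 h.
Proof.
move=> h1 h2.
pose r : {rmorphism K -> M} := HB.pack h (GRing.isZmodMorphism.Build K M h h1)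
  (GRing.isMonoidMorphism.Build K M h h2).
by exists r.
Qed.

Lemma rmorphism_inverse (K M : fieldType) (j : {rmorphism K -> M}) :
  (forall x, exists y, j y = x) ->
  exists j' : {rmorphism M -> K}, cancel j j' /\ cancel j' j.
Proof.
move=> /choice[h hj]; have hK x : h (j x) = x by apply: (fmorph_inj j); rewrite hj.
have [||r rE] := @rmorphism_of M K h.
- by move=> x y; apply: (fmorph_inj j); rewrite rmorphB !hj.
- split=> [|x y]; apply: (fmorph_inj j); first by rewrite rmorph1 hj.
  by rewrite rmorphM !hj.
by exists r; split=> x; rewrite rE.
Qed.

Section GalAct.
Variables (F : fieldType) (N : splittingFieldType F) (galN : galois 1 {:N}).

Definition gal_rmorph (g : gal_of {:N}) : {rmorphism N -> N} := gal_repr g.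

Lemma gal_rmorph_fix z : (forall g, gal_rmorph g z = z) -> exists a, z = in_alg N a.
Proof.
move=> h; have : z \in fixedField 'Gal({:N} / 1)%g.
  by apply/fixedFieldP; rewrite ?memvf // => g _; exact: h.
by move: (galN) => /galois_fixedField -> /vlineP[a ->]; exists a.
Qed.

Lemma gal_rmorphM s t z : gal_rmorph (s * t)%g z = gal_rmorph t (gal_rmorph s z).
Proof. exact: galM (memvf z). Qed.

Lemma gal_rmorph_base s a : gal_rmorph s (in_alg N a) = in_alg N a.
Proof. exact: rmorph_alg. Qed.

Definition gal_act : galois_act (in_alg N) := @GaloisAct F N (in_alg N) (gal_of {:N}) gal_rmorph
  (fun z => gal_id _ z) gal_rmorphM
  gal_rmorph_base gal_rmorph_fix.

End GalAct.

Lemma galois_act_transport (F M M' : fieldType) (f : {rmorphism F -> M})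
    (f' : {rmorphism F -> M'}) (j : {rmorphism M -> M'}) (G : galois_act f) :
  (forall a, j (f a) = f' a) -> (forall x, exists y, j y = x) ->
  exists (G' : galois_act f') (h : gact_grp G' -> gact_grp G), injective h /\
    forall t y, gact t (j y) = j (gact (h t) y).
Proof.
move=> jf surj; have [j' [jK j'K]] := rmorphism_inverse surj.
pose act (t : gact_grp G) : {rmorphism M' -> M'} := j \o gact t \o j'.
have a1 z : act 1%g z = z by rewrite /act /= gact1 j'K.
have aM s t z : act (s * t)%g z = act t (act s z) by rewrite /act /= gactM jK.
have ab s a : act s (f' a) = f' a by rewrite /act /= -jf jK gact_base.
have af z : (forall s, act s z = z) -> exists a, z = f' a.
  move=> h; have [|a E] := @gact_fix _ _ _ G (j' z).
    by move=> s; rewrite -[in RHS](h s) /act /= jK.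
  by exists a; rewrite -jf -E j'K.
exists (GaloisAct a1 aM ab af), id; split=> // t y.
by rewrite /= jK.
Qed.

Lemma pchar_natr_neq0 (p : nat) (K : fieldType) :
  prime p -> p \notin [pchar K] -> p%:R != 0 :> K.
Proof. by move=> p_pr; rewrite inE p_pr. Qed.

Lemma mup_splitting (p : nat) (K Omega : fieldType) (f : {rmorphism K -> Omega}) (z : Omega) :
  prime p -> p%:R != 0 :> K -> p.-primitive_root z ->
  exists (N : splittingFieldType K) (j : {rmorphism N -> Omega}) (zN : N),
    [/\ forall a, j a%:A = f a, galois 1 {:N}, j zN = z &
        forall g : gal_of {:N}, g zN = zN -> g = 1%g].
Proof.
move=> p_pr p0 zp; have pK0 : 'X^p - 1 != 0 :> {poly K}.
  by rewrite monic_neq0 // monicXnsubC // prime_gt0.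
pose rs := [seq z ^+ i | i <- index_iota 0 p].
have Dq : map_poly f ('X^p - 1) %= \prod_(r <- rs) ('X - r%:P).
  by rewrite big_map (factor_Xn_sub_1 zp) rmorphB rmorph1 /= map_polyXn eqpxx.
have [N [j [zs [jf Ezs gen]]]] := splitting_field_in pK0 Dq.
have sep : separable_poly ('X^p - 1 : {poly K}) by exact: separable_Xn_sub_1.
have galN : galois 1 {:N}.
  apply: (galois_in jf gen) => x; rewrite Ezs => xrs; exists ('X^p - 1) => //.
  by rewrite (eqp_root Dq) root_prod_XsubC.
have : z \in map j zs.
  rewrite Ezs; apply/mapP; exists 1%N; last by rewrite expr1.
  by rewrite mem_index_iota prime_gt1.
move=> /mapP[zN zNzs Ez]; exists N, j, zN; split=> // g gz.
have hz : {subset zs <= fixedField [set g]%SET}.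
  move=> y yzs; apply/fixedFieldP; rewrite ?memvf // => _ /set1P ->.
  have : j y \in rs by rewrite -Ezs map_f.
  move=> /mapP[i _]; rewrite Ez -rmorphXn => /fmorph_inj ->.
  by rewrite -[LHS]/(gal_rmorph g _) rmorphXn; congr (_ ^+ _); exact: gz.
have : (<<1 & zs>> <= fixedField [set g]%SET)%VS.
  by apply/Fadjoin_seqP; split=> //; exact: sub1v.
rewrite gen => /subvP h; apply/eqP/gal_eqP => y _; rewrite gal_id.
have /mem_fixedFieldP[_ ->] := h y (memvf y) => //; exact/set1P.
Qed.

(** Stands for J = K(z) in terms of the group: an element of G is determined by its effect on z. *)
Definition faithful_at (K J : fieldType) (f : {rmorphism K -> J}) (G : galois_act f) (z : J) :=
  forall t : gact_grp G, gact t z = z -> t = 1%g.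

Lemma generated_subfield_ind (K : fieldType) (A S : set K) :
  subfield_set S -> A `<=` S -> generated_subfield A `<=` S.
Proof. by move=> sS AS; exact: smallest_sub. Qed.

Lemma range_subfield (K M : fieldType) (j : {rmorphism K -> M}) : subfield_set (range j).
Proof.
split=> [|_ _ /set_mem[x _ <-] /set_mem[y _ <-]|_ _ /set_mem[x _ <-] /set_mem[y _ <-]];
  apply/mem_set.
- by exists 1; rewrite ?rmorph1.
- by exists (x - y); rewrite ?rmorphB.
- by exists (x / y); rewrite ?fmorph_div.
Qed.

Lemma mup_extension_act (p : nat) (K J : fieldType) (f : {rmorphism K -> J}) :
  prime p -> p%:R != 0 :> K -> is_mup_extension p f ->
  exists (G : galois_act f) (z : J), p.-primitive_root z /\ faithful_at G z.
Proof.
move=> p_pr p0 [[z _ zp] gen].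
have [N [j [zN [jf galN jz fz]]]] := mup_splitting f p_pr p0 zp.
have surj x : exists y, j y = x.
  have : generated_subfield (range f `|` [set z : J | z ^+ p = 1]) x by rewrite gen.
  suff h : range f `|` [set z : J | z ^+ p = 1] `<=` range j.
    by move=> /(generated_subfield_ind (range_subfield j) h)[y _ <-]; exists y.
  move=> y [[a _ <-]|/= yp]; first by exists a%:A.
  by have [i ->] := prim_rootP zp yp; exists (zN ^+ i); rewrite // rmorphXn jz.
have [G [h [hinj hj]]] := galois_act_transport (gal_act galN) jf surj.
exists G, z; split=> // t tz; apply: hinj.
suff e : forall t, gact t z = z -> h t = 1%g by rewrite (e _ tz) e // gact1.
move=> {tz}t; rewrite -jz hj => /fmorph_inj; exact: fz.
Qed.

Lemma mup_extension_in (p : nat) (K Omega : fieldType) (f : {rmorphism K -> Omega}) (z : Omega) :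
  prime p -> p%:R != 0 :> K -> p.-primitive_root z ->
  exists (E : fieldType) (phi : {rmorphism K -> E}) (j : {rmorphism E -> Omega})
    (G : galois_act phi) (zE : E),
    [/\ forall a, j (phi a) = f a, j zE = z & faithful_at G zE].
Proof.
move=> p_pr p0 zp; have [N [j [zN [jf galN jz fz]]]] := mup_splitting f p_pr p0 zp.
by exists N, (in_alg N), j, (gal_act galN), zN.
Qed.

(** Says that z^s is conjugate to z over K. The formulation by polynomials over K allows comparison
    between different ambient fields and different choices of z. *)
Definition conj_root (K M : fieldType) (f : {rmorphism K -> M}) (z : M) (s : nat) : Prop :=
  forall h : {poly K}, root (map_poly f h) z -> root (map_poly f h) (z ^+ s).

Lemma root_comp_Xn (K M : fieldType) (f : {rmorphism K -> M}) (h : {poly K}) (z : M) (s : nat) :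
  root (map_poly f (h \Po 'X^s)) z = root (map_poly f h) (z ^+ s).
Proof.
by rewrite /root map_comp_poly /= map_polyXn horner_comp hornerXn.
Qed.

(* Both z and a suitable power of z' are roots of the same irreducible factor of X^p - 1. *)
Lemma conj_root_indep (p : nat) (K M M' : fieldType) (f : {rmorphism K -> M})
    (f' : {rmorphism K -> M'}) (z : M) (z' : M') (s : nat) :
  prime p -> p.-primitive_root z -> p.-primitive_root z' ->
  conj_root f z s -> conj_root f' z' s.
Proof.
move=> p_pr zp zp' hz.
pose good n := `[< exists2 h : {poly K}, h != 0 /\ size h = n & root (map_poly f h) z >].
have Xz : root (map_poly f ('X^p - 1)) z.
  by rewrite /root rmorphB rmorph1 /= map_polyXn !hornerE (prim_expr_order zp) subrr.
have pK0 : 'X^p - 1 != 0 :> {poly K} by rewrite monic_neq0 // monicXnsubC // prime_gt0.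
have ex : exists n, good n.
  by exists (size ('X^p - 1 : {poly K})); apply/asboolP; exists ('X^p - 1).
case: (ex_minnP ex) => n /asboolP[m [m0 sm] mz] hmin.
have mmin h : h != 0 -> root (map_poly f h) z -> (size m <= size h)%N.
  by move=> h0 hz'; rewrite sm; apply: hmin; apply/asboolP; exists h.
have irr : irreducible_poly m.
  by apply/(subfx_irreducibleP mz m0) => h hz' h0; exact: mmin.
have mdvd h : root (map_poly f h) z -> m %| h.
  move=> hz'; apply/modp_eq0P/eqP; apply: contraT => r0.
  have := mmin _ r0; rewrite leqNgt ltn_modp m0; apply.
  move/rootP: hz'; rewrite {1}(divp_eq h m) rmorphD rmorphM hornerD hornerM /=.
  by move/rootP: mz => ->; rewrite mulr0 add0r => /rootP.
have [t wt] : exists t, root (map_poly f' m) (z' ^+ t).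
  have : map_poly f' m %| \prod_(i <- index_iota 0 p) ('X - (z' ^+ i)%:P).
    rewrite (factor_Xn_sub_1 zp') -(map_polyXn f') -(rmorph1 (map_poly f')) -rmorphB.
    by rewrite dvdp_map; exact: mdvd.
  move=> /dvdp_prod_XsubC[msk Dm].
  have : size (map_poly f' m) != 1 by rewrite size_map_poly; have [] := irr; case: ltngtP.
  rewrite (eqp_size Dm) size_prod_XsubC.
  case E : (mask _ _) => [|i r] // _; exists i.
  by rewrite (eqp_root Dm) E big_cons rootM root_XsubC eqxx.
set w := z' ^+ t in wt.
have wE h : root (map_poly f h) z -> root (map_poly f' h) w.
  move=> /mdvd /dvdpP[g ->]; by rewrite rmorphM rootM wt orbT.
have wE' h : root (map_poly f' h) w -> root (map_poly f h) z.
  move=> hw; have d1 : size (gcdp m h) != 1.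
    rewrite -(size_map_poly f') neq_ltn orbC.
    rewrite (@root_size_gt1 _ w) ?map_poly_eq0 ?gcdp_eq0 ?(negbTE m0) //.
    by rewrite gcdp_map root_gcd wt.
  have [_ /(_ _ d1 (dvdp_gcdl _ _)) dm] := irr.
  have : m %| h by rewrite -(eqp_dvdl _ dm) dvdp_gcdr.
  by move=> /dvdpP[g ->]; rewrite rmorphM rootM mz orbT.
have w1 : w != 1.
  apply/eqP => w1; have : root (map_poly f' ('X - 1)) w.
    by rewrite /root rmorphB rmorph1 /= map_polyX !hornerE w1 subrr.
  move=> /wE'; rewrite /root rmorphB rmorph1 /= map_polyX !hornerE subr_eq0 => /eqP z1.
  by have /prime_primitive_root[//|_] := zp.
have wp : p.-primitive_root w.
  apply/prime_primitive_root => //; split; last exact/eqP.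
  by rewrite -exprM mulnC exprM (prim_expr_order zp') expr1n.
(* The statement passes from w to z' = w^r by composing the polynomial with X^r. *)
have [r zr] := prim_rootP wp (prim_expr_order zp').
move=> h; rewrite zr -root_comp_Xn => /wE'/hz; rewrite -root_comp_Xn => /wE.
by rewrite root_comp_Xn root_comp_Xn -!exprM [(s * r)%N]mulnC.
Qed.

(** Fermat: an automorphism and its p^n-th power act alike on p-th roots of unity. *)
Lemma prim_root_exp_pX (p n s : nat) (M : fieldType) (z : M) :
  prime p -> z ^+ p = 1 -> z ^+ (s ^ (p ^ n)) = z ^+ s.
Proof.
move=> p_pr zp; have e a b : a = b %[mod p] -> z ^+ a = z ^+ b.
  by move=> E; rewrite (divn_eq a p) (divn_eq b p) E !exprD ![(_ * p)%N]mulnC !exprM zp !expr1n.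
apply: e; elim: n => [|n IH]; first by rewrite expn0 expn1.
by rewrite expnSr expnM fermat_little.
Qed.

(* An automorphism over F realizing z -> z^s becomes trivial on finitely many given
   p-elements after raising it to a power of p, which does not change its effect on z. *)
Lemma conj_root_p_compositum (p : nat) (F K Omega : fieldType) (f : {rmorphism F -> K})
    (g : {rmorphism K -> Omega}) (z : Omega) (s : nat) :
  prime p -> p%:R != 0 :> F -> GRing.closed_field_axiom Omega ->
  range g = p_compositum p (g \o f) -> p.-primitive_root z ->
  conj_root (g \o f) z s -> conj_root g z s.
Proof.
move=> p_pr p0 cl rg zp hz h hzr.
have hp i : p_element p (g \o f) (g h`_i).
  by rewrite -p_compositumE // -rg; exists h`_i.
have /choice[th /choice[n hth]] := fun i => p_element_automorphism (hp i).
have sz : sepalg (g \o f) z.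
  exists ('X^p - 1); first exact: separable_Xn_sub_1.
  by rewrite /root rmorphB rmorph1 /= map_polyXn !hornerE (prim_expr_order zp) subrr.
have [|M [j [jf gM jx]]] := @galois_hull _ _ (g \o f) (z :: [seq th i | i <- index_iota 0 (size h)]) cl.
  move=> x; rewrite inE => /predU1P[->//|/mapP[i _ ->]]; by have [] := hth i.
have [zM jz] := jx z (mem_head _ _).
have /choice[y hy] : forall i, exists y, (i < size h)%N -> j y = g h`_i /\
    forall sigma : {rmorphism M -> M},
      (forall a, sigma a%:A = a%:A) -> iter (p ^ n i) sigma y = y.
  move=> i; have [ilt|ige] := boolP (i < size h)%N; last by exists 0.
  have [|y0 jy0 hy0] := (hth i).2 M (in_alg M) j jf.
    by apply: jx; rewrite inE map_f ?orbT // mem_index_iota.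
  by exists y0.
have /polyOver1P[q Eq] := minPolyOver 1%AS zM.
have [sg _ Esg] : exists2 sg : gal_of {:M}, sg \in 'Gal({:M} / 1)%g & sg zM = zM ^+ s.
  have [_ _ nM] := and3P gM.
  apply: (normalField_root_minPoly (sub1v _) nM (memvf _)).
  rewrite Eq -(fmorph_root j) -map_poly_comp (eq_map_poly jf) rmorphXn /= jz; apply: hz.
  by rewrite -jz -(eq_map_poly jf) map_poly_comp fmorph_root -Eq root_minPoly.
pose N := (\sum_(i < size h) n i)%N.
pose sigma : {rmorphism M -> M} := gal_rmorph (sg ^+ (p ^ N))%g.
pose sg' := gal_rmorph sg.
have Esg' : sg' zM = zM ^+ s by [].
have sigmaE x : sigma x = iter (p ^ N) sg' x by exact: gal_X.
have sz' : sigma zM = zM ^+ s.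
  rewrite sigmaE; have -> k : iter k sg' zM = zM ^+ (s ^ k).
    elim: k => [|k IH]; first by rewrite expr1.
    by rewrite iterS IH rmorphXn Esg' -exprM expnS.
  apply: prim_root_exp_pX => //; apply: (fmorph_inj j).
  by rewrite rmorphXn jz rmorph1 (prim_expr_order zp).
have sy i : (i < size h)%N -> sigma (y i) = y i.
  move=> ilt; have [_ /(_ sg') hi] := hy i ilt.
  have {}hi : iter (p ^ n i) sg' (y i) = y i by apply: hi => a; exact: rmorph_alg.
  rewrite sigmaE /N (bigD1 (Ordinal ilt)) //= expnD mulnC.
  elim: (p ^ _)%N => // k IH; by rewrite mulSn iterD IH hi.
have hzM : \sum_(i < size h) y i * zM ^+ i = 0.
  apply: (fmorph_inj j); rewrite rmorph0 rmorph_sum.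
  transitivity (map_poly g h).[z]; last exact/rootP.
  rewrite horner_coef size_map_poly; apply: eq_bigr => i _.
  by rewrite rmorphM rmorphXn jz coef_map; have [-> _] := hy i (ltn_ord i).
apply/rootP; rewrite horner_coef size_map_poly.
transitivity (j (sigma (\sum_(i < size h) y i * zM ^+ i))); last by rewrite hzM !rmorph0.
rewrite !rmorph_sum; apply: eq_bigr => i _; rewrite !rmorphM !rmorphXn sz' sy // coef_map.
by rewrite rmorphXn jz; have [-> _] := hy i (ltn_ord i).
Qed.

Lemma sum_unity_root (M : fieldType) (p : nat) (w : M) :
  w ^+ p = 1 -> w != 1 -> \sum_(i < p) w ^+ i = 0.
Proof.
move=> wp w1; apply/eqP; have /eqP := subrX1 w p; rewrite wp subrr eq_sym mulf_eq0.
by rewrite subr_eq0 (negbTE w1).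
Qed.

Lemma modn_Fp (p : nat) : prime p -> forall i j : nat,
  (i = j %[mod p]) <-> (i%:R = j%:R :> 'F_p).
Proof.
move=> p_pr i j; split=> [h|/(congr1 val)]; last by rewrite /= !val_Fp_nat.
by apply: val_inj; rewrite /= !val_Fp_nat.
Qed.

Section MupAct.
Variables (p : nat) (K E : fieldType) (f : {rmorphism K -> E}) (G : galois_act f) (z : E).
Hypotheses (p_pr : prime p) (p0 : p%:R != 0 :> E) (zp : p.-primitive_root z).
Hypothesis fz : faithful_at G z.
Local Notation gT := (gact_grp G).

Lemma mup_root_neq0 : z != 0.
Proof.
apply/eqP => z0; have := prim_expr_order zp; rewrite z0 expr0n.
by rewrite eqn0Ngt prime_gt0 //= => /eqP; rewrite eq_sym oner_eq0.
Qed.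

(* The double sum collapses to the term t = 1 by orthogonality. *)
Lemma mup_coord x : exists c : 'I_p -> K, x = \sum_(i < p) f (c i) * z ^+ i /\
  forall i, f (c i) = p%:R^-1 * \sum_(t : gT) gact t (x / z ^+ i).
Proof.
have z0 := mup_root_neq0.
have /choice[a ha] : forall i : 'I_p, exists a, \sum_(t : gT) gact t (x / z ^+ i) = f a.
  by move=> i; exact: gact_trace.
exists (fun i => p%:R^-1 * a i); split=> [|i]; last first.
  by rewrite rmorphM fmorphV rmorph_nat -ha.
apply: (mulfI p0); rewrite mulr_sumr.
under eq_bigr do rewrite rmorphM fmorphV rmorph_nat -mulrA mulVKf // -ha mulr_suml.
rewrite exchange_big /= (bigD1 1%g) //= [X in _ + X]big1 => [|t t1].
  rewrite addr0 (eq_bigr (fun=> x)) => [|i _]; first by rewrite sumr_const card_ord mulr_natl.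
  by rewrite gact1 divfK // expf_neq0.
under eq_bigr do rewrite rmorphM fmorphV rmorphXn -mulrA -exprVn -exprMn.
rewrite -mulr_sumr sum_unity_root ?mulr0 //.
  by rewrite exprMn exprVn -rmorphXn (prim_expr_order zp) rmorph1 invr1 mulr1.
apply: contra_neq t1 => h; apply: fz.
have tz0 : gact t z != 0 by rewrite fmorph_eq0.
by rewrite -[LHS]mulr1 -h mulVKf.
Qed.

(** [s] is the cyclotomic character and [n] its inverse modulo p, as natural numbers fit to be
    exponents. *)
Lemma mup_exponents : exists s n : gT -> nat,
  [/\ forall t, gact t z = z ^+ s t, forall t, (n t)%:R = (s t)%:R^-1 :> 'F_p,
      forall t, (s t)%:R != 0 :> 'F_p & forall t u, (s (t * u)%g)%:R = (s t)%:R * (s u)%:R :> 'F_p].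
Proof.
have /choice[s hs] : forall t : gT, exists s, gact t z = z ^+ s.
  move=> t; have [|i ->] := @prim_rootP _ p z zp (gact t z); last by exists i.
  by rewrite -rmorphXn (prim_expr_order zp) rmorph1.
exists s, (fun t => val ((s t)%:R^-1 : 'F_p)).
have sM t u : (s (t * u)%g)%:R = (s t)%:R * (s u)%:R :> 'F_p.
  rewrite -natrM; apply/modn_Fp => //; apply/eqP.
  by rewrite -(eq_prim_root_expr zp) -hs gactM hs rmorphXn hs -exprM mulnC.
have s1 : (s 1%g)%:R = 1 :> 'F_p.
  apply/(modn_Fp p_pr _ 1); apply/eqP.
  by rewrite -(eq_prim_root_expr zp) -hs gact1 expr1.
split=> // t; first by rewrite natr_Zp.
apply/eqP => st; have := sM t t^-1%g; rewrite mulgV s1 st mul0r => /eqP.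
by rewrite oner_eq0.
Qed.

Lemma mup_conj_root s : conj_root f z s -> exists t : gT, gact t z = z ^+ s.
Proof.
have [h hE] := gact_charpoly G z.
move=> /(_ h); rewrite hE -!(big_map (fun t => gact t z) predT (fun y => 'X - y%:P)).
rewrite !root_prod_XsubC => /(_ _)/mapP[|t _ ->]; last by exists t.
by apply/mapP; exists 1%g; rewrite ?gact1 // mem_index_enum.
Qed.

Lemma mup_root_conj (t : gT) s : gact t z = z ^+ s -> conj_root f z s.
Proof.
move=> ts h /rootP hz; apply/rootP; rewrite -ts.
have -> : map_poly f h = map_poly (gact t) (map_poly f h).
  by rewrite -map_poly_comp; apply: eq_map_poly => a /=; rewrite gact_base.
by rewrite horner_map hz rmorph0.
Qed.

End MupAct.

(** If r is separable and r(0) is nonzero, then r(X^p) is prime to its derivative p X^(p-1) r'(X^p).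
    A factor X of the polynomial of y^p is removed beforehand, y being nonzero. *)
Lemma sepalg_pth_root (p : nat) (F Omega : fieldType) (f : {rmorphism F -> Omega}) (y : Omega) :
  p%:R != 0 :> F -> y != 0 -> sepalg f (y ^+ p) -> sepalg f y.
Proof.
move=> p0 y0 [q sq qy].
have pgt0 : (0 < p)%N by rewrite lt0n; apply: contraNneq p0 => ->.
have [r [sr ry r0]] : exists r, [/\ separable_poly r, root (map_poly f r) (y ^+ p) & ~~ root r 0].
  have [q0|q0] := boolP (root q 0); last by exists q.
  have /factor_theorem[r Er] := q0; exists r.
  have := sq; rewrite Er separable_mul subr0 => /and3P[sr _ cr].
  split=> //; last by rewrite -coprimepX.
  move: qy; rewrite Er rmorphM rootM rmorphB /= map_polyX map_polyC /= rmorph0 subr0.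
  by rewrite rootX (negbTE (expf_neq0 p y0)) orbF.
exists (r \Po 'X^p); last by rewrite root_comp_Xn.
move: sr; rewrite !separable_poly.unlock deriv_comp derivXn => sr.
rewrite coprimepMr coprimep_comp_poly //= -scaler_nat coprimepZr //.
rewrite coprimep_expr // coprimepX /root horner_comp hornerXn expr0n.
by rewrite eqn0Ngt pgt0.
Qed.

(* With gamma_t a p-th root of t b, put A_u = prod_t gamma_t^(n (t u^-1)), so that
   A_1^p = prod_t (t b)^(n t), and beta_k = sum_u z^(k s u) A_u.  An automorphism sigma
   over F of order prime to p fixes p-extensions of F, acts on b as some element t_e,
   and hence shifts the index of beta_k; as its order is prime to p it fixes beta_k, so
   beta_k lies in K, and A_1 is a combination of the beta_k. *)
Lemma kummer_pth_power (p : nat) (F K Omega E : fieldType) (f : {rmorphism F -> K})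
    (g : {rmorphism K -> Omega}) (phi : {rmorphism K -> E}) (j : {rmorphism E -> Omega})
    (G : galois_act phi) (z b : E) (s n : gact_grp G -> nat) :
  prime p -> p%:R != 0 :> F -> GRing.closed_field_axiom Omega ->
  range g = p_compositum p (g \o f) -> (forall a, j (phi a) = g a) ->
  p.-primitive_root z -> faithful_at G z ->
  (forall t, gact t z = z ^+ s t) -> (forall t, (n t)%:R = (s t)%:R^-1 :> 'F_p) ->
  b != 0 -> exists c, \prod_t gact t b ^+ n t = c ^+ p.
Proof.
move=> p_pr p0 cl rg jphi zp fz hs hn b0.
have pgt0 := prime_gt0 p_pr.
have pE0 : p%:R != 0 :> E by rewrite -(rmorph_nat phi) -(rmorph_nat f) !fmorph_eq0.
have zjp : p.-primitive_root (j z).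
  by apply/(prime_primitive_root p_pr); have /(prime_primitive_root p_pr)[z1 z2] := zp;
    rewrite -rmorphXn z1 rmorph1; split=> // h; apply: z2; apply: (fmorph_inj j); rewrite rmorph1.
have sM t u : (s (t * u)%g)%:R = (s t)%:R * (s u)%:R :> 'F_p.
  rewrite -natrM; apply/modn_Fp => //; apply/eqP.
  by rewrite -(eq_prim_root_expr zp) -hs gactM hs rmorphXn hs -exprM mulnC.
have s1 : (s 1%g)%:R = 1 :> 'F_p.
  apply/(modn_Fp p_pr _ 1); apply/eqP.
  by rewrite -(eq_prim_root_expr zp) -hs gact1 expr1.
have s0 t : (s t)%:R != 0 :> 'F_p.
  by apply/eqP => st; have /eqP := sM t t^-1%g; rewrite mulgV s1 st mul0r oner_eq0.
have nV t u : (n (t * u^-1)%g)%:R = (n t)%:R * (s u)%:R :> 'F_p.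
  have E1 : (s t)%:R = (s (t * u^-1)%g)%:R * (s u)%:R :> 'F_p by rewrite -sM mulgKV.
  by rewrite !hn E1 invfM mulfVK.
have [c [Eb _]] := mup_coord p_pr pE0 zp fz b.
have /choice[gam hgam] : forall t : gact_grp G, exists x, x ^+ p = j (gact t b).
  move=> t; have [x Ex] := cl p (fun i => if i is 0%N then j (gact t b) else 0) pgt0.
  exists x; rewrite Ex -(prednK pgt0) big_ord_recl /= mulr1 big1 ?addr0 // => i _.
  by rewrite mul0r.
have pc i : p_element p (g \o f) (g (c i)).
  by rewrite -p_compositumE // -rg; exists (c i).
have /choice[th /choice[m hth]] := fun i => p_element_automorphism (pc i).
have sz : sepalg (g \o f) (j z).
  exists ('X^p - 1); first exact: separable_Xn_sub_1.
  by rewrite /root rmorphB rmorph1 /= map_polyXn !hornerE (prim_expr_order zjp) subrr.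
have Ejb (t : gact_grp G) : j (gact t b) = \sum_(i < p) g (c i) * j z ^+ (s t * i)%N.
  rewrite Eb !rmorph_sum; apply: eq_bigr => i _.
  by rewrite !rmorphM gact_base jphi !rmorphXn hs -!rmorphXn -exprM !rmorphXn.
have gam0 t : gam t != 0.
  apply/eqP => h; have := hgam t; rewrite h expr0n eqn0Ngt pgt0 /= => /esym/eqP.
  by rewrite !fmorph_eq0 (negbTE b0).
have sgam t : sepalg (g \o f) (gam t).
  apply: (sepalg_pth_root p0 (gam0 t)); rewrite hgam.
  have [|M [jM [jf gM jx]]] := @galois_hull _ _ (g \o f) (j z :: [seq th i | i <- enum 'I_p]) cl.
    by move=> x; rewrite inE => /predU1P[->//|/mapP[i _ ->]]; have [] := hth i.
  have [zM jz] := jx (j z) (mem_head _ _).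
  have /choice[y hy] : forall i, exists y, jM y = g (c i).
    move=> i; have [|y jy _] := (hth i).2 M (in_alg M) jM jf.
      by apply: jx; rewrite inE map_f ?orbT // mem_enum.
    by exists y.
  rewrite (_ : j (gact t b) = jM (\sum_(i < p) y i * zM ^+ (s t * i)%N)).
    exact: galois_sepalg.
  rewrite Ejb rmorph_sum; apply: eq_bigr => i _.
  by rewrite rmorphM rmorphXn hy jz.
pose T := gact_grp G.
have [|M [jM [jf gM jx]]] := @galois_hull _ _ (g \o f)
    (j z :: [seq th i | i <- enum 'I_p] ++ [seq gam t | t <- enum T]) cl.
  move=> x; rewrite inE mem_cat => /predU1P[->//|/orP[]/mapP[i _ ->] //].
  by have [] := hth i.
have [zM jz] := jx (j z) (mem_head _ _).
have zMp : p.-primitive_root zM.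
  have /(prime_primitive_root p_pr)[z1 z2] := zjp; apply/(prime_primitive_root p_pr); split.
    by apply: (fmorph_inj jM); rewrite rmorphXn jz rmorph1.
  by move=> h; apply: z2; rewrite -jz h rmorph1.
have /choice[y hy] : forall i, exists y, jM y = g (c i) /\
    forall sigma : {rmorphism M -> M},
      (forall a, sigma a%:A = a%:A) -> iter (p ^ m i) sigma y = y.
  move=> i; have [|y jy hy] := (hth i).2 M (in_alg M) jM jf.
    by apply: jx; rewrite inE mem_cat map_f ?orbT // mem_enum.
  by exists y.
have /choice[Gam hGam] : forall t, exists y, jM y = gam t.
  by move=> t; apply: jx; rewrite inE mem_cat (map_f gam) ?orbT // mem_enum.
pose B t := \sum_(i < p) y i * zM ^+ (s t * i)%N.
have jB t : jM (B t) = j (gact t b).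
  rewrite Ejb rmorph_sum; apply: eq_bigr => i _.
  by rewrite rmorphM rmorphXn jz; have [-> _] := hy i.
have GamB t : Gam t ^+ p = B t.
  by apply: (fmorph_inj jM); rewrite rmorphXn hGam hgam jB.
have B0 t : B t != 0 by rewrite -(fmorph_eq0 jM) jB !fmorph_eq0.
have Gam0 t : Gam t != 0 by rewrite -(fmorph_eq0 jM) hGam.
pose A u := \prod_(t : T) Gam t ^+ n (t * u^-1)%g.
pose beta k := \sum_(u : T) zM ^+ (k * s u)%N * A u.
have zMmod a a' : a%:R = a'%:R :> 'F_p -> zM ^+ a = zM ^+ a'.
  by move=> /(modn_Fp p_pr)/eqP; rewrite -(eq_prim_root_expr zMp) => /eqP.
have beta_mod a a' : a%:R = a'%:R :> 'F_p -> beta a = beta a'.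
  move=> h; apply: eq_bigr => u _; congr (_ * _); apply: zMmod.
  by rewrite !natrM h.
have pM0 : p%:R != 0 :> M by rewrite -(rmorph_nat (in_alg M)) fmorph_eq0.
have jzE a : jM (zM ^+ a) = j (z ^+ a) by rewrite !rmorphXn jz.
have zM0 : zM != 0 by rewrite -(fmorph_eq0 jM) jz fmorph_eq0; exact: (mup_root_neq0 p_pr zp).
(* The coefficient of [A u] is the sum of the k-th powers of z^(s u - 1), which vanishes unless z^(s
   u) = z, that is u = 1 by faithfulness. *)
have betaE : \sum_(k < p) zM^-1 ^+ k * beta k = p%:R * A 1%g.
  under eq_bigr do rewrite mulr_sumr.
  rewrite exchange_big (bigD1 1%g) //= [X in _ + X]big1 => [|u u1].
    rewrite addr0 (eq_bigr (fun=> A 1%g)) => [|k _]; first by rewrite sumr_const card_ord mulr_natl.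
    rewrite mulrA [(k * _)%N]mulnC exprM -exprMn (zMmod _ 1%N) // expr1 mulVf //.
    by rewrite expr1n mul1r.
  under eq_bigr do rewrite mulrA [(_ * s u)%N]mulnC exprM -exprMn.
  rewrite -mulr_suml sum_unity_root ?mul0r //.
    rewrite exprMn exprVn (prim_expr_order zMp) invr1 mul1r -exprM mulnC exprM.
    by rewrite (prim_expr_order zMp) expr1n.
  apply: contra_neq u1 => h; apply: fz; rewrite hs.
  apply: (fmorph_inj j); rewrite -jzE -[zM ^+ _](mulVKf zM0) h mulr1.
  by rewrite -[zM]expr1 jzE expr1.
have A10 : A 1%g != 0 by apply/prodf_neq0 => t _; rewrite expf_neq0.
have fixed (sg : gal_of {:M}) k : coprime p #[sg]%g -> sg (beta k) = beta k.
  move=> csg; pose sigma := gal_rmorph sg; rewrite -[LHS]/(sigma _).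
  have sF (a : F) : sigma a%:A = a%:A by exact: rmorph_alg.
  have [e Ee] : exists e, sigma zM = zM ^+ e.
    have [|i ->] := prim_rootP zMp (_ : sigma zM ^+ p = 1); last by exists i.
    by rewrite -rmorphXn (prim_expr_order zMp) rmorph1.
  have sy i : sigma (y i) = y i.
    have [_ /(_ sigma sF)] := hy i; rewrite -gal_X => h.
    have cgk : coprime #|<[sg]>%g| (p ^ m i) by rewrite coprime_sym coprimeXl.
    transitivity (((sg ^+ (p ^ m i)) ^+ expg_invn <[sg]> (p ^ m i))%g (y i)).
      by rewrite expgK ?cycle_id.
    by rewrite gal_X; elim: (expg_invn _ _) => // l IH; rewrite iterS IH.
  have [te Ete] : exists te : T, gact te z = z ^+ e.
    apply: mup_conj_root; rewrite /conj_root => h hzr.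
    have cF : conj_root (g \o f) (j z) e.
      move=> q /rootP hq; apply/rootP; rewrite -jz -rmorphXn -Ee.
      have E1 x : (map_poly (g \o f) q).[jM x] = jM (map_poly (in_alg M) q).[x].
        by rewrite -horner_map -map_poly_comp (eq_map_poly jf).
      have E2 : (map_poly (in_alg M) q).[sigma zM] = sigma (map_poly (in_alg M) q).[zM].
        by rewrite -horner_map -map_poly_comp (eq_map_poly sF).
      apply/eqP; rewrite E1 E2 !fmorph_eq0 -(fmorph_eq0 jM) -E1 jz; exact/eqP.
    have := conj_root_p_compositum p_pr p0 cl rg zjp cF.
    move=> /(_ h); rewrite -rmorphXn -!(eq_map_poly jphi) !map_poly_comp !fmorph_root.
    by apply.
  have seF u : (s (u * te)%g)%:R = (s u)%:R * e%:R :> 'F_p.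
    rewrite sM; congr (_ * _); apply/(modn_Fp p_pr); apply/eqP.
    by rewrite -(eq_prim_root_expr zp) -hs Ete.
  have sB t : sigma (B t) = B (t * te)%g.
    rewrite rmorph_sum; apply: eq_bigr => i _; rewrite rmorphM sy rmorphXn Ee -exprM.
    by congr (_ * _); apply: zMmod; rewrite !natrM seF mulrCA mulrA.
  have /choice[r hr] : forall t, exists r, sigma (Gam t) = zM ^+ r * Gam (t * te)%g.
    move=> t; have [|i Ei] := prim_rootP zMp (_ : (sigma (Gam t) / Gam (t * te)%g) ^+ p = 1).
      by rewrite expr_div_n -rmorphXn !GamB sB divff.
    by exists i; rewrite -Ei divfK.
  pose R := (\sum_t r t * n t)%N.
  have sA u : sigma (A u) = zM ^+ (s u * R) * A (u * te)%g.
    rewrite rmorph_prod.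
    under eq_bigr do rewrite rmorphXn hr exprMn -exprM.
    rewrite big_split /= prodrXr; congr (_ * _).
      apply: zMmod; rewrite natrM !natr_sum mulr_sumr; apply: eq_bigr => t _.
      by rewrite !natrM nV mulrA mulrC.
    rewrite [RHS](reindex_inj (mulIg te)) /=; apply: eq_bigr => t _.
    by rewrite invMg mulgA mulgK.
  have e0 : e%:R != 0 :> 'F_p.
    by apply/eqP => e0; have /eqP := s0 (1 * te)%g; rewrite seF e0 mulr0.
  (* Under sigma the exponent l s(u) becomes l s(u) e + s(u) R, and this is (l + R / e) s(u te),
     because s(u te) = s(u) e modulo p. *)
  pose d := (val (e%:R^-1 : 'F_p) * R)%N.
  have dF : d%:R = e%:R^-1 * R%:R :> 'F_p by rewrite natrM natr_Zp.
  have sbeta l : sigma (beta l) = beta (l + d)%N.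
    rewrite rmorph_sum [RHS](reindex_inj (mulIg te)) /=; apply: eq_bigr => u _.
    rewrite rmorphM rmorphXn Ee sA mulrA -exprM -exprD; congr (_ * _).
    apply: zMmod; rewrite natrD !natrM natrD dF seF mulrDl.
    congr (_ + _); first by rewrite mulrC -mulrA.
    by rewrite [(s u)%:R * e%:R]mulrC mulrACA mulVf // mul1r mulrC.
  have siter i l : iter i sigma (beta l) = beta (l + i * d)%N.
    by elim: i => [|i IH]; rewrite ?mul0n ?addn0 // iterS IH sbeta -addnA mulSn [(d + _)%N]addnC.
  have [d0|d0] := eqVneq (d%:R : 'F_p) 0.
    by rewrite sbeta; apply: beta_mod; rewrite natrD d0 addr0.
  (* A nonzero shift d is impossible: with the order of sg it would generate all shifts modulo p, so
     all [beta l] would be equal, and [betaE] would give [A 1%g] = 0. *)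
  have per l : beta (l + #[sg]%g * d)%N = beta l.
    by rewrite -siter -gal_X expg_order gal_id.
  have o0 : (#[sg]%g * d)%:R != 0 :> 'F_p.
    rewrite natrM mulf_neq0 //; apply/eqP => o0.
    have /eqP : (#[sg]%g = 0 %[mod p])%N by apply/modn_Fp.
    by rewrite mod0n -/(dvdn _ _) => pd; move: csg; rewrite prime_coprime // pd.
  have const l : beta l = beta 0%N.
    have per' i : beta (i * (#[sg]%g * d))%N = beta 0%N.
      by elim: i => [|i IH] //; rewrite mulSn addnC per.
    rewrite -(per' (val ((l%:R : 'F_p) / (#[sg]%g * d)%:R))).
    by apply: beta_mod; rewrite natrM natr_Zp divfK.
  move: A10; suff /eqP -> : A 1%g == 0 by rewrite eqxx.
  rewrite -(mulrI_eq0 _ (mulfI pM0)) -betaE.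
  under eq_bigr do rewrite const.
  rewrite -mulr_suml sum_unity_root ?mul0r //.
    by rewrite exprVn (prim_expr_order zMp) invr1.
  rewrite invr_eq1; apply/eqP => h; have /(prime_primitive_root p_pr)[_ //] := zMp.
have /choice[ka hka] : forall k, exists a, jM (beta k) = j (phi a).
  move=> k; have : range g (jM (beta k)).
    rewrite rg p_compositumE //; apply: p_element_fixed => // sg; exact: fixed.
  by move=> [a _ <-]; exists a.
exists (p%:R^-1 * \sum_(k < p) z^-1 ^+ k * phi (ka k)).
apply: (fmorph_inj j); rewrite rmorphXn.
have -> : j (p%:R^-1 * \sum_(k < p) z^-1 ^+ k * phi (ka k)) = jM (A 1%g).
  apply: (mulfI (_ : p%:R != 0)); first by rewrite -(rmorph_nat j) fmorph_eq0.
  rewrite rmorphM fmorphV rmorph_nat mulVKf; last by rewrite -(rmorph_nat j) fmorph_eq0.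
  rewrite -[p%:R * _](_ : jM (p%:R * A 1%g) = _); last by rewrite rmorphM rmorph_nat.
  rewrite -betaE !rmorph_sum; apply: eq_bigr => k _.
  by rewrite !rmorphM !rmorphXn !fmorphV jz hka.
rewrite -rmorphXn rmorph_prod -prodrXl rmorph_prod; apply: eq_bigr => t _.
by rewrite invg1 mulg1 -exprM mulnC exprM GamB !rmorphXn jB.
Qed.

(** * Valuations and roots of unity *)

Section ResidueAction.
Variables (k M : fieldType) (f : {rmorphism k -> M}) (G : galois_act f).
Variables (V : valuation_ring k) (W : valuation_ring M) (VW : extends f V W).
Hypothesis nT : ~ vmax W (#|ginert G W|%:R).

Definition residue_gact (t : subg_of (gstab_group G W)) : {rmorphism residue W -> residue W} :=
  residue_map (gstab_extends (subgP t)).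

Lemma residue_gactE t x (Wx : vr_set W x) (Wtx : vr_set W (gact (sgval t) x)) :
  residue_gact t (res (vr_elem Wx)) = res (vr_elem Wtx).
Proof. exact: residue_map_res. Qed.

Lemma gstab_vr (t : subg_of (gstab_group G W)) x : vr_set W x -> vr_set W (gact (sgval t) x).
Proof. by have /gstabP h := subgP t; move/h. Qed.

Lemma residue_gact1 r : residue_gact 1%g r = r.
Proof.
have [x [Wx ->]] := res_lift r; have W1 : vr_set W (gact (sgval (1%g : subg_of (gstab_group G W))) x).
  exact: gstab_vr.
by rewrite (residue_gactE _ W1); apply/res_elemP; rewrite morph1 gact1 subrr; exact: vmax0.
Qed.

Lemma residue_gactM s t r : residue_gact (s * t)%g r = residue_gact t (residue_gact s r).
Proof.
have [x [Wx ->]] := res_lift r.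
rewrite (residue_gactE _ (gstab_vr _ Wx)) (residue_gactE _ (gstab_vr s Wx)).
rewrite (residue_gactE _ (gstab_vr _ (gstab_vr _ Wx))); apply/res_elemP.
by rewrite morphM ?inE // gactM subrr; exact: vmax0.
Qed.

Lemma residue_map_elem x (Vx : vr_set V x) (Wx : vr_set W (f x)) :
  residue_map VW (res (vr_elem Vx)) = res (vr_elem Wx).
Proof. exact: residue_map_res. Qed.

Lemma residue_gact_base t a : residue_gact t (residue_map VW a) = residue_map VW a.
Proof.
have [x [Vx ->]] := res_lift a; rewrite (residue_map_elem _ ((extendsE VW x).2 Vx)).
rewrite (residue_gactE _ (gstab_vr _ ((extendsE VW x).2 Vx))); apply/res_elemP.
by rewrite gact_base subrr; exact: vmax0.
Qed.

Lemma residue_gact_fix r : (forall t, residue_gact t r = r) ->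
  exists a, r = residue_map VW a.
Proof.
have [x [Wx ->]] := res_lift r => h.
have [|y my] := gact_residue_fixed Wx nT.
  move=> t tW; have := h (subg _ t); rewrite (residue_gactE _ (gstab_vr _ Wx)) => /res_elemP.
  by rewrite subgK.
have Wfy : vr_set W (f y) by apply: vr_cong (vmaxBC my) Wx.
exists (res (vr_elem ((extendsE VW y).1 Wfy))).
by rewrite (residue_map_elem _ Wfy); apply/res_elemP.
Qed.

(** The decomposition group serves as Galois group of the residue fields; that nothing more is fixed
    is [gact_residue_fixed], which needs the order of inertia to be a unit. A nontrivial inertia
    group acts trivially here. *)
Definition residue_act : galois_act (residue_map VW) :=
  @GaloisAct _ _ (residue_map VW) (subg_of (gstab_group G W)) residue_gact
    residue_gact1 residue_gactM residue_gact_base residue_gact_fix.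

End ResidueAction.

Lemma residue_natr (K : fieldType) (W : valuation_ring K) n :
  (n%:R == 0 :> residue W) <-> vmax W n%:R.
Proof.
rewrite -(rmorph_nat (@res _ W)) res_eq0 vmax_nonunits rmorph_nat; by split.
Qed.

Section MupValuation.
Variables (p : nat) (K E : fieldType) (f : {rmorphism K -> E}) (G : galois_act f) (z : E).
Variables (V : valuation_ring K) (W : valuation_ring E) (VW : extends f V W).
Hypotheses (p_pr : prime p) (nVp : ~ vmax V p%:R) (zp : p.-primitive_root z).
Hypothesis fz : faithful_at G z.

Let nWp : ~ vmax W p%:R.
Proof. by rewrite -(rmorph_nat f) (extends_vmax _ VW). Qed.

Lemma mup_vr : vr_set W z.
Proof.
apply: (@vr_of_exp _ _ _ p); first exact: prime_gt0.
by rewrite (prim_expr_order zp); exact: vr1.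
Qed.

(** For w different from 1 the sum 1 + w + ... + w^(p-1) is 0, but it is congruent to the unit p. *)
Lemma unity_root_vmax (w : E) : w ^+ p = 1 -> vmax W (w - 1) -> w = 1.
Proof.
move=> wp m; apply/eqP; apply: contraT => w1; exfalso; apply: nWp.
have Ww : vr_set W w by apply: vr_cong m _; exact: vr1.
apply: vmax_cong (vmax0 W); rewrite -(sum_unity_root wp w1).
rewrite -[X in vmax _ (_ - X%:R)]card_ord -sumr_const -sumrB; apply: vmax_sum => i _.
by rewrite -[X in _ - X](expr1n _ i); apply: vmax_congX => //; exact: vr1.
Qed.

Lemma mup_vmax_inj i j : vmax W (z ^+ i - z ^+ j) -> z ^+ i = z ^+ j.
Proof.
have z0 := mup_root_neq0 p_pr zp.
move=> m; have nz : ~ vmax W (z ^+ j).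
  move=> /vmaxX h; have /h : vr_set W z by exact: mup_vr.
  move=> mz; apply: (@vmax1 _ W); rewrite -(prim_expr_order zp) -(prednK (prime_gt0 p_pr)).
  by rewrite exprS; apply: vmaxMr => //; apply: vrX; exact: mup_vr.
apply: (mulIf (_ : (z ^+ j)^-1 != 0)); first by rewrite invr_eq0 expf_neq0.
rewrite divff ?expf_neq0 //; apply: unity_root_vmax.
  by rewrite exprMn exprVn -!exprM ![(_ * p)%N]mulnC !exprM (prim_expr_order zp) !expr1n invr1 mulr1.
rewrite -[X in _ - X](divff (expf_neq0 j z0)) -mulrBl; apply: vmaxMr => //.
exact: vunit_inv.
Qed.

(** Inertia fixes the residue of z, and p-th roots of unity stay distinct modulo W, so it fixes
    z. *)
Lemma mup_ginert : ginert G W = [set 1%g]%SET.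
Proof.
apply/finset.setP => t; apply/ginertP/finset.set1P => [[tW h]|->].
  apply: fz; have [s [n [hs _ _ _]]] := mup_exponents G p_pr zp; rewrite hs.
  rewrite -[RHS]expr1; apply: mup_vmax_inj; rewrite -hs expr1.
  by apply: h; exact: mup_vr.
by split=> [|x _]; [exact: group1|rewrite gact1 subrr; exact: vmax0].
Qed.

Lemma mup_nT : ~ vmax W (#|ginert G W|%:R).
Proof. by rewrite mup_ginert cards1; exact: vmax1. Qed.

Lemma mup_value_surj x : x != 0 ->
  exists2 y : K, vr_set W (f y / x) & ~ vmax W (f y / x).
Proof.
move=> x0; apply: gact_unramified => //; first exact: mup_nT.
move=> t; rewrite mup_ginert inE => /eqP ->.
by rewrite gact1 divff // subrr; exact: vmax0.
Qed.

Definition mup_res : residue W := res (vr_elem mup_vr).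

Lemma mup_resX i j : mup_res ^+ i = mup_res ^+ j -> z ^+ i = z ^+ j.
Proof.
rewrite /mup_res -!(rmorphXn (@res _ W)) => /res_eqP; rewrite !rmorphXn /=.
exact: mup_vmax_inj.
Qed.

Lemma mup_res_prim : p.-primitive_root mup_res.
Proof.
apply/(prime_primitive_root p_pr); split.
  rewrite /mup_res -(rmorphXn (@res _ W)) -(rmorph1 (@res _ W)).
  apply/res_eqP; rewrite rmorphXn rmorph1 /= (prim_expr_order zp) subrr; exact: vmax0.
rewrite -[LHS]expr1 -(expr0 mup_res) => /mup_resX; rewrite expr1 expr0 => z1.
by have /(prime_primitive_root p_pr)[_ ] := zp.
Qed.

Lemma mup_residue_faithful : faithful_at (residue_act VW mup_nT) mup_res.
Proof.
move=> t; have [s [n [hs _ _ _]]] := mup_exponents G p_pr zp.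
rewrite /= /mup_res (residue_gactE _ (gstab_vr _ mup_vr)) => /res_elemP.
rewrite hs -[X in _ - X]expr1 => /mup_vmax_inj; rewrite -hs expr1 => /fz h.
by apply: val_inj; rewrite /= h.
Qed.

(** [mup_coord], applied to the decomposition group acting on the residue field, writes every
    residue in powers of the root of unity. *)
Lemma mup_residue_extension : is_mup_extension p (residue_map VW).
Proof.
split; first by exists mup_res; [|exact: mup_res_prim].
apply/seteqP; split=> // r _.
have pr0 : p%:R != 0 :> residue W by apply/negP => /residue_natr.
have [c [-> _]] := mup_coord p_pr pr0 mup_res_prim mup_residue_faithful r.
move=> S [[S1 SB SV] hS].
have S0 : S 0 by have := SB 1 1 S1 S1; rewrite subrr => /set_mem.
have SD x y : S x -> S y -> S (x + y).
  move=> Sx Sy; have hN : S (- y) by rewrite -sub0r; apply/set_mem/SB; exact/mem_set.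
  by rewrite -[y]opprK; apply/set_mem/SB; exact/mem_set.
have SM x y : S x -> S y -> S (x * y).
  move=> Sx Sy; have hV : S y^-1 by rewrite -[_^-1]mul1r; apply/set_mem/SV => //; exact/mem_set.
  by rewrite -[y]invrK; apply/set_mem/SV; exact/mem_set.
elim/big_ind: _ => // i _; apply: (SM); first by apply: hS; left; exists (c i).
have Sz : S mup_res by apply: hS; right; exact: prim_expr_order mup_res_prim.
by elim: (i : nat) => [|l IH]; [exact/set_mem|rewrite exprS; exact: SM].
Qed.

(* An element u of every conjugate of W has coordinates in V. Choosing u = 1 mod W
   and u = 0 mod the other conjugates separates W from them over the residue field. *)
Lemma mup_stab_conj (t : gact_grp G) s : gact t z = z ^+ s ->
  t \in gstab G W <-> conj_root (residue_map VW) mup_res s.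
Proof.
move=> ts; split=> [tW|hc].
  apply: (@mup_root_conj _ _ _ (residue_act VW mup_nT) _ (subg _ t)).
  rewrite /= /mup_res (residue_gactE _ (gstab_vr _ mup_vr)) -(rmorphXn (@res _ W)).
  by apply/res_eqP; rewrite rmorphXn /= subgK // ts subrr; exact: vmax0.
apply: contrapT => /negP tW.
have [|||u [u1 hu]] := @approximation _ W (gact_grp G) (fun t => t \notin gstab G W)
    (fun t => vr_pull (gact t) W) (fun=> 1).
- by move=> i ni /gact_pull_sub; exact/negP.
- by move=> i ni /gact_pull_sup; exact/negP.
- by move=> *; exact: vr1.
have Wu : vr_set W u by apply: vr_cong u1 _; exact: vr1.
have Wtu (i : gact_grp G) : vr_set W (gact i u).
  have [/gstabP h|/hu[h _]] := boolP (i \in gstab G W); first exact/h.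
  by move: h; rewrite vmax_pull => /vmax_sub.
have pE0 : p%:R != 0 :> E by exact: vunit_neq0 nWp.
have [c [Ec hc']] := mup_coord p_pr pE0 zp fz u.
have Vc i : vr_set V (c i).
  apply/(extendsE VW); rewrite hc'; apply: vrM; first exact: vunit_inv.
  apply: vr_sum => j _; rewrite fmorph_div; apply: vrM => //.
  have [s' [n [hs _ _ _]]] := mup_exponents G p_pr zp.
  rewrite -fmorphV -exprVn.
  have -> : z^-1 = z ^+ p.-1.
    by apply: (mulfI (mup_root_neq0 p_pr zp)); rewrite -exprS prednK ?prime_gt0 //
      (prim_expr_order zp) mulfV // (mup_root_neq0 p_pr zp).
  by rewrite !rmorphXn hs; do 3!apply: vrX; exact: mup_vr.
(* At the residue of z this polynomial takes the residue of u - 1, which is 0, and at that of z^s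
   the residue of t u - 1, which is -1. *)
pose h : {poly residue V} := \poly_(i < p) (if insub i is Some j then res (vr_elem (Vc j)) else 0) - 1.
have hE (e : nat) : (map_poly (residue_map VW) h).[mup_res ^+ e] =
    \sum_(i < p) residue_map VW (res (vr_elem (Vc i))) * mup_res ^+ (e * i)%N - 1.
  rewrite rmorphB rmorph1 /= hornerD hornerN hornerC; congr (_ - _).
  rewrite (@horner_coef_wide _ p); last by rewrite size_map_poly; exact: size_poly.
  apply: eq_bigr => i _; rewrite coef_map coef_poly ltn_ord valK -exprM //.
have sumE (e : nat) : \sum_(i < p) residue_map VW (res (vr_elem (Vc i))) * mup_res ^+ (e * i)%N =
   res (\sum_(i < p) vr_elem ((extendsE VW _).2 (Vc i)) * vr_elem mup_vr ^+ (e * i)%N).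
  rewrite (rmorph_sum (@res _ W)); apply: eq_bigr => i _.
  rewrite (rmorphM (@res _ W)) (rmorphXn (@res _ W)); congr (_ * _); exact: residue_map_elem.
have hz : root (map_poly (residue_map VW) h) mup_res.
  apply/eqP; rewrite -[mup_res]expr1 hE sumE; apply/eqP; rewrite subr_eq0.
  rewrite -(rmorph1 (@res _ W)); apply/eqP/res_eqP.
  rewrite rmorph_sum rmorph1 (_ : \sum_(i < p) _ = u) // Ec; apply: eq_bigr => i _.
  by rewrite rmorphM rmorphXn /= mul1n.
have := hc h hz => /rootP; rewrite hE sumE => /eqP; rewrite subr_eq0.
rewrite -(rmorph1 (@res _ W)) => /eqP/res_eqP; rewrite rmorph_sum rmorph1 => m1.
have mt : vmax W (gact t u) by have [] := hu t tW; rewrite vmax_pull.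
apply: (@vmax1 _ W); apply: vmax_cong mt; apply: vmax_trans m1.
rewrite {1}Ec rmorph_sum -sumrB; apply: vmax_sum => i _.
by rewrite rmorphM rmorphXn gact_base ts rmorphM rmorphXn /= -exprM subrr; exact: vmax0.
Qed.

End MupValuation.

Lemma ranges_card_eq (T X Y : Type) (a : T -> X) (b : T -> Y) :
  (forall t t', a t = a t' <-> b t = b t') -> range a #= range b.
Proof.
move=> ab; have [t0|nT] := pselect (exists t : T, True); last first.
  have -> : range a = set0 by apply/seteqP; split=> // x [t _ _]; case: nT; exists t.
  have -> : range b = set0 by apply/seteqP; split=> // x [t _ _]; case: nT; exists t.
  by rewrite card_eq0.
have /choice[c hc] : forall x, exists t, range a x -> a t = x.
  move=> x; have [[t _ <-]|nx] := pselect (range a x); first by exists t.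
  by case: t0 => t _; exists t.
have -> : range b = (b \o c) @` range a.
  apply/seteqP; split=> [_ [t _ <-]|_ [x ax <-]]; last by exists (c x).
  by exists (a t); [exists t|apply/ab; rewrite hc //; exists t].
apply: card_esym; apply: inj_card_eq => x y /set_mem ax /set_mem ay /ab.
by rewrite !hc.
Qed.

Lemma gact_pull_eq (k M : fieldType) (f : {rmorphism k -> M}) (G : galois_act f)
    (W : valuation_ring M) (t u : gact_grp G) :
  vr_pull (gact t) W = vr_pull (gact u) W <-> (t^-1 * u)%g \in gstab G W.
Proof.
split=> [E|/gstabP h]; last first.
  by apply: vr_eq => x /=; rewrite -(h (gact t x)) -gactM mulKVg.
apply/gstabP => x; rewrite gactM -[vr_set W (gact u _)]/(vr_set (vr_pull (gact u) W) _).
by rewrite -E /= gactKV.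
Qed.

Lemma gact_extensions (k M : fieldType) (f : {rmorphism k -> M}) (G : galois_act f)
    (V : valuation_ring k) (W : valuation_ring M) : extends f V W ->
  [set W' | extends f V W'] = range (fun t : gact_grp G => vr_pull (gact t) W).
Proof.
move=> VW; apply/seteqP; split=> [W' /= VW'|_ [t _ <-]].
  by have [t ->] := gact_transitive G VW VW'; exists t.
by rewrite /extends (extends_pull VW); apply/seteqP; split=> x /=; rewrite gact_base.
Qed.

(* Both sets of extensions are the quotient of the group of exponents s realized by
   automorphisms z -> z^s by the subgroup of those realized over the residue field. *)
Lemma mup_extensions_card_eq (p : nat) (K1 E1 K2 E2 : fieldType)
    (f1 : {rmorphism K1 -> E1}) (f2 : {rmorphism K2 -> E2})
    (G1 : galois_act f1) (G2 : galois_act f2) (z1 : E1) (z2 : E2)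
    (V1 : valuation_ring K1) (V2 : valuation_ring K2)
    (W1 : valuation_ring E1) (W2 : valuation_ring E2)
    (VW1 : extends f1 V1 W1) (VW2 : extends f2 V2 W2)
    (p_pr : prime p) (zp1 : p.-primitive_root z1) (zp2 : p.-primitive_root z2) :
  ~ vmax V1 p%:R -> ~ vmax V2 p%:R -> faithful_at G1 z1 -> faithful_at G2 z2 ->
  (forall s, conj_root f1 z1 s <-> conj_root f2 z2 s) ->
  (forall s, conj_root (residue_map VW1) (mup_res W1 p_pr zp1) s <->
             conj_root (residue_map VW2) (mup_res W2 p_pr zp2) s) ->
  [set W | extends f1 V1 W] #= [set W | extends f2 V2 W].
Proof.
move=> nV1 nV2 fz1 fz2 hS hD.
have [s1 [_ [hs1 _ s1n0 s1M]]] := mup_exponents G1 p_pr zp1.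
have [s2 [_ [hs2 _ s2n0 s2M]]] := mup_exponents G2 p_pr zp2.
have expF (E : fieldType) (z : E) a b : p.-primitive_root z ->
    z ^+ a = z ^+ b -> a%:R = b%:R :> 'F_p.
  by move=> zp /eqP; rewrite (eq_prim_root_expr zp) => /eqP/(modn_Fp p_pr).
have Fexp (E : fieldType) (z : E) a b : p.-primitive_root z ->
    a%:R = b%:R :> 'F_p -> z ^+ a = z ^+ b.
  by move=> zp /(modn_Fp p_pr)/eqP; rewrite -(eq_prim_root_expr zp) => /eqP.
have /choice[h hh] : forall t, exists u, (s2 u)%:R = (s1 t)%:R :> 'F_p.
  move=> t; have /hS/(mup_conj_root G2)[u hu] := mup_root_conj (hs1 t).
  by exists u; apply: (expF _ _ _ _ zp2); rewrite -hu -hs2.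
have hsurj u : exists t, h t = u.
  have /hS/(mup_conj_root G1)[t ht] := mup_root_conj (hs2 u).
  exists t; suff : ((h t) * u^-1)%g = 1%g by move/eqP; rewrite -eq_mulgV1 => /eqP.
  apply: fz2; rewrite hs2 -[RHS]expr1; apply: (Fexp _ _ _ _ zp2).
  have Etu : (s1 t)%:R = (s2 u)%:R :> 'F_p by apply: (expF _ _ _ _ zp1); rewrite -hs1.
  rewrite s2M hh Etu -s2M mulgV; apply: (expF _ _ _ _ zp2).
  by rewrite -hs2 gact1 expr1.
rewrite (gact_extensions G1 VW1) (gact_extensions G2 VW2).
have -> : range (fun t : gact_grp G2 => vr_pull (gact t) W2) =
    range (fun t : gact_grp G1 => vr_pull (gact (h t)) W2).
  apply/seteqP; split=> _ [t _ <-]; last by exists (h t).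
  by have [u <-] := hsurj t; exists u.
apply: ranges_card_eq => t u; rewrite !gact_pull_eq.
rewrite (mup_stab_conj VW1 p_pr nV1 zp1 fz1 (hs1 _)) hD.
suff -> : conj_root (residue_map VW2) (mup_res W2 p_pr zp2) (s1 (t^-1 * u)%g) <->
    conj_root (residue_map VW2) (mup_res W2 p_pr zp2) (s2 ((h t)^-1 * h u)%g).
  by rewrite -(mup_stab_conj VW2 p_pr nV2 zp2 fz2 (hs2 _)).
have E : (s1 (t^-1 * u)%g)%:R = (s2 ((h t)^-1 * h u)%g)%:R :> 'F_p.
  apply: (mulfI (s1n0 t)); rewrite -s1M mulKVg -hh -[in RHS]hh.
  by rewrite -s2M mulKVg.
rewrite /conj_root.
have -> : mup_res W2 p_pr zp2 ^+ s1 (t^-1 * u)%g = mup_res W2 p_pr zp2 ^+ s2 ((h t)^-1 * h u)%g.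
  exact: (Fexp _ _ _ _ (mup_res_prim VW2 p_pr nV2 zp2)).
by [].
Qed.

Lemma p_group_order (gT : finGroupType) (p : nat) : prime p ->
  (forall g : gT, exists n, (g ^+ (p ^ n))%g = 1%g) -> p.-nat #|gT|.
Proof.
move=> p_pr h; rewrite -cardsT; apply/(@pgroupP _ _ [group of [set: gT]%SET]) => q q_pr /(Cauchy q_pr)[g _ og].
have [n gn] := h g; have : (q %| p ^ n)%N by rewrite -og order_dvdn gn.
by rewrite Euclid_dvdX // => /andP[]; rewrite dvdn_prime2.
Qed.

(* The Galois group of the splitting field of the orbit of x is a p-group, as the
   conjugates of a primitive element are images under G. *)
Lemma galois_act_p_element (p : nat) (k M : fieldType) (f : {rmorphism k -> M})
    (G : galois_act f) : prime p ->
  (forall t : gact_grp G, exists n, (t ^+ (p ^ n))%g = 1%g) -> forall x, p_element p f x.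
Proof.
move=> p_pr pG x.
(* Repetitions are removed to make the polynomial separable; in [gact_charpoly] each conjugate is
   repeated when x has a nontrivial stabilizer. *)
pose rs := undup [seq gact t x | t : gact_grp G].
have rsP y : (y \in rs) = (y \in [seq gact t x | t : gact_grp G]) by rewrite mem_undup.
have [q Eq] : exists q, map_poly f q = \prod_(r <- rs) ('X - r%:P).
  set h := \prod_(r <- rs) _.
  have /choice[c hc] : forall i, exists a, h`_i = f a.
    move=> i; apply: (gact_fix (g := G)) => t; rewrite -coef_map.
    suff -> : map_poly (gact t) h = h by [].
    rewrite rmorph_prod (eq_bigr (fun r => 'X - (gact t r)%:P)) => [|r _]; last first.
      by rewrite rmorphB /= map_polyX map_polyC.
    rewrite -(big_map (gact t) predT (fun r => 'X - r%:P)); apply: perm_big.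
    apply: uniq_perm; rewrite ?map_inj_uniq ?undup_uniq //; first exact: fmorph_inj.
    have [|||_ //] := @uniq_min_size _ (map (gact t) rs) rs.
    - by rewrite map_inj_uniq ?undup_uniq //; exact: fmorph_inj.
    - move=> w /mapP[y]; rewrite rsP => /mapP[u _ ->] ->; rewrite rsP -gactM.
      by apply/mapP; exists (u * t)%g; rewrite ?mem_enum.
    - by rewrite size_map.
  exists (\poly_(i < size h) c i); apply/polyP => i; rewrite coef_map coef_poly.
  by case: ltnP => [_|hi]; [rewrite hc|rewrite raddf0 nth_default].
have sq : separable_poly q by rewrite -(separable_map f) Eq separable_prod_XsubC undup_uniq.
have Dq : map_poly f q %= \prod_(r <- rs) ('X - r%:P) by rewrite Eq eqpxx.
have [N [j [zs [jf Ezs gen]]]] := splitting_field_in (separable_poly_neq0 sq) Dq.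
have galN : galois 1 {:N}.
  apply: (galois_in jf gen) => y; rewrite Ezs => yrs; exists q => //.
  by rewrite Eq root_prod_XsubC.
pose theta := separable_generator 1 {:N}.
have [_ sepN _] := and3P galN.
have genth : {:N}%VS = <<1; theta>>%VS by apply: eq_adjoin_separable_generator; rewrite ?sub1v.
have polyE y : exists h : {poly k}, y = (map_poly (in_alg N) h).[theta].
  by apply/Fadjoin1_polyP; rewrite -genth memvf.
have evalE (h : {poly k}) y : j (map_poly (in_alg N) h).[y] = (map_poly f h).[j y].
  by rewrite -horner_map -map_poly_comp (eq_map_poly jf).
have orb (g : gal_of {:N}) : exists t : gact_grp G, forall y, j (gal_rmorph g y) = gact t (j y).
  have [h hE] := gact_charpoly G (j theta).
  have sF a : gal_rmorph g (in_alg N a) = in_alg N a by exact: gal_rmorph_base.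
  have : root (map_poly f h) (j (gal_rmorph g theta)).
    rewrite /root -evalE fmorph_eq0 -(eq_map_poly sF) map_poly_comp horner_map fmorph_eq0.
    rewrite -(fmorph_eq0 j) evalE -/(root _ _) hE /root horner_prod (bigD1 1%g) //= gact1.
    by rewrite !hornerE subrr mul0r.
  rewrite hE -(big_map (fun t => gact t (j theta)) predT (fun r => 'X - r%:P)) root_prod_XsubC.
  move=> /mapP[t _ ht]; exists t => y; have [u ->] := polyE y.
  rewrite -horner_map -map_poly_comp (eq_map_poly sF) !evalE ht -horner_map.
  by rewrite -map_poly_comp; congr (_.[_]); apply: eq_map_poly => a /=; rewrite gact_base.
have pN : p.-nat #|{: gal_of {:N}}|.
  apply: p_group_order => // g; have [t ht] := orb g; have [n tn] := pG t; exists n.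
  apply/eqP/gal_eqP => y _; rewrite gal_id gal_X; apply: (fmorph_inj j).
  have -> i : j (iter i g y) = iter i (gact t) (j y).
    by elim: i => // i IH; rewrite !iterS -IH -ht.
  by rewrite -gactX tn gact1.
have /p_natP[n En] : p.-nat (\dim {:N}).
  rewrite -card_gal1 //; apply: pnat_dvd pN; rewrite -cardsT.
  by apply: cardSg; exact: finset.subsetT.
exists n, N, j; split=> //.
have : x \in map j zs by rewrite Ezs rsP; apply/mapP; exists 1%g; rewrite ?gact1 ?mem_enum.
by move=> /mapP[y _ ->]; exists y.
Qed.

(** * Valuations and p-extensions *)

Lemma p_element_comp (p : nat) (F M M' : fieldType) (f : {rmorphism F -> M})
    (g : {rmorphism M -> M'}) (f' : {rmorphism F -> M'}) (x : M) :
  (forall a, g (f a) = f' a) -> p_element p f x -> p_element p f' (g x).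
Proof.
move=> gf [n [N [j [galN dimN jf [y _ <-]]]]].
exists n, N, (g \o j); split=> //; first by move=> a; rewrite /= jf.
Qed.

Lemma residue_map_comp (K L M : fieldType) (f : {rmorphism K -> L}) (g : {rmorphism L -> M})
    (h : {rmorphism K -> M}) (V : valuation_ring K) (W : valuation_ring L)
    (Y : valuation_ring M) (VW : extends f V W) (WY : extends g W Y) (VY : extends h V Y) :
  (forall a, g (f a) = h a) -> forall r, residue_map WY (residue_map VW r) = residue_map VY r.
Proof.
move=> gf r; have [x [Vx ->]] := res_lift r.
rewrite (residue_map_elem VW _ ((extendsE VW x).2 Vx)).
rewrite (residue_map_elem WY _ ((extendsE WY _).2 ((extendsE VW x).2 Vx))).
rewrite (residue_map_elem VY _ ((extendsE VY x).2 Vx)).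
by apply/res_elemP; rewrite gf subrr; exact: vmax0.
Qed.

Lemma vr_nat (K : fieldType) (W : valuation_ring K) n : vr_set W n%:R.
Proof. by elim: n => [|n IH]; [exact: vr0|rewrite -natr1; apply: vrD; [|exact: vr1]]. Qed.

Section PValuation.
Variables (p : nat) (k M : fieldType) (f : {rmorphism k -> M}) (G : galois_act f).
Variables (V : valuation_ring k) (W : valuation_ring M) (VW : extends f V W).
Hypotheses (p_pr : prime p) (nVp : ~ vmax V p%:R).
Hypothesis pG : forall t : gact_grp G, exists n, (t ^+ (p ^ n))%g = 1%g.

Let nWp : ~ vmax W p%:R.
Proof. by rewrite -(rmorph_nat f) (extends_vmax _ VW). Qed.

Lemma p_natr_unit n : ~ vmax W (p ^ n)%:R.
Proof.
elim: n => [|n IH]; first exact: vmax1.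
rewrite expnS natrM => /vmax_prime[] //.
  exact: vr_nat.
exact: vr_nat.
Qed.

Lemma ginert_group_set : group_set (ginert G W).
Proof.
apply/group_setP; split.
  by apply/ginertP; split=> [|x _]; [exact: group1|rewrite gact1 subrr; exact: vmax0].
move=> s t /ginertP[sW hs] /ginertP[tW ht]; apply/ginertP; split; first exact: groupM.
move=> x Wx; rewrite gactM; apply: vmax_trans (hs x Wx); apply: ht.
by have /gstabP h := sW; apply/h.
Qed.

Lemma p_subgroup_card (H : {group gact_grp G}) : exists n, #|H| = (p ^ n)%N.
Proof.
have /p_natP[n En] : p.-nat #|H|.
  have := p_group_order p_pr pG; rewrite -cardsT; apply: pnat_dvd; apply: cardSg.
  exact: finset.subsetT.
by exists n.
Qed.

Lemma p_nT : ~ vmax W #|ginert G W|%:R.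
Proof.
have [n En] := p_subgroup_card (Group ginert_group_set).
by rewrite -[#|_|]/#|Group ginert_group_set| En; exact: p_natr_unit.
Qed.

Lemma p_residue_element r : p_element p (residue_map VW) r.
Proof.
apply: (galois_act_p_element (G := residue_act VW p_nT)) => // t.
have [n tn] := pG (sgval t); exists n; apply: val_inj.
by rewrite /= morphX ?inE // tn.
Qed.

(** An automorphism of order dividing p^n acts on w with an exponent s such that s^(p^n) = 1 modulo
    p, and by Fermat s^(p^n) = s; so w is fixed. *)
Lemma p_fixed_residue_root (w : residue W) : p.-primitive_root w ->
  exists2 v : residue V, p.-primitive_root v & w = residue_map VW v.
Proof.
move=> wp; have [|v Ev] := @gact_fix _ _ _ (residue_act VW p_nT) w.
  move=> t; have [s Es] : exists s, gact t w = w ^+ s.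
    have [|i ->] := prim_rootP wp (_ : gact t w ^+ p = 1); last by exists i.
    by rewrite -rmorphXn (prim_expr_order wp) rmorph1.
  have [n tn] := pG (sgval t).
  have tn' : (t ^+ (p ^ n))%g = 1%g by apply: val_inj; rewrite /= morphX ?inE // tn.
  have hi i : iter i (gact t) w = w ^+ (s ^ i).
    elim: i => [|i IH]; first by rewrite expr1.
    by rewrite iterS IH rmorphXn Es -exprM expnS.
  rewrite Es -(prim_root_exp_pX n s p_pr (prim_expr_order wp)) -hi -gactX tn'.
  exact: gact1.
exists v => //; have /(prime_primitive_root p_pr)[w1 w2] := wp.
apply/(prime_primitive_root p_pr); split.
  by apply: (fmorph_inj (residue_map VW)); rewrite rmorphXn rmorph1 -Ev.
by move=> v1; apply: w2; rewrite Ev v1 rmorph1.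
Qed.

(* For t in the inertia group, t x / x is a root of unity of p-power order modulo W. *)
Lemma p_value_surj x : ~ has_mup p [set: residue V] -> x != 0 ->
  exists2 y : k, vr_set W (f y / x) & ~ vmax W (f y / x).
Proof.
move=> nmu x0; apply: gact_unramified => //; first exact: p_nT.
move=> t tT; have [tW ht] := ginertP _ _ tT.
have [Wr nr] := gstab_ratio_unit tW x0; set r := gact t x / x in Wr nr *.
have hr i : vmax W (gact (t ^+ i)%g x / x - r ^+ i).
  elim: i => [|i IH]; first by rewrite gact1 divff // subrr; exact: vmax0.
  have tiW : (t ^+ i)%g \in gstab G W by exact: groupX.
  have Wri := (gstab_ratio_unit tiW x0).1.
  have -> : gact (t ^+ i.+1)%g x / x = gact t (gact (t ^+ i)%g x / x) * r.
    by rewrite expgSr gactM fmorph_div /r mulrA divfK // fmorph_eq0.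
  rewrite exprSr; apply: vmax_congM => //; first by have /gstabP h := tW; apply/h.
    by apply: vmax_trans IH; exact: ht.
  by rewrite subrr; exact: vmax0.
have [n tn] := pG t; have := hr (p ^ n)%N; rewrite tn gact1 divff //.
elim: n {tn} => [|n IH] h; first by rewrite expn0 expr1 in h; exact: vmaxBC.
apply: IH; apply: contrapT => hn; apply: nmu.
have Ww : vr_set W (r ^+ (p ^ n)) by exact: vrX.
have [|v vp _] := @p_fixed_residue_root (res (vr_elem Ww)); last by exists v.
apply/(prime_primitive_root p_pr); split.
  rewrite -(rmorphXn (@res _ W)) -(rmorph1 (@res _ W)); apply/res_eqP.
  by rewrite rmorphXn rmorph1 /= -exprM mulnC -expnS; exact: vmaxBC.
rewrite -(rmorph1 (@res _ W)) => /res_eqP; rewrite rmorph1 /= => h1.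
by apply: hn; exact: vmaxBC.
Qed.

(** The product of the conjugates of x under the decomposition group is fixed by inertia, so its
    value is one of k; and it has the value of x to the order of that p-group. *)
Lemma p_value_torsion x : x != 0 -> exists m (y : k),
  vr_set W (f y / x ^+ (p ^ m)) /\ ~ vmax W (f y / x ^+ (p ^ m)).
Proof.
move=> x0; have [m Em] := p_subgroup_card (gstab_group G W).
pose N := \prod_(t in gstab G W) gact t x.
have N0 : N != 0 by apply/prodf_neq0 => t _; rewrite fmorph_eq0.
have tN t : t \in gstab G W -> gact t N = N.
  move=> tW; rewrite rmorph_prod [RHS](reindex_inj (mulIg t)) /=.
  by apply: eq_big => [s|s _]; [rewrite (groupMr _ tW)|rewrite gactM].
have [] := @gact_unramified _ _ _ G W N N0 p_nT.
  move=> t /ginertP[tW _]; rewrite tN // divff // subrr; exact: vmax0.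
move=> y Wy ny; exists m, y.
have [WN nN] : vr_set W (N / x ^+ (p ^ m)) /\ ~ vmax W (N / x ^+ (p ^ m)).
  rewrite -Em /= -prodr_const -prodf_div.
  elim/big_ind: _ => [|u v [Wu nu] [Wv nv]|t tW]; last exact: gstab_ratio_unit.
    by split; [exact: vr1|exact: vmax1].
  by split; [exact: vrM|exact: vunitM].
have -> : f y / x ^+ (p ^ m) = (f y / N) * (N / x ^+ (p ^ m)) by rewrite mulrA divfK.
by split; [exact: vrM|exact: vunitM].
Qed.

End PValuation.

(** Every element of the Galois extension witnessing that x is a p-element is one too, so the whole
    extension maps into K. Questions about one element of F(p) thus reduce to finite
    p-extensions. *)
Lemma p_compositum_subextension (p : nat) (F K Omega : fieldType) (f : {rmorphism F -> K})
    (g : {rmorphism K -> Omega}) (x : K) :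
  prime p -> GRing.closed_field_axiom Omega -> range g = p_compositum p (g \o f) ->
  exists (N : splittingFieldType F) (j : {rmorphism N -> K}) (n : nat),
    [/\ galois 1 {:N}, \dim {:N} = (p ^ n)%N, forall a, j a%:A = f a & exists y, j y = x].
Proof.
move=> p_pr cl rg; have : p_element p (g \o f) (g x).
  by rewrite -p_compositumE // -rg; exists x.
move=> [n [N [j [galN dimN jf [y _ Ey]]]]].
have /choice[h hh] : forall z, exists u, g u = j z.
  move=> z; have : range g (j z) by rewrite rg p_compositumE //; exists n, N, j; split=> //; exists z.
  by move=> [u _ <-]; exists u.
have [||r rE] := @rmorphism_of N K h.
- by move=> a b; apply: (fmorph_inj g); rewrite rmorphB !hh rmorphB.
- split=> [|a b]; apply: (fmorph_inj g); first by rewrite hh !rmorph1.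
  by rewrite rmorphM !hh rmorphM.
exists N, r, n; split=> //.
  by move=> a; rewrite rE; apply: (fmorph_inj g); rewrite hh jf.
by exists y; rewrite rE; apply: (fmorph_inj g); rewrite hh.
Qed.

Lemma gal_act_pgroup (p n : nat) (F : fieldType) (N : splittingFieldType F)
    (galN : galois 1 {:N}) : \dim {:N} = (p ^ n)%N ->
  forall t : gact_grp (gal_act galN), exists m, (t ^+ (p ^ m))%g = 1%g.
Proof.
by move=> dimN t; exists n; rewrite -dimN -card_gal1 // expg_cardG // mem_gal1.
Qed.

Section MaxPExtensionValuation.
Variables (p : nat) (F K Omega : fieldType) (f : {rmorphism F -> K})
  (g : {rmorphism K -> Omega}).
Variables (V : valuation_ring F) (Y : valuation_ring K) (VY : extends f V Y).
Hypotheses (p_pr : prime p) (nVp : ~ vmax V p%:R) (cl : GRing.closed_field_axiom Omega).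
Hypothesis rg : range g = p_compositum p (g \o f).

Lemma max_p_residue_element (r : residue Y) : p_element p (residue_map VY) r.
Proof.
have [x [Yx ->]] := res_lift r.
have [N [j [n [galN dimN jf [y yx]]]]] := p_compositum_subextension x p_pr cl rg.
pose W := vr_pull j Y; have WY : extends j W Y by [].
have VW : extends (in_alg N) V W.
  by rewrite (extends_pull VY); apply/seteqP; split=> a /=; rewrite jf.
have Wy : vr_set W y by rewrite /= yx.
have := p_residue_element (G := gal_act galN) VW p_pr nVp (gal_act_pgroup dimN) (res (vr_elem Wy)).
move=> /(p_element_comp (residue_map_comp VW WY VY jf)).
suff <- : residue_map WY (res (vr_elem Wy)) = res (vr_elem Yx) by [].
by apply: residue_map_res; rewrite /= yx.
Qed.

Lemma max_p_value_surj x : ~ has_mup p [set: residue V] -> x != 0 ->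
  exists2 y : F, vr_set Y (f y / x) & ~ vmax Y (f y / x).
Proof.
move=> nmu x0; have [N [j [n [galN dimN jf [y yx]]]]] := p_compositum_subextension x p_pr cl rg.
pose W := vr_pull j Y.
have VW : extends (in_alg N) V W.
  by rewrite (extends_pull VY); apply/seteqP; split=> a /=; rewrite jf.
have y0 : y != 0 by rewrite -(fmorph_eq0 j) yx.
have [a] := p_value_surj (G := gal_act galN) VW p_pr nVp (gal_act_pgroup dimN) nmu y0.
rewrite vmax_pull /= fmorph_div yx jf => h1 h2; by exists a.
Qed.

Lemma max_p_value_torsion x : x != 0 -> exists m (y : F),
  vr_set Y (f y / x ^+ (p ^ m)) /\ ~ vmax Y (f y / x ^+ (p ^ m)).
Proof.
move=> x0; have [N [j [n [galN dimN jf [y yx]]]]] := p_compositum_subextension x p_pr cl rg.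
pose W := vr_pull j Y.
have VW : extends (in_alg N) V W.
  by rewrite (extends_pull VY); apply/seteqP; split=> a /=; rewrite jf.
have y0 : y != 0 by rewrite -(fmorph_eq0 j) yx.
have [m [a]] := p_value_torsion (G := gal_act galN) VW p_pr nVp (gal_act_pgroup dimN) y0.
by rewrite vmax_pull /= fmorph_div rmorphXn yx jf => h; exists m, a.
Qed.

End MaxPExtensionValuation.

(** * Lifting p-extensions of the residue field *)

Section TotalResidue.
Variables (K : fieldType) (W : valuation_ring K).

(** A total residue map, 0 outside W, so that products and sums can be reduced without carrying
    membership proofs in the terms. *)
Definition rsd (x : K) : residue W :=
  if pselect (vr_set W x) is left h then res (vr_elem h) else 0.

Lemma rsdE x (Wx : vr_set W x) : rsd x = res (vr_elem Wx).
Proof. by rewrite /rsd; case: pselect => // h; apply/res_elemP; rewrite subrr; exact: vmax0. Qed.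

Lemma rsd_surj r : exists2 x, vr_set W x & r = rsd x.
Proof. by have [x [Wx ->]] := res_lift r; exists x => //; rewrite (rsdE Wx). Qed.

Lemma rsdP x y : vr_set W x -> vr_set W y -> rsd x = rsd y <-> vmax W (x - y).
Proof. by move=> Wx Wy; rewrite (rsdE Wx) (rsdE Wy); exact: res_elemP. Qed.

Lemma rsd1 : rsd 1 = 1.
Proof. by rewrite (rsdE (vr1 W)) -(rmorph1 (@res _ W)); apply/res_eqP; rewrite rmorph1 subrr; exact: vmax0. Qed.

Lemma rsdM x y : vr_set W x -> vr_set W y -> rsd (x * y) = rsd x * rsd y.
Proof.
move=> Wx Wy; rewrite (rsdE Wx) (rsdE Wy) (rsdE (vrM Wx Wy)) -(rmorphM (@res _ W)).
by apply/res_eqP; rewrite rmorphM subrr; exact: vmax0.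
Qed.

Lemma rsdX x n : vr_set W x -> rsd (x ^+ n) = rsd x ^+ n.
Proof.
by move=> Wx; elim: n => [|n IH]; rewrite ?rsd1 // !exprS rsdM ?IH //; exact: vrX.
Qed.

Lemma rsd_prod (I : Type) (r : seq I) (P : pred I) (F : I -> K) :
  (forall i, P i -> vr_set W (F i)) ->
  rsd (\prod_(i <- r | P i) F i) = \prod_(i <- r | P i) rsd (F i).
Proof.
move=> WF.
suff [] : vr_set W (\prod_(i <- r | P i) F i) /\
  rsd (\prod_(i <- r | P i) F i) = \prod_(i <- r | P i) rsd (F i) by [].
elim/big_rec2: _ => [|i y x Pi [Wx <-]]; first by split; [exact: vr1|exact: rsd1].
by have Wi := WF i Pi; split; [exact: vrM|exact: rsdM].
Qed.

Lemma rsd_eq0 x : vr_set W x -> rsd x = 0 <-> vmax W x.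
Proof.
move=> Wx; have := rsdP Wx (vr0 W); rewrite subr0 => <-.
suff -> : rsd 0 = 0 by [].
by rewrite (rsdE (vr0 W)) -(rmorph0 (@res _ W)); apply/res_eqP; rewrite rmorph0 subrr; exact: vmax0.
Qed.

End TotalResidue.

Lemma rsd_map (K M : fieldType) (f : {rmorphism K -> M}) (V : valuation_ring K)
    (W : valuation_ring M) (VW : extends f V W) x : vr_set V x ->
  residue_map VW (rsd V x) = rsd W (f x).
Proof.
move=> Vx; have Wx := (extendsE VW x).2 Vx.
by rewrite (rsdE Vx) (rsdE Wx) (residue_map_elem VW Vx Wx).
Qed.

Lemma unity_root_power (p : nat) (M : fieldType) (z a b : M) :
  p.-primitive_root z -> a != 0 -> b ^+ p = a ^+ p -> exists i : nat, b = z ^+ i * a.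
Proof.
move=> zp a0 e; have [|i Ei] := prim_rootP zp (_ : (b / a) ^+ p = 1).
  by rewrite expr_div_n e divff // expf_neq0.
by exists i; rewrite -Ei divfK.
Qed.

Lemma coprime_power_in (M : fieldType) (S : set M) (p m : nat) (a : M) :
  subfield_set S -> prime p -> coprime m p -> S (a ^+ m) -> S (a ^+ p) -> S a.
Proof.
move=> sS p_pr cmp Sm Sp; have [S1 _ SV] := sS.
have SD x y : S x -> S y -> S (x / y).
  by move=> Sx Sy; apply/set_mem/SV; exact/mem_set.
have SM x y : S x -> S y -> S (x * y).
  move=> Sx Sy; rewrite -[y]invrK -[y^-1]mul1r; apply: (SD) => //; apply: (SD) => //.
  exact/set_mem.
have SX x i : S x -> S (x ^+ i).
  by move=> Sx; elim: i => [|i IH]; [exact/set_mem|rewrite exprS; exact: (SM)].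
have m0 : m%:R != 0 :> 'F_p.
  apply/eqP => m0; have /eqP : (m = 0 %[mod p])%N by apply/modn_Fp.
  by rewrite mod0n => pm; move: cmp; rewrite coprime_sym prime_coprime // /dvdn pm.
pose u := val ((m%:R : 'F_p)^-1).
have E : (u * m)%N = ((u * m) %/ p * p + 1)%N.
  rewrite {1}(divn_eq (u * m) p); congr (_ + _)%N.
  have /(modn_Fp p_pr (u * m) 1) -> : (u * m)%:R = 1%:R :> 'F_p.
    by rewrite natrM natr_Zp mulVf.
  by rewrite modn_small // prime_gt1.
have [a0|a0] := eqVneq a 0.
  by move: Sp; rewrite a0 expr0n eqn0Ngt prime_gt0.
have -> : a = a ^+ (u * m) / a ^+ ((u * m) %/ p * p).
  by rewrite {1}E exprD expr1 mulrAC divff ?mul1r // expf_neq0.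
apply: (SD); first by rewrite mulnC exprM; exact: SX.
by rewrite [(_ * p)%N]mulnC exprM; exact: SX.
Qed.

(** An element of order p would act on z with an exponent s such that s = s^p = 1 modulo p. *)
Lemma mup_card_coprime (p : nat) (K E : fieldType) (f : {rmorphism K -> E})
    (G : galois_act f) (z : E) (H : {group gact_grp G}) :
  prime p -> p.-primitive_root z -> faithful_at G z -> coprime #|H| p.
Proof.
move=> p_pr zp fz; rewrite coprime_sym prime_coprime //; apply/negP => /(Cauchy p_pr)[t _ ot].
have [s [_ [hs _ _ _]]] := mup_exponents G p_pr zp.
have hi i : gact (t ^+ i)%g z = z ^+ (s t ^ i).
  elim: i => [|i IH]; first by rewrite gact1 expr1.
  by rewrite expgSr gactM IH rmorphXn hs -exprM expnS.
have /fz t1 : gact t z = z.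
  rewrite hs -(prim_root_exp_pX 1 _ p_pr (prim_expr_order zp)) expn1 -hi -ot expg_order.
  exact: gact1.
by move: ot p_pr; rewrite t1 order1 => <-.
Qed.

(** The p-th root given by the Kummer argument reduces, up to a root of unity, to the product q of
    the [alpha t ^+ n t] over the decomposition group, so q lies in the residue field of E. The last
    hypothesis says that [alpha t ^+ n t] agrees with [alpha 1%g] up to that field; the exponent p -
    1 avoids a division, since [alpha 1%g ^+ p] lies there. *)
Lemma kummer_descent (p : nat) (F K Omega E : fieldType) (f : {rmorphism F -> K})
    (g : {rmorphism K -> Omega}) (phi : {rmorphism K -> E}) (j : {rmorphism E -> Omega})
    (G : galois_act phi) (z : E) (s n : gact_grp G -> nat)
    (B : valuation_ring Omega) (W : valuation_ring E) (WB : extends j W B)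
    (alpha : gact_grp G -> residue B) (a : E) :
  prime p -> p%:R != 0 :> F -> GRing.closed_field_axiom Omega ->
  range g = p_compositum p (g \o f) -> (forall a, j (phi a) = g a) ->
  p.-primitive_root z -> faithful_at G z ->
  (forall t, gact t z = z ^+ s t) -> (forall t, (n t)%:R = (s t)%:R^-1 :> 'F_p) ->
  ~ vmax W p%:R ->
  vr_set W a -> residue_map WB (rsd W a) = alpha 1%g ^+ p ->
  (forall t, t \in gstab G W -> alpha t ^+ p = residue_map WB (rsd W (gact t a))) ->
  (forall t, t \in gstab G W ->
     exists r, alpha t ^+ n t * alpha 1%g ^+ p.-1 = residue_map WB r) ->
  exists r, alpha 1%g = residue_map WB r.
Proof.
move=> p_pr p0 cl rg jphi zp fz hs hn nWp Wa Ea Et Bt.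
have [m|na] := pselect (vmax W a).
  exists 0; rewrite rmorph0; apply/eqP; move: Ea; rewrite (rsd_eq0 Wa).2 // rmorph0.
  by move=> /esym/eqP; rewrite expf_eq0 => /andP[].
have [|||u [u1 hu]] := @approximation _ W (gact_grp G) (fun t => t \notin gstab G W)
    (fun t => vr_pull (gact t) W) (fun=> a - 1).
- by move=> t ni /gact_pull_sub; exact/negP.
- by move=> t ni /gact_pull_sup; exact/negP.
- by move=> t U _ WU _; apply: WU; apply: vrB => //; exact: vr1.
have Wu : vr_set W u by apply: vr_cong u1 _; exact: vr1.
have Wa1 : vr_set W (a - 1) by apply: vrB => //; exact: vr1.
(* Congruent to a at W and to 1 at the other conjugates of W, so that only the decomposition group
   contributes residues to the product. *)
pose b := 1 + u * (a - 1).
have ba : vmax W (b - a).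
  have -> : b - a = (u - 1) * (a - 1) by rewrite /b mulrBl mul1r opprB addrCA addrA.
  exact: vmaxMr.
have b0 : b != 0 by apply/eqP => b0; apply: na; apply: vmax_cong ba _; rewrite b0; exact: vmax0.
have bt (t : gact_grp G) : t \notin gstab G W -> vmax W (gact t b - 1).
  move=> /hu[_]; rewrite vmax_pull => h.
  by rewrite /b rmorphD rmorph1 addrC addKr.
have Wb : vr_set W b by apply: vr_cong ba Wa.
have [c Ec] := kummer_pth_power p_pr p0 cl rg jphi zp fz hs hn b0.
have Wat (t : gact_grp G) : t \in gstab G W -> vr_set W (gact t a) by move=> /gstabP h; apply/h.
have Wbt (t : gact_grp G) : vr_set W (gact t b).
  have [/gstabP h|/bt h] := boolP (t \in gstab G W); first exact/h.
  by apply: vr_cong h _; exact: vr1.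
have Wc : vr_set W c.
  apply: (@vr_of_exp _ _ _ p); first exact: prime_gt0.
  by rewrite -Ec; apply: vr_prod => t _; exact: vrX.
have resc : rsd W c ^+ p = \prod_(t in gstab G W) rsd W (gact t a) ^+ n t.
  rewrite -rsdX // -Ec rsd_prod => [|t _]; last exact: vrX.
  rewrite (bigID (mem (gstab G W))) /= [X in _ * X]big1 => [|t nt].
    rewrite mulr1; apply: eq_bigr => t tW; rewrite rsdX //; congr (_ ^+ _).
    by apply/rsdP => //; [exact: Wat|rewrite -rmorphB; apply/gstab_vmax].
  rewrite rsdX // (_ : rsd W _ = 1) ?expr1n // -(rsd1 W).
  by apply/rsdP => //; [exact: vr1|exact: bt].
pose q := \prod_(t in gstab G W) alpha t ^+ n t.
have Eq : q ^+ p = residue_map WB (rsd W c) ^+ p.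
  rewrite /q -prodrXl -rmorphXn resc rmorph_prod; apply: eq_bigr => t tW.
  transitivity ((alpha t ^+ p) ^+ n t); first by rewrite -!exprM mulnC.
  by rewrite (Et t tW) -rmorphXn.
have c0 : residue_map WB (rsd W c) != 0.
  rewrite fmorph_eq0; apply/eqP => /(rsd_eq0 Wc).1 mc; exfalso.
  have : vmax W (\prod_(t : gact_grp G) gact t b ^+ n t).
    by rewrite Ec -(prednK (prime_gt0 p_pr)) exprS; apply: vmaxMr => //; exact: vrX.
  have nbt (t : gact_grp G) : ~ vmax W (gact t b).
    have [tW|/bt h m] := boolP (t \in gstab G W).
      by move=> /(gstab_vmax _ tW) m; apply: na; exact: vmax_cong ba m.
    by apply: (@vmax1 _ W); exact: vmax_cong h m.
  suff [] : vr_set W (\prod_(t : gact_grp G) gact t b ^+ n t) /\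
     ~ vmax W (\prod_(t : gact_grp G) gact t b ^+ n t) by [].
  elim/big_ind: _ => [|x y [Wx nx] [Wy ny]|t _].
  - by split; [exact: vr1|exact: vmax1].
  - by split; [exact: vrM|exact: vunitM].
  - by split; [exact: vrX|move=> /(vmaxX (Wbt t)); exact: nbt].
have nVp : ~ vmax (vr_pull phi W) p%:R by rewrite vmax_pull rmorph_nat.
have zBp : p.-primitive_root (residue_map WB (mup_res W p_pr zp)).
  have /(prime_primitive_root p_pr)[z1 z2] := mup_res_prim (vr_pull_extends phi W) p_pr nVp zp.
  apply/(prime_primitive_root p_pr); split; first by rewrite -rmorphXn z1 rmorph1.
  by rewrite -(rmorph1 (residue_map WB)) => /fmorph_inj.
have [i Ei] := unity_root_power zBp c0 Eq.
have q0 : q != 0.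
  by rewrite Ei mulf_neq0 // expf_neq0 //; exact: mup_root_neq0 p_pr zBp.
have sR := range_subfield (residue_map WB).
suff : range (residue_map WB) (alpha 1%g) by move=> [r _ <-]; exists r.
(* Multiplying the last hypothesis over the decomposition group and dividing by q leaves this power
   of [alpha 1%g]; its exponent is prime to p. *)
apply: (@coprime_power_in _ _ p (p.-1 * #|gstab G W|)) => //; last by rewrite -Ea; exists (rsd W a).
  rewrite coprimeMl (mup_card_coprime _ p_pr zp fz) andbT.
  by rewrite -{2}(prednK (prime_gt0 p_pr)) coprimenS.
have [_ _ RV] := sR.
have -> : alpha 1%g ^+ (p.-1 * #|gstab G W|) =
    (\prod_(t in gstab G W) (alpha t ^+ n t * alpha 1%g ^+ p.-1)) / q.
  by rewrite big_split /= prodr_const -exprM mulrAC divff // mul1r.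
apply/set_mem/RV; apply/mem_set.
  elim/big_ind: _ => [|x y [x' _ <-] [y' _ <-]|t tW].
  - by exists 1; rewrite ?rmorph1.
  - by exists (x' * y'); rewrite ?rmorphM.
  - by have [r ->] := Bt t tW; exists r.
by rewrite Ei; exists (mup_res W p_pr zp ^+ i * rsd W c); rewrite // rmorphM rmorphXn.
Qed.

Section ResolventDescent.
Variables (p : nat) (k R Om : fieldType) (r : {rmorphism k -> R}) (iota : {rmorphism R -> Om}).
Variables (N : splittingFieldType k) (galN : galois 1 {:N}) (j : {rmorphism N -> Om}).
Hypotheses (p_pr : prime p) (p0 : p%:R != 0 :> Om) (jb : forall a, j a%:A = iota (r a)).
Variables (zeta : Om) (zp : p.-primitive_root zeta).
Variables (H H' : {group gal_of {:N}}).
Hypotheses (nHH : (H' <| H)%g) (iHH : #|H : H'|%g = p).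
Hypothesis fixH : forall x, x \in fixedField H -> exists y, j x = iota y.

Let zetaX a b : a = b %[mod p] -> zeta ^+ a = zeta ^+ b.
Proof. by move=> h; apply/eqP; rewrite (eq_prim_root_expr zp) h. Qed.

(** sigma is an element of H outside H'; its coset generates the quotient, which has prime order
    p. *)
Lemma fixedField_prime_index : exists sigma : {rmorphism N -> N},
  [/\ forall h y, h \in H -> y \in fixedField H' -> exists i, h y = iter i sigma y,
      forall i y, y \in fixedField H' -> iter i sigma y \in fixedField H',
      forall y, y \in fixedField H' -> iter p sigma y = y &
      forall a, sigma a%:A = a%:A].
Proof.
have sub := normal_sub nHH.
have cQ : #|(H / H')%g| = p by rewrite card_quotient ?normal_norm.
have [s sH nsH] : exists2 s, s \in H & s \notin H'.
  apply/fintype.subsetPn; apply/negP => h.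
  by move: h p_pr; rewrite -indexg_eq1 iHH => /eqP ->.
have sN : s \in 'N(H')%g by rewrite (fintype.subsetP (normal_norm nHH)).
have genQ : <[coset H' s]>%g = (H / H')%g.
  have oQ : #[coset H' s]%g = p.
    apply/eqP; have : (#[coset H' s]%g %| p)%N by rewrite -cQ order_dvdG ?mem_quotient.
    case/primeP: (p_pr) => _ h /h /orP[|//]; rewrite order_eq1 => /eqP /coset_idr.
    by move=> /(_ sN); rewrite (negbTE nsH).
  apply/eqP; rewrite eqEcard cycle_subG mem_quotient //= cQ.
  by rewrite -[#|_|]/(#[coset H' s]%g) oQ.
have sp : (s ^+ p)%g \in H'.
  apply: coset_idr; first by rewrite groupX.
  by rewrite morphX // -cQ expg_cardG ?mem_quotient.
have fixP y : y \in fixedField H' -> forall h, h \in H' -> h y = y.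
  by move=> /mem_fixedFieldP[_ h]; exact: h.
exists (gal_rmorph s); split.
- move=> h y hH yE; have : coset H' h \in <[coset H' s]>%g by rewrite genQ mem_quotient.
  have hN : h \in 'N(H')%g by rewrite (fintype.subsetP (normal_norm nHH)).
  move=> /cycleP[i]; rewrite -morphX // => e; exists i.
  have : (h * (s ^+ i)^-1)%g \in H'.
    apply: coset_idr; first by rewrite groupM ?groupV ?groupX.
    by rewrite morphM ?groupV ?groupX // morphV ?groupX // -e mulgV.
  move=> /(fixP y yE) E; rewrite -[in RHS]E -gal_X.
  by rewrite -[RHS]galM ?memvf // mulgKV.
- move=> i y yE; elim: i => // i IH; apply/fixedFieldP; rewrite ?memvf // => h hH' /=.
  have hs : (s * h)%g = ((s * h * s^-1) * s)%g by rewrite mulgKV.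
  have hc : (s * h * s^-1)%g \in H' by rewrite -{1}[s]invgK -mulgA -conjgE memJ_norm ?groupV.
  rewrite -[LHS](galM s h (memvf _)) hs galM ?memvf //; congr (gal_repr s _); exact: fixP.
- by move=> y yE; rewrite -gal_X; exact: fixP.
- by move=> a; exact: gal_rmorph_base.
Qed.

Variables (T : fieldType) (phi : {rmorphism R -> T}) (kappa : {rmorphism T -> Om}).
Hypothesis kphi : forall a, kappa (phi a) = iota a.
(** The form in which [kummer_descent] is used: [alpha e] is a Lagrange resolvent at zeta^e. As one
    polynomial A gives all p-th powers, an automorphism zeta -> zeta^s carries the p-th power of
    [alpha e] to that of [alpha (e * s)]. *)
Hypothesis kummer : forall (alpha : nat -> Om) (A : {poly R}),
  (forall e e', e = e' %[mod p] -> alpha e = alpha e') ->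
  (forall e, alpha e ^+ p = (map_poly iota A).[zeta ^+ e]) ->
  (forall e m n, (m * n)%N = 1 %[mod p] -> exists A' : {poly R},
     alpha (e * m)%N ^+ n * alpha e ^+ p.-1 = (map_poly iota A').[zeta ^+ e]) ->
  forall e, coprime e p -> exists u, alpha e = kappa u.

(* Lagrange resolvents: replacing y by sigma y multiplies the resolvent at zeta^e by
   zeta^(-e), so that suitable monomials in the resolvents are invariant, and averaging
   over sigma moves their coefficients to R. *)
Lemma resolvent_lift y : y \in fixedField H' -> exists u, j y = kappa u.
Proof.
have [sigma [hH sE sp sF]] := fixedField_prime_index => yE.
have galH : galois (fixedField H') {:N} by exact: fixedField_galois.
pose resol e c := \sum_(i < p) zeta ^+ (e * i) * j (iter i sigma c).
(* Resolvents with an indeterminate in place of zeta, so that descending the coefficients treats all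
   zeta^e simultaneously. *)
pose pol m c : {poly N} := \sum_(i < p) iter i sigma c *: 'X^(m * i).
pose ev e (q : {poly N}) := (map_poly j q).[zeta ^+ e].
have ev_pol e m c : ev e (pol m c) = resol (e * m)%N c.
  rewrite /ev rmorph_sum horner_sum; apply: eq_bigr => i _ /=.
  rewrite -mul_polyC rmorphM /= map_polyC map_polyXn hornerM hornerC hornerXn.
  by rewrite mulrC -exprM mulnA.
have ev_M e q q' : ev e (q * q') = ev e q * ev e q' by rewrite /ev rmorphM hornerM.
have ev_X e q n : ev e (q ^+ n) = ev e q ^+ n.
  by elim: n => [|n IH]; rewrite ?exprS ?ev_M ?IH // /ev rmorph1 hornerC.
have shift e c : c \in fixedField H' -> zeta ^+ e * resol e (sigma c) = resol e c.
  move=> cE; rewrite /resol mulr_sumr -(prednK (prime_gt0 p_pr)) big_ord_recr big_ord_recl /=.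
  rewrite addrC muln0 expr0 mul1r; congr (_ + _).
    rewrite mulrA -exprD -mulnS prednK ?prime_gt0 // (zetaX (_ : _ = 0 %[mod p])); last first.
      by rewrite modnMl mod0n.
    rewrite expr0 mul1r; congr (j _); rewrite -iterSr prednK ?prime_gt0 //; exact: sp.
  apply: eq_bigr => i _; rewrite mulrA -exprD -mulnS -iterSr.
  by rewrite /bump.
have shiftn e l c : c \in fixedField H' -> zeta ^+ (e * l) * resol e (iter l sigma c) = resol e c.
  move=> cE; elim: l => [|l IH]; first by rewrite muln0 mul1r.
  by rewrite mulnSr exprD -mulrA shift ?IH //; exact: sE.
have sg l : exists s : {rmorphism N -> N}, s =1 iter l sigma.
  elim: l => [|l [s hs]]; first by exists idfun.
  by exists (sigma \o s) => x /=; rewrite hs.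
have /choice[tw htw] := sg.
have tw_pol l m c : map_poly (tw l) (pol m c) = pol m (iter l sigma c).
  rewrite rmorph_sum; apply: eq_bigr => i _ /=.
  rewrite -!mul_polyC rmorphM /= map_polyC map_polyXn /= htw -!iterD addnC //.
have polE m c : c \in fixedField H' -> pol m c \is a polyOver (fixedField H').
  by move=> cE; apply: rpred_sum => i _; rewrite polyOverZ ?polyOverXn //; exact: sE.
have trE c : c \in fixedField H' -> exists u, j (\sum_(i < p) iter i sigma c) = iota u.
  move=> cE; apply: fixH; apply/fixedFieldP; rewrite ?memvf // => h hh.
  have trs : sigma (\sum_(i < p) iter i sigma c) = \sum_(i < p) iter i sigma c.
    rewrite rmorph_sum -(prednK (prime_gt0 p_pr)) big_ord_recr big_ord_recl /= addrC.
    by rewrite -iterS prednK ?prime_gt0 // sp.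
  have trH' : \sum_(i < p) iter i sigma c \in fixedField H' by apply: rpred_sum => i _; exact: sE.
  have [i ->] := hH h _ hh trH'.
  by elim: i => // i IH; rewrite iterS IH.
have pR0 : p%:R != 0 :> R by have := p0; rewrite -(rmorph_nat iota) fmorph_eq0.
have desc q : q \is a polyOver (fixedField H') -> exists A : {poly R},
    forall e, (forall l, ev e (map_poly (tw l) q) = ev e q) -> ev e q = (map_poly iota A).[zeta ^+ e].
  move=> qE; have /choice[u hu] : forall i, exists u, j (\sum_(l < p) iter l sigma q`_i) = iota u.
    by move=> i; apply: trE; exact: (polyOverP qE).
  exists (\poly_(i < size q) (p%:R^-1 * u i)) => e he.
  apply: (mulfI p0); transitivity (\sum_(l < p) ev e (map_poly (tw l) q)).
    by rewrite (eq_bigr (fun=> ev e q)) => [|l _ //]; rewrite sumr_const card_ord mulr_natl.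
  rewrite (@horner_coef_wide _ (size q)); last by rewrite size_map_poly; exact: size_poly.
  under eq_bigr do rewrite /ev (@horner_coef_wide _ (size q)) ?size_map_poly //.
  rewrite exchange_big mulr_sumr; apply: eq_bigr => i _ /=.
  have Eu : iota (p%:R^-1 * u i) = p%:R^-1 * j (\sum_(l < p) iter l sigma q`_i).
    by rewrite rmorphM fmorphV rmorph_nat hu.
  rewrite [in RHS]coef_map coef_poly ltn_ord [X in _ * (X * _)]Eu mulrA mulVKf //.
  rewrite rmorph_sum mulr_suml; apply: eq_bigr => l _.
  by rewrite !coef_map /= htw.
have zp1 := prim_expr_order zp.
have res_lift e : coprime e p -> exists u, resol e y = kappa u.
  have [A hA] := desc (pol 1%N y ^+ p) (rpredX p (polE 1%N y yE)).
  move=> ce; apply: (@kummer (fun e => resol e y) A _ _ _ e ce) => [a b ab|a|a m n mn].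
  - apply: eq_bigr => i _; congr (_ * _); apply: zetaX.
    by rewrite -modnMml ab modnMml.
  - rewrite -{1}[a]muln1 -ev_pol -ev_X; apply: hA => l.
    rewrite rmorphXn /= tw_pol !ev_X !ev_pol muln1 -[in RHS](shiftn a l y yE) exprMn.
    by rewrite -exprM mulnC exprM zp1 expr1n mul1r.
  - have [A' hA'] := desc (pol m y ^+ n * pol 1%N y ^+ p.-1)
      (rpredM (rpredX n (polE m y yE)) (rpredX p.-1 (polE 1%N y yE))).
    exists A'; rewrite -hA' => [|l]; first by rewrite ev_M !ev_X !ev_pol muln1.
    rewrite rmorphM !rmorphXn /= !tw_pol !ev_M !ev_X !ev_pol muln1.
    rewrite -[in RHS](shiftn (a * m)%N l y yE) -[X in _ = _ * X ^+ _](shiftn a l y yE).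
    (* The two resolvents contribute the exponent a l (m n + p - 1), divisible by p because m n = 1
       modulo p. *)
    rewrite !exprMn mulrACA -!exprM -exprD (zetaX (_ : _ = 0 %[mod p])) ?mul1r //.
    rewrite mod0n; apply/eqP; rewrite -/(dvdn p _).
    have -> : (a * m * l * n + a * l * p.-1 = a * l * (m * n + p.-1))%N.
      by rewrite mulnDr; congr (_ + _)%N; rewrite -!mulnA; congr (a * _)%N; rewrite mulnCA.
    apply: dvdn_mull; rewrite /dvdn -modnDml mn modnDml add1n prednK ?prime_gt0 //.
    by rewrite modnn.
have sumE : p%:R * j y = \sum_(e < p) resol e y.
  rewrite exchange_big (bigD1 (Ordinal (prime_gt0 p_pr))) //= [X in _ + X]big1 => [|i i0].
    under eq_bigr do rewrite muln0 expr0 mul1r.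
    by rewrite sumr_const card_ord addr0 mulr_natl.
  under eq_bigr do rewrite mulnC exprM.
  rewrite -mulr_suml sum_unity_root ?mul0r //.
    by rewrite -exprM mulnC exprM zp1 expr1n.
  rewrite -(expr0 zeta) (eq_prim_root_expr zp) mod0n modn_small //.
have /choice[u hu] : forall e : 'I_p, exists u, resol e y = kappa u.
  (* The remaining index e = 0 gives the trace of y, which is already in R. *)
  move=> e; have [ce|] := boolP (coprime e p); first exact: res_lift.
  rewrite coprime_sym prime_coprime // negbK => pe.
  have [u eu] := trE y yE; exists (phi u); rewrite kphi -eu rmorph_sum.
  apply: eq_bigr => i _; rewrite (zetaX (_ : _ = 0 %[mod p])) ?expr0 ?mul1r //.
  by rewrite mod0n; apply/eqP; exact: dvdn_mulr.
exists (p%:R^-1 * \sum_e u e); apply: (mulfI p0).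
rewrite sumE rmorphM fmorphV rmorph_nat mulVKf // rmorph_sum.
by apply: eq_bigr => e _; exact: hu.
Qed.

End ResolventDescent.

Section PGaloisDescent.
Variables (p : nat) (k R Om : fieldType) (r : {rmorphism k -> R}) (iota : {rmorphism R -> Om}).
Variables (N : splittingFieldType k) (galN : galois 1 {:N}) (j : {rmorphism N -> Om}).
Hypotheses (p_pr : prime p) (p0 : p%:R != 0 :> Om) (jb : forall a, j a%:A = iota (r a)).
Variables (zeta : Om) (zp : p.-primitive_root zeta).
Variables (T : fieldType) (phi : {rmorphism R -> T}) (kappa : {rmorphism T -> Om}).
Variable D : galois_act phi.
Hypothesis kphi : forall a, kappa (phi a) = iota a.
Hypothesis coD : forall t : gact_grp D, coprime #[t]%g p.
Hypothesis kummer : forall (alpha : nat -> Om) (A : {poly R}),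
  (forall e e', e = e' %[mod p] -> alpha e = alpha e') ->
  (forall e, alpha e ^+ p = (map_poly iota A).[zeta ^+ e]) ->
  (forall e m n, (m * n)%N = 1 %[mod p] -> exists A' : {poly R},
     alpha (e * m)%N ^+ n * alpha e ^+ p.-1 = (map_poly iota A').[zeta ^+ e]) ->
  forall e, coprime e p -> exists u, alpha e = kappa u.

(* An automorphism t in D acts on the lift of a generator theta of the fixed field of H'
   as some h in H; the orders of t and h being coprime, t fixes that lift. *)
Lemma p_galois_descent_step (H H' : {group gal_of {:N}}) :
  (H' <| H)%g -> #|H : H'|%g = p -> (p.-group H)%g ->
  (forall x, x \in fixedField H -> exists y, j x = iota y) ->
  forall x, x \in fixedField H' -> exists y, j x = iota y.
Proof.
move=> nHH iHH pH fixH.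
have /choice[lift hl] : forall y, exists u, y \in fixedField H' -> j y = kappa u.
  move=> y; have [yE|] := boolP (y \in fixedField H'); last by exists 0.
  by have [u hu] := resolvent_lift p_pr p0 zp nHH iHH fixH kphi kummer yE; exists u.
have sE : (fixedField H <= fixedField H')%VS by apply: fixedFieldS; exact: normal_sub.
have /and3P[_ sepN _] := fixedField_galois H.
have sepE : separable (fixedField H) (fixedField H').
  by apply: separableSr sepN; exact: subvf.
pose theta := separable_generator (fixedField H) (fixedField H').
have genE : (fixedField H' : {vspace N}) = <<fixedField H; theta>>%VS.
  exact: eq_adjoin_separable_generator.
have thE : theta \in fixedField H' by exact: separable_generator_mem.
have hE h y : h \in H -> y \in fixedField H' -> h y \in fixedField H'.
  move=> hh yE; have [sigma [hH sEE _ _]] := fixedField_prime_index p_pr nHH iHH.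
  by have [i ->] := hH h y hh yE; exact: sEE.
have liftP (q : {poly N}) : q \is a polyOver (fixedField H) ->
    exists A : {poly R}, map_poly j q = map_poly iota A.
  move=> qE; have /choice[u hu] : forall i, exists u, j q`_i = iota u.
    by move=> i; apply: fixH; exact: (polyOverP qE).
  exists (\poly_(i < size q) u i); apply/polyP => i; rewrite !coef_map coef_poly.
  by case: ltnP => [_|hi]; [exact: hu|by rewrite nth_default // !raddf0].
have kE (A : {poly R}) u : kappa (map_poly phi A).[u] = (map_poly iota A).[kappa u].
  by rewrite -horner_map -map_poly_comp (eq_map_poly kphi).
have actE (t : gact_grp D) (A : {poly R}) u : gact t (map_poly phi A).[u] = (map_poly phi A).[gact t u].
  by rewrite -horner_map -map_poly_comp (eq_map_poly (gact_base t)).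
have hfix h q : h \in H -> q \is a polyOver (fixedField H) -> map_poly (gal_rmorph h) q = q.
  move=> hh qE; apply/polyP => i; rewrite coef_map.
  by have /mem_fixedFieldP[_] := polyOverP qE i; apply.
have key (t : gact_grp D) : exists2 h, h \in H & forall y, y \in fixedField H' ->
    kappa (gact t (lift y)) = j (h y).
  pose q := \prod_(h in H) ('X - (gal_rmorph h theta)%:P).
  have qE : q \is a polyOver (fixedField H).
    apply/polyOverP => i; apply/fixedFieldP; rewrite ?memvf // => h hh.
    rewrite -[LHS]/(gal_rmorph h _) -coef_map; congr (nth 0 (polyseq _) i).
    rewrite /q rmorph_prod [RHS](reindex_inj (mulIg h)) /=.
    apply: eq_big => [g|g _]; first by rewrite groupMr.
    by rewrite rmorphB /= map_polyX map_polyC /= gal_rmorphM.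
  have [A EA] := liftP q qE.
  have : (map_poly iota A).[kappa (gact t (lift theta))] == 0.
    rewrite -kE fmorph_eq0 -actE fmorph_eq0 -(fmorph_eq0 kappa) kE -hl // -EA horner_map fmorph_eq0.
    by rewrite horner_prod (bigD1 1%g) //= gal_id !hornerE subrr mul0r.
  rewrite -EA rmorph_prod horner_prod => /prodf_eq0[h hh].
  rewrite rmorphB /= map_polyX map_polyC !hornerE subr_eq0 => /eqP Eth.
  exists h => // y yE; have /Fadjoin_polyP[u uE Ey] : y \in <<fixedField H; theta>>%VS by rewrite -genE.
  have [C EC] := liftP u uE.
  have -> : lift y = (map_poly phi C).[lift theta].
    by apply: (fmorph_inj kappa); rewrite kE -!hl // Ey -EC horner_map.
  rewrite actE kE -EC Eth horner_map Ey; congr (j _).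
  by rewrite -[RHS]/(gal_rmorph h _) -[RHS]horner_map hfix.
have fixed (t : gact_grp D) y : y \in fixedField H' -> gact t (lift y) = lift y.
  move=> yE; have [h hh ht] := key t.
  have it i : kappa (gact (t ^+ i)%g (lift y)) = j (iter i h y) /\ iter i h y \in fixedField H'.
    elim: i => [|i [IH1 IH2]]; first by rewrite gact1 hl.
    split; last by rewrite iterS hE.
    rewrite expgSr gactM; have -> : gact (t ^+ i)%g (lift y) = lift (iter i h y).
      by apply: (fmorph_inj kappa); rewrite IH1 hl.
    by rewrite ht.
  have hm : (h ^+ #[t])%g y = y.
    have [E _] := it #[t]%g; move: E; rewrite expg_order gact1 -hl // => /fmorph_inj E.
    by rewrite gal_X -E.
  have chm : coprime #|<[h]>%g| #[t]%g.
    rewrite -[#|_|]/(#[h]%g); have := mem_p_elt pH hh; rewrite /p_elt => /p_natP[[|e] ->]; first by rewrite expn0 coprime1n.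
    by rewrite coprime_sym coprimeXr ?coD.
  have hy : h y = y.
    rewrite -{1}(expgK chm (cycle_id h)) gal_X.
    by elim: (expg_invn _ _) => // i IH; rewrite iterS IH.
  by apply: (fmorph_inj kappa); rewrite ht // hy hl.
move=> x xE; have [w Ew] := gact_fix (fun t => fixed t x xE).
by exists w; rewrite hl // Ew kphi.
Qed.

(** A nontrivial p-group has a normal subgroup of index p; the subgroup H shrinks in such steps from
    the Galois group to the trivial group. *)
Lemma p_galois_descent (n : nat) : \dim {:N} = (p ^ n)%N -> forall x, exists y, j x = iota y.
Proof.
move=> dimN.
have pG (H : {group gal_of {:N}}) : (p.-group H)%g.
  rewrite /pgroup; apply: (@pnat_dvd _ (p ^ n)); last by rewrite pnatX pnat_id.
  rewrite -dimN -card_gal1 //; apply: cardSg; apply/fintype.subsetP => g _; exact: mem_gal1.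
suff main m : forall H : {group gal_of {:N}}, (#|H| <= m)%N ->
    (forall x, x \in fixedField H -> exists y, j x = iota y) -> forall x, exists y, j x = iota y.
  apply: (main _ ('Gal({:N} / 1))%G (leqnn _)) => x.
  move: (galN) => /galois_fixedField -> /vlineP[a ->]; exists (r a); exact: jb.
elim: m => [|m IH] H; first by rewrite leqNgt cardG_gt0.
move=> hm fixH; have [H1|H1] := eqVneq #|H| 1%N.
  move=> x; apply: fixH; apply/fixedFieldP; rewrite ?memvf // => h hh.
  by move: hh; rewrite (card1_trivg H1) => /finset.set1P ->; exact: gal_id.
have [e Ee] := p_natP (pG H).
have e0 : (0 < e)%N by case: e Ee => // E; move: H1; rewrite E.
have lee : (e.-1 <= logn p #|H|)%N by rewrite Ee pfactorK // leq_pred.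
have [H' [sHH nHH cH]] := normal_pgroup (pG H) (normal_refl H) lee.
have iHH : #|H : H'|%g = p.
  apply/eqP; rewrite -(eqn_pmul2l (cardG_gt0 H')) Lagrange // cH Ee -expnSr prednK //.
apply: (IH H'); last exact: p_galois_descent_step fixH.
rewrite -ltnS; apply: leq_trans hm; rewrite cH Ee -{2}(prednK e0) ltn_exp2l ?prime_gt1 //.
Qed.

End PGaloisDescent.

Lemma closed_primitive_root (Omega : fieldType) (p : nat) :
  GRing.closed_field_axiom Omega -> prime p -> p%:R != 0 :> Omega ->
  exists z : Omega, p.-primitive_root z.
Proof.
move=> cl p_pr p0; have [|z Ez] := cl p.-1 (fun=> -1).
  by rewrite -subn1 subn_gt0 prime_gt1.
have S0 : \sum_(i < p) z ^+ i = 0.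
  rewrite -(prednK (prime_gt0 p_pr)) big_ord_recr /= Ez -big_split /=.
  by apply: big1 => i _; rewrite mulN1r subrr.
exists z; apply/(prime_primitive_root p_pr); split.
  by apply/eqP; rewrite -subr_eq0 subrX1 S0 mulr0.
move=> z1; move: S0 p0; rewrite z1.
under eq_bigr do rewrite expr1n.
by rewrite sumr_const card_ord => ->; rewrite eqxx.
Qed.

Lemma extends_pull_comp (K E M : fieldType) (f : {rmorphism K -> E}) (j : {rmorphism E -> M})
    (g : {rmorphism K -> M}) (V : valuation_ring K) (B : valuation_ring M) :
  (forall a, j (f a) = g a) -> extends g V B -> extends f V (vr_pull j B).
Proof.
move=> jf VB; apply/seteqP; split=> x /=; rewrite jf; first by move/(extendsE VB).
by move=> h; apply/(extendsE VB).
Qed.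

Lemma rsd_sum (K : fieldType) (W : valuation_ring K) (I : Type) (r : seq I) (P : pred I) (F : I -> K) :
  (forall i, P i -> vr_set W (F i)) ->
  rsd W (\sum_(i <- r | P i) F i) = \sum_(i <- r | P i) rsd W (F i).
Proof.
move=> WF.
suff [] : vr_set W (\sum_(i <- r | P i) F i) /\
  rsd W (\sum_(i <- r | P i) F i) = \sum_(i <- r | P i) rsd W (F i) by [].
elim/big_rec2: _ => [|i y x Pi [Wx <-]]; first by split; [exact: vr0|exact/(rsd_eq0 (vr0 W))/vmax0].
have Wi := WF i Pi; split; first exact: vrD.
rewrite (rsdE Wx) (rsdE Wi) (rsdE (vrD Wi Wx)) -(rmorphD (@res _ W)).
by apply/res_eqP; rewrite rmorphD subrr; exact: vmax0.
Qed.

Lemma rsd_horner (K E : fieldType) (phi : {rmorphism K -> E}) (Y : valuation_ring K)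
    (W : valuation_ring E) (YW : extends phi Y W) (A : {poly residue Y}) :
  exists a : {poly K}, forall x, vr_set W x -> vr_set W (map_poly phi a).[x] /\
    rsd W (map_poly phi a).[x] = (map_poly (residue_map YW) A).[rsd W x].
Proof.
have /choice[u hu] : forall i, exists u, vr_set Y u /\ A`_i = rsd Y u.
  by move=> i; have [u Yu ->] := rsd_surj A`_i; exists u.
exists (\poly_(i < size A) u i) => x Wx.
have Ea : (map_poly phi (\poly_(i < size A) u i)).[x] = \sum_(i < size A) phi (u i) * x ^+ i.
  rewrite (@horner_coef_wide _ (size A)) ?size_map_poly; last exact: size_poly.
  by apply: eq_bigr => i _; rewrite [in LHS]coef_map coef_poly ltn_ord.
have Wi (i : 'I_(size A)) : vr_set W (phi (u i) * x ^+ i).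
  by apply: vrM; [apply/(extendsE YW); case: (hu i)|exact: vrX].
rewrite Ea; split; first exact: vr_sum.
rewrite rsd_sum => [|i _]; last exact: Wi.
rewrite horner_coef size_map_poly; apply: eq_bigr => i _; have [Yu Eu] := hu i.
rewrite rsdM ?rsdX //; [|exact/(extendsE YW)|exact: vrX].
by rewrite [in RHS]coef_map /= Eu rsd_map.
Qed.

Section ResidueLift.
Variables (p : nat) (F K Omega : fieldType) (f : {rmorphism F -> K}) (g : {rmorphism K -> Omega}).
Variables (V : valuation_ring F) (Y : valuation_ring K) (B : valuation_ring Omega).
Variables (VY : extends f V Y) (YB : extends g Y B).
Hypotheses (p_pr : prime p) (nVp : ~ vmax V p%:R) (cl : GRing.closed_field_axiom Omega).
Hypothesis rg : range g = p_compositum p (g \o f).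

(** Galois descent with R and T the residue fields of F(p) and of F(p)(mu_p). Its Kummer hypothesis
    is [kummer_descent] for the value at z^e of a lift of A and the family t ->
    [alpha (e * s t)]. *)
Lemma p_residue_lift x : p_element p (residue_map YB \o residue_map VY) x ->
  exists y, x = residue_map YB y.
Proof.
move=> [n [N [j [galN dimN jb [y _ <-]]]]].
have p0 : p%:R != 0 :> F by exact: vunit_neq0 nVp.
have pK0 : p%:R != 0 :> K by rewrite -(rmorph_nat f) fmorph_eq0.
have nYp : ~ vmax Y p%:R by rewrite -(rmorph_nat f) (extends_vmax _ VY).
have [|z zp] := closed_primitive_root cl p_pr; first by rewrite -(rmorph_nat g) fmorph_eq0.
have [E [phi [jE [G [zE [jphi jz fz]]]]]] := mup_extension_in g p_pr pK0 zp.
have zEp : p.-primitive_root zE by rewrite -(fmorph_primitive_root jE) jz.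
pose W := vr_pull jE B; have WB : extends jE W B := vr_pull_extends jE B.
have YW : extends phi Y W := extends_pull_comp jphi YB.
have nWp : ~ vmax W p%:R by rewrite -(rmorph_nat phi) (extends_vmax _ YW).
have Wz : vr_set W zE := mup_vr W p_pr zEp.
have Ez : rsd W zE = mup_res W p_pr zEp by exact: rsdE.
pose zeta := residue_map WB (rsd W zE).
have zeta_p : p.-primitive_root zeta.
  by rewrite fmorph_primitive_root Ez; exact: mup_res_prim YW p_pr nYp zEp.
have [s [m [hs hm hs0 _]]] := mup_exponents G p_pr zEp.
have kphi := residue_map_comp YW WB YB jphi.
have kE (A : {poly residue Y}) u :
    residue_map WB (map_poly (residue_map YW) A).[u] = (map_poly (residue_map YB) A).[residue_map WB u].
  by rewrite -horner_map -map_poly_comp (eq_map_poly kphi).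
have s1 : (s 1%g = 1 %[mod p])%N.
  by apply/eqP; rewrite -(eq_prim_root_expr zEp) -hs gact1.
have pB : p%:R != 0 :> residue B.
  by apply/negP => /residue_natr; rewrite -(rmorph_nat g) (extends_vmax _ YB).
pose D := residue_act YW (mup_nT YW p_pr nYp zEp fz).
have fD : faithful_at D (rsd W zE) by rewrite Ez; exact: mup_residue_faithful.
have := p_galois_descent galN p_pr pB jb zeta_p kphi (D := D) _ _ dimN y.
have coD (t : gact_grp D) : coprime #[t]%g p.
  by rewrite (mup_card_coprime <[t]>%G p_pr _ fD) // -(fmorph_primitive_root (residue_map WB)).
move=> /(_ coD)[]; last by move=> u ->; exists u.
move=> alpha A aper aA aA' e _.
have [a ha] := rsd_horner YW A.
have WX i : vr_set W (zE ^+ i) by exact: vrX.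
have Er i : residue_map WB (rsd W (map_poly phi a).[zE ^+ i]) = (map_poly (residue_map YB) A).[zeta ^+ i].
  by rewrite (ha _ (WX i)).2 rsdX // kE rmorphXn.
have Es1 : alpha (e * s 1%g)%N = alpha e.
  by apply: aper; rewrite -modnMmr s1 modnMmr muln1.
rewrite -Es1; apply: (kummer_descent p_pr p0 cl rg jphi zEp fz hs hm nWp
  (alpha := fun t => alpha (e * s t)%N) (ha _ (WX e)).1).
- by rewrite Er Es1 aA.
- move=> t _; rewrite aA -Er; congr (residue_map WB (rsd W _)).
  rewrite -[RHS]horner_map -map_poly_comp (eq_map_poly (gact_base t)).
  by rewrite rmorphXn hs -exprM mulnC.
- move=> t _; rewrite Es1; have [|A' ->] := aA' e (s t) (m t).
    by apply/modn_Fp => //; rewrite natrM hm mulfV.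
  by exists (map_poly (residue_map YW) A').[rsd W zE ^+ e]; rewrite kE rmorphXn.
Qed.

End ResidueLift.

Section MaxPExtension.
Variables (p : nat) (F K : fieldType) (f : {rmorphism F -> K}).
Variables (V : valuation_ring F) (Y : valuation_ring K) (VY : extends f V Y).
Hypotheses (p_pr : prime p) (nVp : ~ vmax V p%:R) (maxf : is_max_p_extension p f).

Lemma max_p_residue : is_max_p_extension p (residue_map VY).
Proof.
have [Omega [g [cl rg]]] := maxf.
have [B YB] := vr_extension_exists g Y.
have cl' := @residue_closed _ B cl.
exists (residue B), (residue_map YB); split=> //.
rewrite p_compositumE //; apply/seteqP; split=> [_ [r _ <-]|x].
  apply: p_element_comp (max_p_residue_element VY p_pr nVp cl rg r) => a //.
by move=> /(p_residue_lift p_pr nVp cl rg)[y ->]; exists y.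
Qed.

Lemma value_map_bij (K1 K2 : fieldType) (h : {rmorphism K1 -> K2}) (W1 : valuation_ring K1)
    (W2 : valuation_ring K2) (W12 : extends h W1 W2) :
  (forall x : K2, x != 0 -> exists2 y : K1, vr_set W2 (h y / x) & ~ vmax W2 (h y / x)) ->
  bijective (value_map W12).
Proof.
move=> sur; have /choice[r hr] : forall d, exists e, value_map W12 e = d.
  elim/value_ind=> x; have [y Wy ny] := sur (val x) (nonzero_neq0 x).
  have y0 : y != 0 by apply: contra_not_neq ny => ->; rewrite rmorph0 mul0r; exact: vmax0.
  exists (value W1 (Nonzero y0)); rewrite value_mapE; apply/value_eqP => /=; split=> //.
  by rewrite -invf_div; exact: vunit_inv.
by exists r => // e; apply: (@value_map_inj _ _ _ _ _ W12); rewrite hr.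
Qed.

Lemma max_p_value_bij : ~ has_mup p [set: residue V] -> bijective (value_map VY).
Proof.
move=> nm; have [Omega [g [cl rg]]] := maxf.
by apply: value_map_bij => x; exact: (max_p_value_surj VY p_pr nVp cl rg).
Qed.

End MaxPExtension.

(** * Value groups tensored with Z[1/p] *)

Lemma zmod_morphismMz (A B : zmodType) (h : A -> B) : zmod_morphism h ->
  forall x (n : int), h (x *~ n) = h x *~ n.
Proof.
move=> hB; pose r : {additive A -> B} := HB.pack h (GRing.isZmodMorphism.Build A B h hB).
by move=> x n; exact: (raddfMz r n x).
Qed.

Section ZinvTensor.
Variables (p : nat) (A B : zmodType) (i : {additive A -> B}).
Hypotheses (p_gt0 : (0 < p)%N) (i_inj : injective i).
Hypothesis divB : forall b : B, exists c, b = c *+ p.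
Hypothesis torB : forall b : B, b *+ p = 0 -> b = 0.
Hypothesis genB : forall b : B, exists m a, b *+ (p ^ m) = i a.

Let torX n (b : B) : b *+ (p ^ n) = 0 -> b = 0.
Proof. by elim: n b => [|n IH] b //; rewrite expnS mulrnA => /IH/torB. Qed.

Let cancelX n (b c : B) : b *+ (p ^ n) = c *+ (p ^ n) -> b = c.
Proof. by move=> /eqP; rewrite -subr_eq0 -mulrnBl => /eqP/torX/eqP; rewrite subr_eq0 => /eqP. Qed.

Let divX n (b : B) : exists c, c *+ (p ^ n) = b.
Proof.
elim: n b => [|n IH] b; first by exists b.
have [c ->] := divB b; have [d <-] := IH c; exists d.
by rewrite expnSr mulrnA.
Qed.

Let pn0 n : p%:R ^+ n != 0 :> rat.
Proof. by rewrite expf_neq0 // Num.Theory.pnatr_eq0 -lt0n. Qed.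

Lemma Zinv_fraction (z : Zinv p) : exists (a : int) (n : nat), val z = a%:~R / p%:R ^+ n.
Proof. exact: (set_mem (valP z)). Qed.

Definition Zinv_pow n : Zinv p :=
  ZinvElem (mem_set (ex_intro _ 1 (ex_intro _ n erefl)) : 1%:~R / p%:R ^+ n \in Zinv_pred p).

Lemma Zinv_powD m n : Zinv_pow (m + n) *+ (p ^ n) = Zinv_pow m.
Proof.
apply: val_inj; rewrite rmorphMn /= -[_ *+ _]mulr_natr natrX exprD invfM mulrA divfK //.
Qed.

Lemma Zinv_powE (z : Zinv p) a n : val z = a%:~R / p%:R ^+ n -> z = Zinv_pow n *~ a.
Proof. by move=> E; apply: val_inj; rewrite rmorphMz E /= -[RHS]mulrzl div1r. Qed.

(** For z = a / p^n the value is the quotient of a x by p^n in B, which exists by divisibility and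
    is unique without p-torsion. Quantifying over all fractions equal to z makes independence of the
    fraction part of the construction. *)
Lemma Zinv_tensor_map : exists t : Zinv p -> A -> B,
  forall z x a n, val z = a%:~R / p%:R ^+ n -> t z x *+ (p ^ n) = i x *~ a.
Proof.
suff /choice[t ht] : forall zx : Zinv p * A, exists y, forall a n,
    val zx.1 = a%:~R / p%:R ^+ n -> y *+ (p ^ n) = i zx.2 *~ a.
  by exists (fun z x => t (z, x)) => z x a n; exact: (ht (z, x)).
move=> [z x] /=; have [a0 [n0 E0]] := Zinv_fraction z.
have [y Ey] := divX n0 (i x *~ a0); exists y => a n E; apply: (@cancelX n0).
have Ea : a * (p ^ n0)%N%:Z = a0 * (p ^ n)%N%:Z.
  apply: (@intr_inj rat); rewrite !rmorphM /= -!pmulrn !natrX.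
  by apply/eqP; rewrite -eqr_div ?pn0 // -E -E0.
by rewrite -!mulrnA mulnC mulrnA Ey !pmulrn -!mulrzA -Ea.
Qed.

Lemma Zinv_tensor : is_Zinv_tensor p i.
Proof.
have [t ht] := Zinv_tensor_map.
have valX n : val (Zinv_pow n) = 1%:~R / p%:R ^+ n by [].
have tP (m : nat) (b : B) a : b *+ (p ^ m) = i a -> b = t (Zinv_pow m) a.
  by move=> E; apply: (@cancelX m); rewrite E (ht _ _ 1 m) ?mulr1z.
exists t; split; last first.
  move=> x; rewrite -[RHS](mulr1n) -(expn0 p).
  by rewrite -[LHS](mulr1n) -{1}(expn0 p) (ht _ _ 1 0%N) ?divr1 ?mulr1z.
split; first split.
- move=> z x y; have [a [n E]] := Zinv_fraction z; apply: (@cancelX n).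
  by rewrite mulrnBl !(ht _ _ _ _ E) -mulrzBl -raddfB.
- move=> x z z'; have [a [n E]] := Zinv_fraction z; have [a' [n' E']] := Zinv_fraction z'.
  have com (c : int) m l : c%:~R / p%:R ^+ m = (c * (p ^ l)%N%:Z)%:~R / p%:R ^+ (m + l) :> rat.
    by rewrite rmorphM /= -pmulrn natrX exprD invfM mulrA mulrAC mulfK.
  rewrite (com _ _ n) addnC in E'; rewrite (com _ _ n') in E; apply: (@cancelX (n + n')).
  rewrite mulrnBl (ht _ _ _ _ E) (ht _ _ _ _ E') -mulrzBr; apply: ht.
  by have -> : val (z - z') = val z - val z' by []; rewrite E E' -mulrBl -rmorphB.
move=> U b [b1 b2].
have bMz z x (n : int) : b z (x *~ n) = b (z *~ n) x.
  by rewrite (zmod_morphismMz (b1 z)) (zmod_morphismMz (b2 x)).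
(* An e with p^m e = i a can only be the tensor of 1 / p^m and a. Two such presentations agree by
   injectivity of i. *)
have /choice[h hE] : forall e, exists u, forall m a, e *+ (p ^ m) = i a -> u = b (Zinv_pow m) a.
  move=> e; have [m [a E]] := genB e; exists (b (Zinv_pow m) a) => m' a' E'.
  have Ea : a *~ (p ^ m')%N = a' *~ (p ^ m)%N.
    by apply: i_inj; rewrite !raddfMz -E -E' -!pmulrn -!mulrnA mulnC.
  by rewrite -(Zinv_powD m m') -(Zinv_powD m' m) addnC !pmulrn -!bMz Ea.
have hP : zmod_morphism h.
  move=> e e'; have [m [a E]] := genB e; have [m' [a' E']] := genB e'.
  have E1 : e *+ (p ^ (m + m')) = i (a *+ (p ^ m')) by rewrite expnD mulrnA E raddfMn.
  have E1' : e' *+ (p ^ (m + m')) = i (a' *+ (p ^ m)) by rewrite addnC expnD mulrnA E' raddfMn.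
  have E2 : (e - e') *+ (p ^ (m + m')) = i (a *+ (p ^ m') - a' *+ (p ^ m)).
    by rewrite mulrnBl E1 E1' raddfB.
  by rewrite (hE _ _ _ E1) (hE _ _ _ E1') (hE _ _ _ E2) b1.
exists h; split.
  split=> // z x; have [a [n E]] := Zinv_fraction z.
  rewrite (hE _ n (x *~ a)); first by rewrite bMz -(Zinv_powE E).
  by rewrite (ht _ _ _ _ E) raddfMz.
move=> h' [_ h't]; apply: funext => e; have [m [a E]] := genB e.
by rewrite (hE _ _ _ E) (tP _ _ _ E) h't.
Qed.

End ZinvTensor.

(** * Divisibility by p of the values of F(p) *)

Section PDivisible.
Variables (p : nat) (F K Omega : fieldType) (f : {rmorphism F -> K}) (g : {rmorphism K -> Omega}).
Variables (V : valuation_ring F) (Y : valuation_ring K) (VY : extends f V Y).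
Hypotheses (p_pr : prime p) (nVp : ~ vmax V p%:R) (cl : GRing.closed_field_axiom Omega).
Hypothesis rg : range g = p_compositum p (g \o f).
(** For V/P in the role of V this is the maximality of P: over every nontrivial coarsening, V/P
    itself included, the residue field has p-th roots of unity coming from the ring. *)
Hypothesis mu : forall U : valuation_ring F, vr_set V `<=` vr_set U ->
  (exists x, ~ vr_set U x) ->
  exists z, [/\ vr_set V z, vmax U (z ^+ p - 1) & ~ vmax U (z - 1)].

Lemma galois_act_vr (k M : fieldType) (h : {rmorphism k -> M}) (G : galois_act h)
    (U : valuation_ring M) x : (forall a, vr_set U (h a)) -> vr_set U x.
Proof.
move=> hU; have [q Eq] := gact_charpoly (f := h) G x.
apply: (@vr_root_monic _ U (map_poly h q)).
- by rewrite Eq; exact: monic_prod_XsubC.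
- by move=> i; rewrite coef_map; exact: hU.
rewrite Eq /root horner_prod (bigD1 1%g) //= gact1 !hornerE subrr mul0r //.
Qed.

Lemma max_p_vr (U : valuation_ring K) x : (forall a, vr_set U (f a)) -> vr_set U x.
Proof.
move=> fU; have [N [j [n [galN _ jb [y <-]]]]] := p_compositum_subextension x p_pr cl rg.
suff : vr_set (vr_pull j U) y by [].
by apply: (galois_act_vr (gal_act galN)) => a; rewrite /= jb.
Qed.

Section Mup.
Variables (E : fieldType) (phi : {rmorphism K -> E}) (G : galois_act phi) (z : E).
Variables (W : valuation_ring E) (YW : extends phi Y W).
Hypotheses (zp : p.-primitive_root z) (fz : faithful_at G z).

(* Modulo a proper overring U of W the roots of unity come from V, so they are fixed by t. *)
Lemma mup_overring_trivial (U : valuation_ring E) (t : gact_grp G) :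
  vr_set W `<=` vr_set U -> t \in gstab G U -> t != 1%g -> forall e, vr_set U e.
Proof.
move=> WU tU t1.
have [[x nx]|allU] := pselect (exists x, ~ vr_set U (phi (f x))); last first.
  move=> e; apply: (galois_act_vr G) => a; rewrite -[vr_set U _]/(vr_set (vr_pull phi U) a).
  apply: max_p_vr => b; rewrite /=; apply: contrapT => nb; apply: allU.
  by exists b.
have [||w [Vw wp w1]] := mu (U := vr_pull f (vr_pull phi U)).
- by move=> a Va /=; apply: WU; apply/(extendsE YW)/(extendsE VY).
- by exists x.
have Ww : vr_set W (phi (f w)) by apply/(extendsE YW)/(extendsE VY).
have nUp : ~ vmax U p%:R.
  by move/(vmax_subr WU); rewrite -(rmorph_nat phi) (extends_vmax _ YW) -(rmorph_nat f) (extends_vmax _ VY).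
have Up := vr_pull_extends phi U.
have nUp' : ~ vmax (vr_pull phi U) p%:R by rewrite vmax_pull rmorph_nat.
have vp : p.-primitive_root (rsd U (phi (f w))).
  apply/(prime_primitive_root p_pr); split.
    rewrite -rsdX; last exact: WU.
    rewrite -[RHS](rsd1 U); apply/rsdP; [by apply: vrX; exact: WU|exact: vr1|].
    by move: wp; rewrite !vmax_pull !rmorphB !rmorphXn !rmorph1.
  rewrite -[X in _ <> X](rsd1 U) => /rsdP h; apply: w1; rewrite !vmax_pull !rmorphB !rmorph1.
  by apply: h; [exact: WU|exact: vr1].
have Uz : vr_set U z by exact: mup_vr U p_pr zp.
have zU : rsd U z ^+ p = rsd U 1 ^+ p by rewrite -!rsdX ?expr1n ?(prim_expr_order zp) //; exact: vr1.
have [|i Ei] := unity_root_power vp _ zU; first by rewrite rsd1 oner_neq0.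
have mz : vmax U (z - phi (f w) ^+ i).
  apply/rsdP => //; first by apply: vrX; exact: WU.
  by rewrite Ei rsd1 mulr1 rsdX //; exact: WU.
have [s [m [hs _ _ _]]] := mup_exponents G p_pr zp.
have mtz : vmax U (gact t z - phi (f w) ^+ i).
  by move/(gstab_vmax _ tU): mz; rewrite rmorphB rmorphXn gact_base.
move: (vmax_trans mtz (vmaxBC mz)); rewrite hs -[X in _ - X]expr1.
move=> /(mup_vmax_inj Up p_pr nUp' zp); rewrite -hs expr1 => /fz tE.
by rewrite tE eqxx in t1.
Qed.

(* With u = 1 mod W and u/x = 0 mod the other conjugates of W, the product over t of
   t(b)^(n t), for b = x + \sum_(t != 1) t(u), is a p-th power of the same value as x^(n 1). *)
Lemma mup_value_divisible (j : {rmorphism E -> Omega}) (x : K) :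
  (forall a, j (phi a) = g a) -> x != 0 -> vmax Y x ->
  exists2 c : E, c != 0 & vr_set W (phi x / c ^+ p) /\ ~ vmax W (phi x / c ^+ p).
Proof.
move=> jphi x0 mx; set y := phi x.
have y0 : y != 0 by rewrite fmorph_eq0.
have my : vmax W y by apply/(extends_vmax _ YW).
have Wy := vmax_sub my.
have ntr (t : gact_grp G) : t != 1%g -> t \notin gstab G W.
  move=> t1; apply/negP => tW.
  exact: (vmax_invN my y0) (mup_overring_trivial (fun _ h => h) tW t1 y^-1).
have [|||u [u1 hu]] := @approximation _ W (gact_grp G) (fun t => t != 1%g)
    (fun t => vr_pull (gact t) W) (fun=> y^-1).
- by move=> t /ntr ni /gact_pull_sub; exact/negP.
- by move=> t /ntr ni /gact_pull_sup; exact/negP.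
- move=> t U t1 WU WtU; have tU := gstab_common_overring WU WtU.
  exact: mup_overring_trivial WU tU t1 _.
have hu' (t : gact_grp G) : t != 1%g -> vmax W (gact t u / y).
  by move=> /hu[_]; rewrite vmax_pull rmorphM -fmorphV gact_base fmorphV.
pose b := y + \sum_(t : gact_grp G | t != 1%g) gact t u.
have by1 : vmax W (b / y - 1).
  rewrite mulrDl divff // addrC addKr mulr_suml; apply: vmax_sum => t t1; exact: hu'.
(* Among the terms of t b, the one with index t^-1 is u, congruent to 1; all the others are
   small. *)
have bt (t : gact_grp G) : t != 1%g -> vmax W (gact t b - 1).
  move=> t1; rewrite rmorphD gact_base rmorph_sum (bigD1 t^-1%g) ?invg_eq1 //=.
  rewrite -gactM mulVg gact1 addrCA addrAC; apply: vmaxD => //; apply: vmaxD => //.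
  apply: vmax_sum => s /andP[s1 st]; rewrite -gactM.
  rewrite -[X in vmax W X](divfK y0); apply: vmaxMr => //; apply: hu'.
  by apply: contra st => /eqP h; rewrite -(mulgK t s) h mul1g.
have nb (t : gact_grp G) : t != 1%g -> vr_set W (gact t b) /\ ~ vmax W (gact t b).
  move=> /bt h; split; first by apply: vr_cong h _; exact: vr1.
  by move=> m; apply: (@vmax1 _ W); exact: vmax_cong h m.
have nby : ~ vmax W (b / y) by move=> m; apply: (@vmax1 _ W); exact: vmax_cong by1 m.
have Wby : vr_set W (b / y) by apply: vr_cong by1 _; exact: vr1.
have b0 : b != 0 by apply: contra_not_neq nby => ->; rewrite mul0r; exact: vmax0.
have [s [n [hs hn _ _]]] := mup_exponents G p_pr zp.
have p0 : p%:R != 0 :> F by exact: vunit_neq0 nVp.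
have [c Ec] := kummer_pth_power p_pr p0 cl rg jphi zp fz hs hn b0.
have n1 : (n 1%g = 1 %[mod p])%N.
  apply/modn_Fp => //; rewrite hn -[RHS]invr1; congr (_^-1).
  apply/(modn_Fp p_pr _ 1)/eqP; by rewrite -(eq_prim_root_expr zp) -hs gact1.
set m := (n 1%g %/ p)%N; have En1 : n 1%g = (m * p + 1)%N.
  by rewrite {1}(divn_eq (n 1%g) p) n1 modn_small // prime_gt1.
set r := \prod_(t : gact_grp G | t != 1%g) gact t b ^+ n t.
have [Wr nr] : vr_set W r /\ ~ vmax W r.
  rewrite /r; elim/big_ind: _ => [|a a' [Wa na] [Wa' na']|t /nb[Wt nt]].
  - by split; [exact: vr1|exact: vmax1].
  - by split; [exact: vrM|exact: vunitM].
  - by split; [exact: vrX|move=> /(vmaxX Wt)].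
have Er : c ^+ p = b ^+ n 1%g * r by rewrite -Ec (bigD1 1%g) //= gact1.
have c0 : c != 0.
  have : c ^+ p != 0 by rewrite Er mulf_neq0 ?expf_neq0 //; exact: vunit_neq0 nr.
  by rewrite expf_eq0 prime_gt0.
(* The value of [c ^+ p] is that of y^(m p + 1); dividing c by y^m leaves the value of y. *)
exists (c / y ^+ m); first by rewrite mulf_neq0 ?invr_eq0 ?expf_neq0.
have -> : y / (c / y ^+ m) ^+ p = ((b / y) ^+ n 1%g * r)^-1.
  by rewrite expr_div_n Er -exprM invf_div mulrA -exprS -addn1 -En1 expr_div_n mulrAC invf_div.
have [Wq nq] : vr_set W ((b / y) ^+ n 1%g * r) /\ ~ vmax W ((b / y) ^+ n 1%g * r).
  by split; [apply: vrM => //; exact: vrX|apply: vunitM => //; [exact: vrX|move/(vmaxX Wby)]].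
split; first exact: vunit_inv.
move=> mi; apply: (vmax_invN mi _); last by rewrite invrK.
by rewrite invr_eq0; exact: vunit_neq0 nq.
Qed.

End Mup.

(** The p-th root of the value found in F(p)(mu_p) is already a value of F(p), by [mup_value_surj].
    Inverting x reduces to x in the maximal ideal. *)
Lemma max_p_value_divisible (x : K) : x != 0 ->
  exists2 c : K, c != 0 & vr_set Y (x / c ^+ p) /\ ~ vmax Y (x / c ^+ p).
Proof.
move=> x0; wlog mx : x x0 / vmax Y x.
  have [mx|nx] := pselect (vmax Y x); first by apply.
  have [Yx _|/vmax_inv mx H] := pselect (vr_set Y x).
    by exists 1; rewrite ?oner_neq0 // expr1n divr1.
  have [|c c0 [Yc nc]] := H x^-1 _ mx; first by rewrite invr_eq0.
  exists c^-1; first by rewrite invr_eq0.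
  rewrite exprVn invrK (_ : x * c ^+ p = (x^-1 / c ^+ p)^-1); last by rewrite invfM !invrK.
  split; first exact: vunit_inv.
  move=> mi; apply: (vmax_invN mi _); last by rewrite invrK.
  by rewrite invr_eq0; exact: vunit_neq0 nc.
have p0 : p%:R != 0 :> F by exact: vunit_neq0 nVp.
have pK0 : p%:R != 0 :> K by rewrite -(rmorph_nat f) fmorph_eq0.
have nYp : ~ vmax Y p%:R by rewrite -(rmorph_nat f) (extends_vmax _ VY).
have [B YB] := vr_extension_exists g Y.
have [|z zp] := closed_primitive_root cl p_pr; first by rewrite -(rmorph_nat g) fmorph_eq0.
have [E [phi [jE [G [zE [jphi jz fz]]]]]] := mup_extension_in g p_pr pK0 zp.
have zEp : p.-primitive_root zE by rewrite -(fmorph_primitive_root jE) jz.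
have YW : extends phi Y (vr_pull jE B) := extends_pull_comp jphi YB.
have [c c0 [Wc nc]] := mup_value_divisible YW zEp fz jphi x0 mx.
have [y Wy ny] := mup_value_surj YW p_pr nYp zEp fz c0.
exists y; first by apply: contra_not_neq ny => ->; rewrite rmorph0 mul0r; exact: vmax0.
have E1 : phi (x / y ^+ p) = phi x / c ^+ p * (phi y / c)^-1 ^+ p.
  by rewrite fmorph_div rmorphXn invf_div expr_div_n mulrA divfK ?expf_neq0.
have Wi := vunit_inv ny.
have ni : ~ vmax (vr_pull jE B) (phi y / c)^-1.
  move=> mi; apply: (vmax_invN mi _); last by rewrite invrK.
  by rewrite invr_eq0; exact: vunit_neq0 ny.
split; first by apply/(extendsE YW); rewrite E1; apply: vrM => //; exact: vrX.
move/(extends_vmax _ YW); rewrite E1; apply: vunitM => //; first exact: vrX.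
by move/(vmaxX Wi).
Qed.

End PDivisible.

Lemma value_natmul (K : fieldType) (W : valuation_ring K) (x y : nonzero K) n :
  value W x *+ n = value W y <->
  vr_set W (val x ^+ n / val y) /\ vr_set W (val y / val x ^+ n).
Proof.
pose xn m := Nonzero (expf_neq0 m (nonzero_neq0 x)).
suff -> : value W x *+ n = value W (xn n) by exact: value_eqP.
elim: n => [|n IH]; first by congr value; exact: val_inj.
by rewrite mulrS IH -valueM; congr value; apply: val_inj; rewrite /= exprS.
Qed.

Lemma value_torsion_free (K : fieldType) (W : valuation_ring K) (n : nat) (d : value_group W) :
  (0 < n)%N -> d *+ n = 0 -> d = 0.
Proof.
elim/value_ind: d => x n0 /value_natmul[]; rewrite /= divr1 div1r -exprVn => h1 h2.
apply/value_eqP; rewrite /= divr1 div1r.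
by split; [apply: vr_of_exp h1|apply: vr_of_exp h2].
Qed.

Section MaxPZinv.
Variables (p : nat) (F K : fieldType) (f : {rmorphism F -> K}).
Variables (V : valuation_ring F) (Y : valuation_ring K) (VY : extends f V Y).
Hypotheses (p_pr : prime p) (nVp : ~ vmax V p%:R) (maxf : is_max_p_extension p f).

Lemma max_p_value_Zinv :
  (forall U : valuation_ring F, vr_set V `<=` vr_set U -> (exists x, ~ vr_set U x) ->
     exists z, [/\ vr_set V z, vmax U (z ^+ p - 1) & ~ vmax U (z - 1)]) ->
  is_Zinv_tensor p (value_map VY).
Proof.
move=> mu; have [Omega [g [cl rg]]] := maxf.
apply: Zinv_tensor; first exact: prime_gt0.
- exact: value_map_inj.
- elim/value_ind=> x.
  have [c c0 [Yc nc]] := max_p_value_divisible VY p_pr nVp cl rg mu (nonzero_neq0 x).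
  exists (value Y (Nonzero c0)); apply/esym/value_natmul; split=> //=.
  by rewrite -invf_div; exact: vunit_inv.
- by move=> d; apply: value_torsion_free; exact: prime_gt0.
elim/value_ind=> x; have [m [y [Yy ny]]] := max_p_value_torsion VY p_pr nVp cl rg (nonzero_neq0 x).
have y0 : y != 0 by apply: contra_not_neq ny => ->; rewrite rmorph0 mul0r; exact: vmax0.
exists m, (value V (Nonzero y0)); rewrite [RHS]value_mapE; apply/value_natmul; split=> //=.
by rewrite -invf_div; exact: vunit_inv.
Qed.

End MaxPZinv.

(** * Localization at P and the quotient V/P *)

Section Localization.
Variables (p : nat) (F : fieldType) (V : valuation_ring F) (P : prime_ideal V).
Hypotheses (p_pr : prime p) (nVp : ~ vmax V p%:R).

Let R := localize P.
Let VR : vr_set V `<=` vr_set R.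
Proof. by move=> x; exact: localize_sub. Qed.

Lemma localize_natr : ~ vmax R p%:R.
Proof. by move/(vmax_subr VR). Qed.

Lemma quotient_vr_rsd x : vr_set V x -> vr_set (quotient_vr P) (rsd R x).
Proof. by move=> Vx; exists (vr_elem (VR Vx)) => //; rewrite (rsdE (VR Vx)). Qed.

Lemma quotient_vr_natr : ~ vmax (quotient_vr P) p%:R.
Proof.
have p0 := vunit_neq0 nVp; have Vi := vunit_inv nVp.
move=> m; apply: (@vmax1 _ (quotient_vr P)).
have Rp : rsd R p%:R = p%:R.
  by rewrite (rsdE (VR (vr_nat V p))) -(rmorph_nat (@res _ R)); apply/res_eqP; rewrite rmorph_nat subrr; exact: vmax0.
have -> : 1 = p%:R * rsd R p%:R^-1.
  by rewrite -Rp -rsdM; [rewrite divff ?rsd1|exact: (VR (vr_nat V p))|exact: VR].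
by apply: vmaxMr; [exact: quotient_vr_rsd|].
Qed.

Lemma has_mup_localize : has_mup p [set: residue R] -> has_mup p (quotient_vr P).
Proof.
move=> [z _ zp]; exists z => //; apply: (@vr_of_exp _ _ _ p); first exact: prime_gt0.
by rewrite (prim_expr_order zp); exact: vr1.
Qed.

(* The elements of V whose class lies in the maximal ideal of U form a prime ideal
   strictly containing P. *)
Lemma mup_prime_overring (U : valuation_ring (residue R)) : is_mup_prime p P ->
  vr_set (quotient_vr P) `<=` vr_set U -> (exists x, ~ vr_set U x) ->
  exists z, [/\ vr_set (quotient_vr P) z, vmax U (z ^+ p - 1) & ~ vmax U (z - 1)].
Proof.
move=> [_ maxP] VU [r nr].
have rsdB x y : vr_set V x -> vr_set V y -> rsd R (x - y) = rsd R x - rsd R y.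
  move=> /VR Rx /VR Ry; rewrite (rsdE Rx) (rsdE Ry) (rsdE (vrB Rx Ry)) -(rmorphB (@res _ R)).
  by apply/res_eqP; rewrite rmorphB subrr; exact: vmax0.
have rsd0 : rsd R 0 = 0 by apply/(rsd_eq0 (vr0 R))/vmax0.
have Urs x : vr_set V x -> vr_set U (rsd R x) by move=> /quotient_vr_rsd/VU.
pose P' : set F := [set x | vr_set V x /\ vmax U (rsd R x)].
have P'V : P' `<=` V by move=> x [].
have P'0 : P' 0 by split; [exact: vr0|rewrite rsd0; exact: vmax0].
have P'D x y : P' x -> P' y -> P' (x + y).
  move=> [Vx mx] [Vy my]; split; first exact: vrD.
  have -> : rsd R (x + y) = rsd R x - (rsd R 0 - rsd R y).
    by rewrite -rsdB ?sub0r -?rsdB ?opprK //; [exact: vrN|exact: vr0].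
  by rewrite rsd0 sub0r opprK; exact: vmaxD.
have P'M x y : vr_set V x -> P' y -> P' (x * y).
  move=> Vx [Vy my]; split; first exact: vrM.
  by rewrite rsdM; [apply: vmaxMl => //; exact: Urs|exact: VR|exact: VR].
have P'1 : ~ P' 1 by move=> [_]; rewrite rsd1; exact: vmax1.
have P'P x y : vr_set V x -> vr_set V y -> P' (x * y) -> P' x \/ P' y.
  move=> Vx Vy [_]; rewrite rsdM; [|exact: VR|exact: VR].
  by move=> /vmax_prime[]; [exact: Urs|exact: Urs|left|right].
pose I := @PrimeIdeal F V P' P'V P'0 P'D P'M P'1 P'P.
have [/(has_mup_quotient p_pr)[z [Vz [_ z1] z2]]|nI] := pselect (has_mup p (quotient_vr I)).
  have Rz := VR Vz; exists (rsd R z); split; first exact: quotient_vr_rsd.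
    by rewrite -rsdX // -(rsd1 R) -rsdB //; [exact: vrX|exact: vr1].
  rewrite -(rsd1 R) -rsdB //; last exact: vr1.
  by move=> m; apply: z2; split=> //; apply: vrB => //; exact: vr1.
exfalso; have mi := vmax_inv nr.
have [x0 [Rx Ex]] : exists x, vr_set V x /\ r^-1 = rsd R x.
  have : vr_set (quotient_vr P) r^-1 by apply: vmax_sub; apply: vmax_subr VU _ mi.
  by move=> [x Vx <-]; exists (val x); split=> //; rewrite (rsdE (VR Vx)); apply/res_eqP; rewrite subrr; exact: vmax0.
have Px : pi_set P x0 by apply: (maxP I nI); split=> //; rewrite -Ex.
have := (quotient_kernel (P := P) (x := vr_elem (VR Rx)) Rx).2 Px.
rewrite -rsdE -Ex => /eqP; rewrite invr_eq0 => /eqP r0.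
by apply: nr; rewrite r0; exact: vr0.
Qed.

End Localization.

Section LocalizedExtension.
Variables (p : nat) (F K : fieldType) (f : {rmorphism F -> K}).
Variables (V : valuation_ring F) (Y : valuation_ring K) (VY : extends f V Y).
Variables (P : prime_ideal V) (Q : prime_ideal Y) (PQ : lies_over f P Q).
Hypotheses (p_pr : prime p) (nVp : ~ vmax V p%:R) (maxf : is_max_p_extension p f).
Hypothesis mupP : is_mup_prime p P.

Lemma localize_value_bij : bijective (value_map (localize_extends VY PQ)).
Proof.
apply: (max_p_value_bij _ p_pr _ maxf); first exact: localize_natr.
by move=> /(has_mup_localize p_pr); case: mupP.
Qed.

(** The residue field of Y_Q is the maximal p-extension of that of V_P, by [max_p_residue] for the
    localizations, so the result on value groups applies to V/P there. *)
Lemma quotient_value_Zinv : is_Zinv_tensor p (value_map (quotient_extends VY PQ)).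
Proof.
apply: (max_p_value_Zinv _ p_pr).
- exact: quotient_vr_natr.
- by apply: max_p_residue => //; exact: localize_natr.
- by move=> U; exact: mup_prime_overring.
Qed.

End LocalizedExtension.

(** Exponents realized over F(p) are realized over F because polynomials over F are polynomials over
    F(p); the converse is [conj_root_p_compositum]. Both are compared at a root of unity in
    Omega. *)
Lemma conj_root_max_p (p : nat) (F K L J : fieldType) (h : {rmorphism F -> K})
    (f1 : {rmorphism F -> L}) (f2 : {rmorphism K -> J}) (z1 : L) (z2 : J) (s : nat) :
  prime p -> p%:R != 0 :> F -> is_max_p_extension p h ->
  p.-primitive_root z1 -> p.-primitive_root z2 ->
  conj_root f1 z1 s <-> conj_root f2 z2 s.
Proof.
move=> p_pr p0 [Omega [g [cl rg]]] zp1 zp2.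
have [|z zp] := closed_primitive_root cl p_pr.
  by rewrite -(rmorph_nat (g \o h)) fmorph_eq0.
split=> [c|/(conj_root_indep (f' := g) p_pr zp2 zp) c].
  have c' := conj_root_indep (f' := g \o h) p_pr zp1 zp c.
  exact: conj_root_indep p_pr zp zp2 (conj_root_p_compositum p_pr p0 cl rg zp c').
apply: (conj_root_indep (f := g \o h) p_pr zp zp1) => q.
by rewrite map_poly_comp; exact: c.
Qed.

Section MupOverMaxP.
Variables (p : nat) (F L K J : fieldType).
Variables (iL : {rmorphism F -> L}) (h : {rmorphism F -> K}) (iJ : {rmorphism K -> J}).
Variables (V : valuation_ring F) (Y : valuation_ring K) (VY : extends h V Y).
Hypotheses (p_pr : prime p) (nVp : ~ vmax V p%:R).

(** [conj_root_max_p] serves twice: for F and F(p), and for their residue fields, which form a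
    maximal p-extension by [max_p_residue]. *)
Lemma mup_extensions_max_p : is_mup_extension p iL -> is_max_p_extension p h ->
  is_mup_extension p iJ -> [set W | extends iL V W] #= [set Z | extends iJ Y Z].
Proof.
move=> mL maxh mJ.
have p0 : p%:R != 0 :> F by exact: vunit_neq0 nVp.
have pK0 : p%:R != 0 :> K by rewrite -(rmorph_nat h) fmorph_eq0.
have nYp : ~ vmax Y p%:R by rewrite -(rmorph_nat h) (extends_vmax _ VY).
have [GL [zL [zLp fL]]] := mup_extension_act p_pr p0 mL.
have [GJ [zJ [zJp fJ]]] := mup_extension_act p_pr pK0 mJ.
have [W VW] := vr_extension_exists iL V; have [Z YZ] := vr_extension_exists iJ Y.
apply: (@mup_extensions_card_eq p _ _ _ _ iL iJ GL GJ zL zJ V Y W Z VW YZ p_pr zLp zJp nVp nYp fL fJ) => s.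
  exact: conj_root_max_p maxh zLp zJp.
apply: conj_root_max_p (max_p_residue VY p_pr nVp maxh) _ _ => //.
- by apply/negP => /residue_natr.
- exact: mup_res_prim VW p_pr nVp zLp.
- exact: mup_res_prim YZ p_pr nYp zJp.
Qed.

End MupOverMaxP.

Theorem theorem4p5
  (p : nat) (F L Fmp J : fieldType)
  (iL : {rmorphism F -> L}) (iFmp : {rmorphism F -> Fmp})
  (iJ : {rmorphism Fmp -> J})
  (V : valuation_ring F) (l : nat)
  (Y : valuation_ring Fmp) (VY : extends iFmp V Y) :
  prime p -> odd p ->
  p \notin [pchar F] -> ~ has_mup p [set: F] ->
  is_mup_extension p iL ->
  is_max_p_extension p iFmp ->
  is_mup_extension p iJ ->
  p \notin [pchar (residue V)] ->
  [set W : valuation_ring L | extends iL V W] #= `I_l ->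
  [/\ is_max_p_extension p (residue_map VY),
      ~ has_mup p [set: residue V] -> bijective (value_map VY),
      has_mup p [set: residue V] ->
        forall (P : prime_ideal V) (Q : prime_ideal Y)
               (PQ : lies_over iFmp P Q),
        is_mup_prime p P ->
        bijective (value_map (localize_extends VY PQ)) /\
        is_Zinv_tensor p (value_map (quotient_extends VY PQ)),
      [set Z : valuation_ring J | extends iJ Y Z] #= `I_l
    & forall (Z : valuation_ring J) (YZ : extends iJ Y Z),
        is_mup_extension p (residue_map YZ) /\ bijective (value_map YZ)].
Proof.
move=> p_pr _ _ _ mL maxp mJ pV cL.
have nVp : ~ vmax V p%:R by move/residue_natr; have := pchar_natr_neq0 p_pr pV => /negP.
split.
- exact: max_p_residue.
- exact: max_p_value_bij.
- move=> _ P Q PQ mupP; split; first exact: (localize_value_bij VY PQ p_pr nVp maxp mupP).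
  exact: (quotient_value_Zinv VY PQ p_pr nVp maxp mupP).
- apply: card_eq_trans cL; rewrite card_eq_sym.
  exact: mup_extensions_max_p VY p_pr nVp mL maxp mJ.
move=> Z YZ.
have nYp : ~ vmax Y p%:R by rewrite -(rmorph_nat iFmp) (extends_vmax _ VY).
have [|G [z [zp fz]]] := mup_extension_act p_pr _ mJ; first exact: vunit_neq0 nYp.
split; first exact: mup_residue_extension YZ p_pr nYp zp fz.
by apply: value_map_bij => x; exact: (mup_value_surj YZ p_pr nYp zp fz (x:=x)).
Qed.
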